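(* Let $n\in\mathbb{N}$, $P_1,\ldots,P_n\in\mathcal{P}_3$, $\sigma_i:=\sigma(P_i)$, $Q_i:=\frac12(\delta_{-\sigma_i}+\delta_{\sigma_i})$, $\sigma:=\big(\sum_{i=1}^n\sigma_i^2\big)^{1/2}$, and $\varrho_i:=\varrho(P_i)$. Then $$\zeta_3\left(\widetilde{\mathop{\ast}_{i=1}^n P_i},\,\mathrm{N}\right)\ \le\ \frac{1}{6\sigma^3}\sum_{i=1}^n\sigma_i^3B(\varrho_i)+\zeta_3\left(\widetilde{\mathop{\ast}_{i=1}^n Q_i},\,\mathrm{N}\right).$$ Further, if $\sigma_1\ge\sigma_2\ge\ldots\ge\sigma_n$, then $$\zeta_3\left(\widetilde{\mathop{\ast}_{i=1}^n Q_i},\,\mathrm{N}\right)\ \le\ \frac16\left(2\sqrt{\frac2\pi}-1\right)\frac{\sigma_1^3}{\sigma^3}+\frac{1}{6\sqrt{2\pi}}\sum_{k=1}^{n-1}\frac{\sigma_{k+1}^3\min\{1,\sqrt n\,\sigma_{k+1}/\sigma\}}{\sigma^3\sqrt k}\ \le\ 0.0993\cdot\frac{\sigma_1^3}{\sigma^3}+0.0665\sum_{k=1}^{n-1}\frac{\sigma_{k+1}^3}{\sigma^3\sqrt k}.$$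
   Context: $\mathcal{P}_3$ is the set of all probability laws $P$ on $\mathbb{R}$ with $\int|x|^3\,dP(x)<\infty$ and variance $\sigma^2(P)>0$; $\mu(P)$ is the mean and $\sigma(P)$ the standard deviation. For such $P$, the standardization $\widetilde P$ is the image of $P$ under $x\mapsto (x-\mu(P))/\sigma(P)$, and $\varrho(P):=\int\left|\frac{x-\mu(P)}{\sigma(P)}\right|^3dP(x)\ (\ge1)$. $\mathop{\ast}_{i=1}^nP_i$ is the convolution of $P_1,\ldots,P_n$; $\delta_a$ is the one-point law at $a$; $\mathrm{N}$ is the standard normal law; $Pf:=\int f\,dP$. $B(\rho):=\sqrt{\tfrac12\rho^2+\tfrac12\rho\sqrt{\rho^2+8}-2}$ for $\rho\in[1,\infty[$. Zolotarev distance of order 3: for probability laws $P,Q$ on $\mathbb{R}$, $\zeta_3(P,Q):=\sup_{f\in\mathcal{F}_3^\infty}|Pf-Qf|$, where $\mathcal{F}_3^\infty$ is the set of bounded, twice continuously differentiable functions $f:\mathbb{R}\to\mathbb{R}$ with $|f''(x)-f''(y)|\le|x-y|$ for all $x,y\in\mathbb{R}$. *)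

(* Defs.v *)
From HB Require Import structures.
From mathcomp Require Import all_boot all_order all_algebra.
From mathcomp Require Import all_classical all_reals all_analysis.
From mathcomp Require Import measurable_realfun.

Set Implicit Arguments.
Unset Strict Implicit.
Unset Printing Implicit Defensive.

Import Order.TTheory GRing.Theory Num.Theory.
Import numFieldNormedType.Exports.

Local Open Scope classical_set_scope.
Local Open Scope ring_scope.

(* Probability laws on the Borel sets of the real line. *)
Notation law R := (probability (measurableTypeR R) R).

Section moments.
Context {R : realType}.
Implicit Type P : law R.

Definition law_mean P : R := fine 'E_P[(fun x : measurableTypeR R => x : R)].

Definition law_variance P : \bar R :=
  'V_P[(fun x : measurableTypeR R => x : R)].

Definition law_sd P : R := Num.sqrt (fine (law_variance P)).

Definition in_P3 P : Prop :=
  (\int[P]_x ((`|x| ^+ 3)%R)%:E < +oo)%E /\ (0 < law_variance P)%E.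

Definition standardize P (x : measurableTypeR R) : measurableTypeR R :=
  (x - law_mean P) / law_sd P.

Definition law_rho P : R := fine (\int[P]_x (`|standardize P x| ^+ 3)%:E)%E.

End moments.

Section standardization.
Context {R : realType} (P : law R).

Lemma measurable_standardize : measurable_fun [set: _] (standardize P).
Proof. by apply: measurable_funM => //; exact: measurable_funB. Qed.

HB.instance Definition _ :=
  isMeasurableFun.Build _ _ _ _ (standardize P) measurable_standardize.

Definition standardized_law : law R := distribution P (standardize P).

End standardization.

Section convolution.
Context {R : realType}.

Definition add_pair (z : measurableTypeR R * measurableTypeR R) :
  measurableTypeR R := z.1 + z.2.

Lemma measurable_add_pair : measurable_fun [set: _] add_pair.
Proof. exact: measurable_funD. Qed.

HB.instance Definition _ :=
  isMeasurableFun.Build _ _ _ _ add_pair measurable_add_pair.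

Definition convolution (P Q : law R) : law R :=
  distribution (P \x Q)%E add_pair.

(* P_0 * (P_1 * ... * (P_(n-1) * \d_0)); \d_0 is the unit of convolution. *)
Definition convolution_law n (P : 'I_n -> law R) : law R :=
  \big[convolution / (\d_(0 : measurableTypeR R) : law R)]_(i < n) P i.

End convolution.

Section two_point_law.
Context {R : realType} (s : R).

Definition two_point : set (measurableTypeR R) -> \bar R :=
  mscale (2^-1)%:nng (measure_add \d_(- s : measurableTypeR R)
                                  \d_(s : measurableTypeR R)).

HB.instance Definition _ := Measure.on two_point.

Lemma two_pointE (A : set (measurableTypeR R)) :
  two_point A = ((2^-1)%:E * (dirac (- s)%R A + dirac s A))%E.
Proof. by congr (_ * _)%E; exact: measure_addE. Qed.

Lemma two_point_setT : two_point [set: _] = 1%E.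
Proof. by rewrite two_pointE !diracT -EFinD -EFinM mulVf. Qed.

HB.instance Definition _ :=
  Measure_isProbability.Build _ _ R two_point two_point_setT.

End two_point_law.

Definition std_normal {R : realType} : law R := normal_prob 0 1.

Definition F3oo {R : realType} : set (R -> R) :=
  [set f : R -> R |
    [/\ bounded_fun f,
        forall x, derivable f x 1,
        forall x, derivable f^`()%classic x 1,
        continuous f^`(2)%classic &
        forall x y, `|f^`(2)%classic x - f^`(2)%classic y| <= `|x - y|]].

(* The supremum is taken in the extended reals, as it may be infinite. *)
Definition zeta3 {R : realType} (P Q : law R) : \bar R :=
  ereal_sup [set `|\int[P]_x (f x)%:E - \int[Q]_x (f x)%:E|%E | f in F3oo].

Definition Bfun {R : realType} (rho : R) : R :=
  Num.sqrt (rho ^+ 2 / 2 + rho / 2 * Num.sqrt (rho ^+ 2 + 8) - 2).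

(* Main.v *)
Require Import Defs.
From HB Require Import structures.
From mathcomp Require Import all_boot all_order all_algebra.
From mathcomp Require Import all_classical all_reals all_analysis.
From mathcomp Require Import measurable_realfun ring lra.

Set Implicit Arguments.
Unset Strict Implicit.
Unset Printing Implicit Defensive.

Import Order.TTheory GRing.Theory Num.Theory.
Import numFieldNormedType.Exports.

Local Open Scope ring_scope.

(** Since zeta_3 only sees bounded C^2 functions [f] with 1-Lipschitz [f''], the
    laws of a convolution can be replaced one at a time (Lindeberg), the shifted
    and rescaled [f] staying in the same class.

    For one law [P] of mean [m] and standard deviation [s], the replacement by
    the two-point law on [m - s] and [m + s] costs at most [s^3 B(rho) / 6]: for
    some [t] in [-s, s], [f - q] is dominated by [|x - m - t|^3 / 6] with
    equality at [m - s] and [m + s], [q] being a quadratic polynomial that [P]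
    and the two-point law integrate alike.  It remains to prove
    [E |Y - t|^3 <= 1 + 3 t^2 + B(rho)] for standardized [Y] and [|t| <= 1],
    where [1 + 3 t^2] is the value for a random sign.

    Two-point laws are replaced by normal ones in the order of decreasing
    variances.  The first replacement costs [s^3 (E|Z|^3 - 1) / 6].  Before the
    later ones, the normal laws already present have smoothed [f] into
    [x |-> E f (x + tau Z)], whose third derivative is
    [2 / (sqrt (2 pi) tau)]-Lipschitz by Stein's identity, and touching it with
    a fourth-degree polynomial yields a cost [s^4 / (6 sqrt (2 pi) tau)].  When
    the [s_i] decrease, [tau^2 = \sum_(j < k) s_j^2] is at least both
    [k s_k^2] and [k sigma^2 / n]. *)

(** Value and slope at [m - s] and [m + s] impose four conditions on a quadratic with three
    coefficients; [t] is the missing degree of freedom. The conditions are compatible when the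
    trapezoidal rule for [f'] between the two nodes has the same error as for the derivative of the
    cubic. As [t] runs through [-s, s], the error of the cubic sweeps the whole range that the
    Lipschitz constant allows to that of [f]. Domination then follows from the second derivative of
    the difference, decreasing before [t] and increasing after it. Strictness there requires a
    constant [M > L] in front of the cubic, and [M] tends to [L] at the end.

    [B(rho)] is [|E Y^3|] for a standardized two-point law with [E |Y|^3 = rho]. The moment
    inequality is governed by laws with atoms [x], [- y] and 0; a rescaling removes the atom at 0,
    and the growth of [B] pays for the change of [rho].

    Against a normal law [f] may be replaced by its even part, which makes [t = 0]. The constant of
    the smoothed steps comes from [E |Z| = 2 / sqrt (2 pi)] and [E Z^4 - 1 = 2]. *)

(** * Syntax-directed differentiation *)

Section derivation_rules.
Context {R : realType}.
Implicit Types (f g df dg : R -> R) (x : R).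

(* Unlike [is_derive], this is not a class: instance resolution stays out of
   the way of the syntax-directed rules below. *)
Definition has_deriv f (x a : R) : Prop := is_derive x (1 : R) f a.

Lemma is_derive_of f (x a b : R) : has_deriv f x a -> a = b ->
  is_derive x (1 : R) f b.
Proof. by move=> fa <-. Qed.

Lemma has_deriv_cst (a x : R) : has_deriv (fun _ => a) x 0.
Proof. exact: is_derive_cst. Qed.

Lemma has_deriv_id x : has_deriv (fun y => y) x 1.
Proof. exact: is_derive_id. Qed.

Lemma has_derivD f g (a b x : R) : has_deriv f x a -> has_deriv g x b ->
  has_deriv (fun y => f y + g y) x (a + b).
Proof. by rewrite /has_deriv => fa gb; exact: is_deriveD. Qed.

Lemma has_derivN f (a x : R) : has_deriv f x a ->
  has_deriv (fun y => - f y) x (- a).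
Proof. by rewrite /has_deriv => fa; exact: is_deriveN. Qed.

Lemma has_derivM f g (a b x : R) : has_deriv f x a -> has_deriv g x b ->
  has_deriv (fun y => f y * g y) x (a * g x + f x * b).
Proof.
rewrite /has_deriv => fa gb; apply: is_derive_eq.
by rewrite /GRing.scale /= addrC mulrC.
Qed.

Lemma has_derivX f n (a x : R) : has_deriv f x a ->
  has_deriv (fun y => f y ^+ n.+1) x (n.+1%:R * f x ^+ n * a).
Proof.
move=> fa; elim: n => [|n IH].
  rewrite expr0 mulr1 mul1r; under eq_fun do rewrite expr1.
  exact: fa.
under eq_fun do rewrite exprS.
apply: is_derive_of (has_derivM fa IH) _.
by rewrite -[n.+2%:R]natr1 [f x ^+ n.+1]exprS; ring.
Qed.

Lemma has_deriv_comp g dg f (a x : R) :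
  (forall y : R, is_derive y (1 : R) g (dg y)) ->
  has_deriv f x a -> has_deriv (fun y => g (f y)) x (dg (f x) * a).
Proof. by move=> gd fa; exact: is_derive1_comp. Qed.

End derivation_rules.

(** Derivatives of opaque functions are taken from universally quantified [is_derive] hypotheses in
    the context, so these have to be introduced, under a name for the function, before the call. The
    goal left over equates the computed derivative with the announced one. *)
Ltac derive_tac := refine (is_derive_of _ _);
  [ repeat first
    [ exact: has_deriv_cst | exact: has_deriv_id
    | match goal with H : forall _, is_derive _ _ _ _ |- _ =>
        first [exact: H | apply: (has_deriv_comp H)] end
    | apply: has_derivD | apply: has_derivN
    | apply: has_derivX | apply: has_derivM ]
  | rewrite /= ].

(** * Mean value arguments, Taylor bounds and the class of test functions *)

Section calculus.
Context {R : realType}.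
Implicit Types f g : R -> R.

Lemma MVT_is_derive (f df : R -> R) (a b : R) : a < b ->
  (forall x : R, is_derive x (1 : R) f (df x)) ->
  exists2 c, a < c < b & f b - f a = df c * (b - a).
Proof.
move=> ab fd; have [|c] := MVT ab (fun x _ => fd x).
  by apply: derivable_within_continuous => x _; exact: ex_derive.
by rewrite in_itv /= => acb E; exists c.
Qed.

Lemma is_derive_cvg (f df : R -> R) : (forall x : R, is_derive x (1 : R) f (df x)) ->
  continuous f.
Proof.
move=> fd x; apply/differentiable_continuous/derivable1_diffP.
exact: ex_derive.
Qed.

Lemma is_derive_mono (f df : R -> R) (a b : R) : a <= b ->
  (forall x : R, is_derive x (1 : R) f (df x)) -> (forall x, a < x < b -> 0 <= df x) ->
  f a <= f b.
Proof.
rewrite le_eqVlt => /predU1P[->//|ab] fd dfge0.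
have [c cab E] := MVT_is_derive ab fd.
by rewrite -subr_ge0 E mulr_ge0 ?subr_ge0 ?(ltW ab) ?dfge0.
Qed.

(** On the half line [f] is compared with the primitive of [c * x ^+ n]; sign changes and reflection
    do the rest. Iteration yields Taylor remainders one order at a time, without integrals. *)
Lemma is_derive_pow_bound (f df : R -> R) (c : R) (n : nat) :
  (forall x : R, is_derive x (1 : R) f (df x)) -> f 0 = 0 ->
  (forall x, `|df x| <= c * `|x| ^+ n) ->
  forall x, `|f x| <= c * `|x| ^+ n.+1 / n.+1%:R.
Proof.
move=> fd f0 dfle.
have pos (g dg : R -> R) : (forall x : R, is_derive x (1 : R) g (dg x)) -> g 0 = 0 ->
    (forall x, `|dg x| <= c * `|x| ^+ n) ->
    forall x, 0 <= x -> g x <= c * x ^+ n.+1 / n.+1%:R.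
  move=> gd g0 dgle x x0.
  pose h y := c / n.+1%:R * y ^+ n.+1 - g y.
  have hd (y : R) : is_derive y (1 : R) h (c * y ^+ n - dg y).
    have n0 : n.+1%:R != 0 :> R by rewrite pnatr_eq0.
    by derive_tac; field; rewrite nat1r.
  have : h 0 <= h x.
    apply: (is_derive_mono x0 hd) => y /andP[y0 _]; rewrite subr_ge0.
    by rewrite (le_trans (ler_norm _)) // (le_trans (dgle y)) // gtr0_norm.
  rewrite /h g0 expr0n mulr0 subr0 subr_ge0 => /le_trans; apply.
  by rewrite mulrAC.
have both (g dg : R -> R) : (forall x : R, is_derive x (1 : R) g (dg x)) -> g 0 = 0 ->
    (forall x, `|dg x| <= c * `|x| ^+ n) ->
    forall x, 0 <= x -> `|g x| <= c * x ^+ n.+1 / n.+1%:R.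
  move=> gd g0 dgle x x0; rewrite ler_norml (pos _ _ gd) // andbT lerNl.
  apply: (pos (fun y => - g y) (fun y => - dg y)) => //.
  - by rewrite g0 oppr0.
  - by move=> y; rewrite normrN.
move=> x; have [x0|x0] := leP 0 x.
  by rewrite (ger0_norm x0); exact: (both _ _ fd f0 dfle x x0).
have gd (y : R) : is_derive y (1 : R) (fun y => f (- y)) (- df (- y)).
  by derive_tac; rewrite mulrN1.
have := both _ _ gd _ _ (- x) _; rewrite opprK (ltr0_norm x0); apply.
- by rewrite oppr0.
- by move=> y; rewrite normrN -(normrN y).
- by rewrite oppr_ge0 ltW.
Qed.

(** A quadratic remainder bound replaces a passage to the limit, both for functions whose next
    derivative has a kink and for differentiation under an expectation. *)
Lemma is_derive_sqr_remainder f (d c x : R) :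
  (forall h, `|f (x + h) - f x - h * d| <= c * h ^+ 2) ->
  is_derive x (1 : R) f d.
Proof.
move=> fle; have c0 : 0 <= c.
  by have := le_trans (normr_ge0 _) (fle 1); rewrite expr1n mulr1.
have C : ((fun h : R => h^-1 *: (f (h *: (1 : R) + x) - f x)) @ 0^' --> d)%classic.
  apply/cvgrPdist_le => e e0; near=> h.
  have h0 : h != 0 by near: h; exact: nbhs_dnbhs_neq.
  have -> : h^-1 *: (f (h *: 1 + x) - f x) =
      h^-1 * (f (x + h) - f x - h * d) + d.
    by rewrite /GRing.scale /= mulr1 (addrC h); field.
  rewrite opprD addrCA subrr addr0 normrN normrM normfV.
  rewrite ler_pdivrMl ?normr_gt0 // (le_trans (fle h)) //.
  rewrite -real_normK ?num_real // expr2 mulrCA ler_wpM2l // mulrC.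
  have : `|h| <= e / (c + 1).
    near: h; apply: dnbhs0_le; rewrite divr_gt0 // ltr_wpDl //.
  rewrite ler_pdivlMr ?ltr_wpDl // => /(le_trans _); apply.
  by rewrite mulrDr mulr1 lerDl.
by apply: DeriveDef; [exact: cvgP C | exact: cvg_lim C].
Unshelve. all: by end_near. Qed.

Lemma is_derive_id_norm (x : R) :
  is_derive x (1 : R) (fun y => y * `|y|) (2 * `|x|).
Proof.
apply: (@is_derive_sqr_remainder _ _ 2) => h; rewrite ler_norml.
case: (ger0P x) => x0; case: (ger0P (x + h)) => xh0; apply/andP; split; nra.
Qed.

Lemma is_derive_norm3 (x : R) :
  is_derive x (1 : R) (fun y => `|y| ^+ 3) (3 * (x * `|x|)).
Proof.
have E : (fun y : R => `|y| ^+ 3) = (fun y => y * (y * `|y|)).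
  apply/funext => y; rewrite exprSr real_normK ?num_real //; ring.
have := is_derive_id_norm; rewrite E => H.
by derive_tac; ring.
Qed.

Lemma MVT_eq f df (a b : R) : (forall x : R, is_derive x (1 : R) f (df x)) ->
  a < b -> f a = f b -> exists2 c, a < c < b & df c = 0.
Proof.
move=> fd ab E; have [c cab] := MVT_is_derive ab fd.
rewrite E subrr => /esym/eqP; rewrite mulf_eq0 subr_eq0 (gt_eqF ab) orbF.
by move/eqP => ?; exists c.
Qed.

Lemma MVT_lt f df (a b : R) : (forall x : R, is_derive x (1 : R) f (df x)) ->
  a < b -> f a < f b -> exists2 c, a < c < b & 0 < df c.
Proof.
move=> fd ab E; have [c cab] := MVT_is_derive ab fd => Ec; exists c => //.
by move: E; rewrite -subr_gt0 Ec pmulr_lgt0 // subr_gt0.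
Qed.

Lemma MVT_gt f df (a b : R) : (forall x : R, is_derive x (1 : R) f (df x)) ->
  a < b -> f b < f a -> exists2 c, a < c < b & df c < 0.
Proof.
move=> fd ab E; have [c cab] := MVT_is_derive ab fd => Ec; exists c => //.
by move: E; rewrite -subr_lt0 Ec pmulr_llt0 // subr_gt0.
Qed.

(* Rolle gives two zeros of [g2] inside the interval; a negative value of [g]
   would force a sign pattern of [g2] that quasiconvexity forbids. *)
Lemma quasiconvex_hermite_ge0 (g g1 g2 : R -> R) (s : R) : 0 < s ->
  (forall x : R, is_derive x (1 : R) g (g1 x)) ->
  (forall x : R, is_derive x (1 : R) g1 (g2 x)) ->
  g s = 0 -> g (- s) = 0 -> g1 s = 0 -> g1 (- s) = 0 ->
  (forall a b c, a < b -> b < c -> g2 b < Num.max (g2 a) (g2 c)) ->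
  forall x, 0 <= g x.
Proof.
move=> s0 gd g1d gs gNs g1s g1Ns qc x.
have Nss : - s < s by lra.
have [c /andP[c1 c2] g1c] := MVT_eq gd Nss (etrans gNs (esym gs)).
have [p1 /andP[p11 p12] g2p1] := MVT_eq g1d c1 (etrans g1Ns (esym g1c)).
have [p2 /andP[p21 p22] g2p2] := MVT_eq g1d c2 (etrans g1c (esym g1s)).
rewrite leNgt; apply/negP => gx.
(* Beyond [s], [g] leaves 0 downwards, so [g1] and then [g2] turn negative: [g2] is 0, 0 and
   negative at three successive points. The last case, left of [- s], is the mirror image. *)
have [sx|xs|xs] := ltgtP s x; last by move: gx; rewrite -xs gs ltxx.
  have [|y /andP[y1 y2] gy] := MVT_gt gd sx; first by rewrite gs.
  have [|z /andP[z1 z2] gz] := MVT_gt g1d y1; first by rewrite g1s.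
  have := qc p1 p2 z (lt_trans p12 p21) (lt_trans p22 z1).
  by rewrite g2p1 g2p2 lt_max ltxx /= => /lt_trans /(_ gz); rewrite ltxx.
(* Between the nodes [g] dips and comes back: [g1] is successively 0, negative, positive and 0,
   hence [g2] negative, positive and negative. *)
have [sx|xNs|xNs] := ltgtP (- s) x; last by move: gx; rewrite -xNs gNs ltxx.
  have [|y1 /andP[y11 y12] gy1] := MVT_gt gd sx; first by rewrite gNs.
  have [|y2 /andP[y21 y22] gy2] := MVT_lt gd xs; first by rewrite gs.
  have [|z1 /andP[z11 z12] gz1] := MVT_gt g1d y11; first by rewrite g1Ns.
  have y12' : y1 < y2 by exact: lt_trans y21.
  have [|z2 /andP[z21 z22] gz2] := MVT_lt g1d y12'.
    exact: lt_trans gy2.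
  have [|z3 /andP[z31 z32] gz3] := MVT_gt g1d y22; first by rewrite g1s.
  have := qc z1 z2 z3 (lt_trans z12 z21) (lt_trans z22 z31).
  rewrite lt_max => /orP[] /(lt_trans gz2) => H.
    by have := lt_trans H gz1; rewrite ltxx.
  by have := lt_trans H gz3; rewrite ltxx.
have [|y /andP[y1 y2] gy] := MVT_lt gd xNs; first by rewrite gNs.
have [|z /andP[z1 z2] gz] := MVT_gt g1d y2; first by rewrite g1Ns.
have := qc z p1 p2 (lt_trans z2 p11) (lt_trans p12 p21).
by rewrite g2p1 g2p2 lt_max ltxx orbF => /lt_trans /(_ gz); rewrite ltxx.
Qed.

(** This is [F3oo] with the derivatives as arguments and a free Lipschitz constant, because
    rescaling the variable by [a] multiplies that constant by [|a| ^+ 3]. *)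
Definition C2lip (L : R) (f f1 f2 : R -> R) : Prop :=
  [/\ (exists M : R, forall x, `|f x| <= M),
      forall x : R, is_derive x (1 : R) f (f1 x),
      forall x : R, is_derive x (1 : R) f1 (f2 x) &
      forall x y, `|f2 x - f2 y| <= L * `|x - y|].

Lemma C2lip_ge0 (L : R) (f f1 f2 : R -> R) : C2lip L f f1 f2 -> 0 <= L.
Proof.
case=> _ _ _ /(_ 1 0) /(le_trans (normr_ge0 _)).
by rewrite subr0 normr1 mulr1.
Qed.

Lemma C2lip_opp (L : R) (f f1 f2 : R -> R) : C2lip L f f1 f2 ->
  C2lip L (fun x => - f x) (fun x => - f1 x) (fun x => - f2 x).
Proof.
case=> -[M fM] fd f1d f2L; split.
- by exists M => x; rewrite normrN.
- by move=> x; derive_tac; rewrite ?mulr1.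
- by move=> x; derive_tac; rewrite ?mulr1.
- by move=> x y; rewrite -opprD normrN.
Qed.

Lemma C2lip_affine (L a b : R) (f f1 f2 : R -> R) : C2lip L f f1 f2 ->
  C2lip (L * `|a| ^+ 3) (fun x => f (a * x + b)) (fun x => a * f1 (a * x + b))
    (fun x => a ^+ 2 * f2 (a * x + b)).
Proof.
case=> -[M fM] fd f1d f2L; split.
- by exists M => x.
- by move=> x; derive_tac; ring.
- by move=> x; derive_tac; ring.
- move=> x y; rewrite -mulrBr normrM normrX.
  have -> : L * `|a| ^+ 3 * `|x - y| = `|a| ^+ 2 * (L * `|a * (x - y)|).
    by rewrite normrM; ring.
  rewrite ler_wpM2l ?exprn_ge0 //; apply: le_trans (f2L _ _) _.
  by rewrite opprD addrACA subrr addr0 mulrBr.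
Qed.

Lemma C2lip_shift (L b : R) (f f1 f2 : R -> R) : C2lip L f f1 f2 ->
  C2lip L (fun x => f (x + b)) (fun x => f1 (x + b)) (fun x => f2 (x + b)).
Proof.
move=> /(C2lip_affine 1 b); rewrite normr1 expr1n mulr1.
rewrite expr1n.
have E (g : R -> R) : (fun x => 1 * g (1 * x + b)) = (fun x => g (x + b)).
  by apply/funext => x; rewrite !mul1r.
by rewrite !E; under eq_fun do rewrite mul1r.
Qed.

Lemma C2lip_taylor1 (L : R) (f f1 f2 : R -> R) : C2lip L f f1 f2 ->
  forall x h, `|f1 (x + h) - f1 x - h * f2 x| <= L / 2 * `|h| ^+ 2.
Proof.
case=> _ fd f1d f2L x.
have H (h : R) : is_derive h (1 : R) (fun h => f1 (x + h) - f1 x - h * f2 x)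
    (f2 (x + h) - f2 x).
  by derive_tac; ring.
move=> h; rewrite mulrAC; apply: (is_derive_pow_bound H).
  by rewrite addr0 subrr mul0r subrr.
move=> k; rewrite expr1 (le_trans (f2L _ _)) //.
by rewrite addrAC subrr add0r.
Qed.

Lemma C2lip_taylor2 (L : R) (f f1 f2 : R -> R) : C2lip L f f1 f2 ->
  forall x h,
  `|f (x + h) - f x - h * f1 x - h ^+ 2 / 2 * f2 x| <= L / 6 * `|h| ^+ 3.
Proof.
move=> fL x; have T := C2lip_taylor1 fL x; case: fL => _ fd f1d f2L.
have H (h : R) : is_derive h (1 : R)
    (fun h => f (x + h) - f x - h * f1 x - h ^+ 2 / 2 * f2 x)
    (f1 (x + h) - f1 x - h * f2 x).
  by derive_tac; field.
move=> h; have -> : L / 6 * `|h| ^+ 3 = L / 2 * `|h| ^+ 3 / 3 by field.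
apply: (is_derive_pow_bound H) => //.
by rewrite addr0 expr0n /=; ring.
Qed.

(** The Taylor expansions for the steps 1 and -1 bound [f1] when subtracted and [f2] when added.
    Both derivatives thereby become integrable under every law. *)
Lemma C2lip_bounded (L : R) (f f1 f2 : R -> R) : C2lip L f f1 f2 ->
  exists M : R, [/\ forall x, `|f x| <= M, forall x, `|f1 x| <= M &
    forall x, `|f2 x| <= M].
Proof.
move=> fL; have T := C2lip_taylor2 fL; have L0 := C2lip_ge0 fL.
case: fL => -[M fM] _ _ _.
have B x : [/\ `|f x| <= M, `|f1 x| <= 4 * M + L & `|f2 x| <= 4 * M + L].
  have := T x 1; have := T x (- 1); have := fM x; have := fM (x + 1).
  have := fM (x - 1); rewrite normrN normr1 sqrrN !expr1n !ler_norml.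
  move=> /andP[? ?] /andP[? ?] /andP[? ?] /andP[? ?] /andP[? ?].
  by split; apply/andP; split; lra.
have M0 : 0 <= M by apply: le_trans (fM 0).
exists (4 * M + L); split=> x; have [b0 b1 b2] := B x => //.
by apply: le_trans b0 _; lra.
Qed.

End calculus.

(** * Quadratic polynomials touching a function from below at two points *)

Section touching.
Context {R : realType}.
Implicit Types f g k : R -> R.

Lemma quasiconvex_of_mono (k : R -> R) (t : R) :
  (forall a b, a < b -> b <= t -> k b < k a) ->
  (forall a b, t <= a -> a < b -> k a < k b) ->
  forall a b c, a < b -> b < c -> k b < Num.max (k a) (k c).
Proof.
move=> kd ki a b c ab bc; rewrite lt_max.
by have [bt|/ltW tb] := leP b t; [rewrite kd | rewrite (ki b c) // orbT].
Qed.

(* [q] is the quadratic Hermite interpolant of [k] at the nodes [-s] and [s];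
   the hypothesis on [k1] makes the four conditions compatible. *)
Lemma quadratic_touching (k k1 k2 : R -> R) (s : R) : 0 < s ->
  (forall x : R, is_derive x (1 : R) k (k1 x)) ->
  (forall x : R, is_derive x (1 : R) k1 (k2 x)) ->
  s * (k1 s + k1 (- s)) = k s - k (- s) ->
  (forall a b c, a < b -> b < c -> k2 b < Num.max (k2 a) (k2 c)) ->
  exists q0 q1 q2 : R, let q x := q0 + q1 * x + q2 * x ^+ 2 in
    [/\ forall x, q x <= k x, q s = k s & q (- s) = k (- s)].
Proof.
move=> s0 kd k1d compat qc; have sN0 : s != 0 by rewrite gt_eqF.
pose q1 := (k s - k (- s)) / (2 * s); pose q2 := (k1 s - k1 (- s)) / (4 * s).
pose q0 := (k s + k (- s)) / 2 - q2 * s ^+ 2.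
exists q0, q1, q2; move=> q.
have qs : q s = k s by rewrite /q /q0 /q1 /q2; field.
have qNs : q (- s) = k (- s) by rewrite /q /q0 /q1 /q2; field.
split=> // x; rewrite -subr_ge0; move: x.
have E : k s - k (- s) = s * (k1 s + k1 (- s)) by [].
apply: (@quasiconvex_hermite_ge0 _ (fun x => k x - q x)
  (fun x => k1 x - (q1 + 2 * q2 * x)) (fun x => k2 x - 2 * q2) s s0).
- by move=> x; rewrite /q; derive_tac; ring.
- by move=> x; derive_tac; ring.
- by rewrite qs subrr.
- by rewrite qNs subrr.
- by rewrite /q1 /q2 E; field.
- by rewrite /q1 /q2 E; field.
- move=> a b c ab bc; have := qc a b c ab bc.
  by rewrite !lt_max !ltrD2r.
Qed.

(** The quantity is the error of the trapezoidal rule for the integral of [f1] over [-s, s], and its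
    vanishing is the compatibility condition of [quadratic_touching]. Its derivative in [s] is
    [s * (f2 s - f2 (- s))]. *)
Lemma C2lip_defect_le (L : R) (f f1 f2 : R -> R) : C2lip L f f1 f2 ->
  forall s, `|s * (f1 s + f1 (- s)) - (f s - f (- s))| <= 2 / 3 * L * `|s| ^+ 3.
Proof.
case=> _ fd f1d f2L s.
have H (x : R) : is_derive x (1 : R)
    (fun s => s * (f1 s + f1 (- s)) - (f s - f (- s)))
    (x * (f2 x - f2 (- x))).
  by derive_tac; ring.
have -> : 2 / 3 * L * `|s| ^+ 3 = (2 * L) * `|s| ^+ 3 / 3 by field.
apply: (is_derive_pow_bound H); first by rewrite oppr0; ring.
move=> x; rewrite normrM; apply: le_trans (ler_wpM2l _ (f2L _ _)) _ => //.
by rewrite opprK -mulr2n normrMn -mulr_natl; lra.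
Qed.

(** The intermediate value theorem chooses [t] so that the trapezoidal errors of the cubic and of
    [f] cancel in [k]. The bound of [C2lip_defect_le] guarantees that the value to be reached lies
    between those at the two ends. *)
Lemma cubic_touching (L M s : R) (f f1 f2 : R -> R) : C2lip L f f1 f2 ->
  L < M -> 0 < s ->
  exists2 t, - s <= t <= s &
    exists q0 q1 q2 : R, let q x := q0 + q1 * x + q2 * x ^+ 2 in
    let k x := M / 6 * `|x - t| ^+ 3 - f x in
    [/\ forall x, q x <= k x, q s = k s & q (- s) = k (- s)].
Proof.
move=> fL LM s0; have D := C2lip_defect_le fL s; have L0 := C2lip_ge0 fL.
pose T := s * (f1 s + f1 (- s)) - (f s - f (- s)).
(* [g t] is the trapezoidal error of [M / 6 * |x - t| ^+ 3] for [t] in [-s, s]; at the ends it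
   equals [2 / 3 * M * s ^+ 3] up to sign. *)
pose g t := M * (t ^+ 3 / 3 - s ^+ 2 * t).
have gd (x : R) : is_derive x (1 : R) g (M * (x ^+ 2 - s ^+ 2)).
  by rewrite /g; derive_tac; field.
have s3 : 0 < s ^+ 3 by rewrite exprn_gt0.
have gNs : g (- s) = 2 / 3 * M * s ^+ 3 by rewrite /g; field.
have gs : g s = - (2 / 3 * M * s ^+ 3) by rewrite /g; field.
have [|||t tin gt] := @IVT _ g (- s) s T.
- by lra.
- apply: continuous_subspaceT; exact: is_derive_cvg gd.
- move: D; rewrite -/T (gtr0_norm s0) ler_norml => /andP[T1 T2].
  have LMs : L * s ^+ 3 <= M * s ^+ 3 by rewrite ler_pM2r // ltW.
  rewrite ge_min le_max gNs gs; apply/andP; split; apply/orP; [right|left];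
  lra.
move: tin; rewrite in_itv /= => /andP[tl tr]; exists t; first by rewrite tl.
have n3 := @is_derive_norm3 R; have n2 := @is_derive_id_norm R.
case: fL => _ fd f1d f2L.
pose k x := M / 6 * `|x - t| ^+ 3 - f x.
pose k1 x := M / 2 * ((x - t) * `|x - t|) - f1 x.
pose k2 x := M * `|x - t| - f2 x.
have kd (x : R) : is_derive x (1 : R) k (k1 x).
  (* The cube of the norm is named so that [derive_tac] finds its derivative among the hypotheses
     and applies the chain rule. *)
  pose h (y : R) := `|y| ^+ 3.
  have hd (y : R) : is_derive y (1 : R) h (3 * (y * `|y|)) by exact: n3.
  rewrite (_ : k = (fun x => M / 6 * h (x - t) - f x)) // /k1.
  by derive_tac; field.
have k1d (x : R) : is_derive x (1 : R) k1 (k2 x).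
  pose h (y : R) := y * `|y|.
  have hd (y : R) : is_derive y (1 : R) h (2 * `|y|) by exact: n2.
  rewrite (_ : k1 = (fun x => M / 2 * h (x - t) - f1 x)) // /k2.
  by derive_tac; field.
have compat : s * (k1 s + k1 (- s)) = k s - k (- s).
  rewrite /k /k1 ger0_norm ?subr_ge0 // ler0_norm; last by lra.
  move: gt; rewrite /g /T; set u := f s; set v := f (- s) => gt.
  have -> : s * (M / 2 * ((s - t) * (s - t)) - f1 s +
     (M / 2 * ((- s - t) * - (- s - t)) - f1 (- s))) =
     M / 2 * s * ((s - t) ^+ 2 - (s + t) ^+ 2) - s * (f1 s + f1 (- s)).
    by field.
  have -> : s * (f1 s + f1 (- s)) = M * (t ^+ 3 / 3 - s ^+ 2 * t) + (u - v).
    by rewrite gt subrK.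
  by field.
(* The slope [M] of [M * |x - t|] outweighs the variation of [f2], which is at most [L] per unit
   length. *)
have qc : forall a b c, a < b -> b < c -> k2 b < Num.max (k2 a) (k2 c).
  apply: (@quasiconvex_of_mono _ t) => a b.
    move=> ab bt; have := f2L a b; rewrite /k2.
    have bt0 : b - t <= 0 by lra.
    have at0 : a - t <= 0 by lra.
    have ba : a - b <= 0 by lra.
    rewrite (ler0_norm bt0) (ler0_norm at0) (ler0_norm ba).
    rewrite ler_norml => /andP[? ?].
    have : L * (b - a) < M * (b - a) by rewrite ltr_pM2r // subr_gt0.
    by lra.
  move=> ta ab; have := f2L b a; rewrite /k2.
  have bt : 0 <= b - t by lra.
  have at0 : 0 <= a - t by lra.
  have ba : 0 <= b - a by lra.
  rewrite (ger0_norm bt) (ger0_norm at0) (ger0_norm ba).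
  rewrite ler_norml => /andP[? ?].
  have : L * (b - a) < M * (b - a) by rewrite ltr_pM2r // subr_gt0.
  by lra.
exact: (quadratic_touching s0 kd k1d compat qc).
Qed.

(** Evenness makes the compatibility condition trivial and places the minimum of [k2] at 0. *)
Lemma even_touching (k k1 k2 : R -> R) (s : R) : 0 < s ->
  (forall x : R, is_derive x (1 : R) k (k1 x)) ->
  (forall x : R, is_derive x (1 : R) k1 (k2 x)) ->
  (forall x, k (- x) = k x) -> (forall x, k1 (- x) = - k1 x) ->
  (forall x, k2 (- x) = k2 x) ->
  (forall a b, 0 <= a -> a < b -> k2 a < k2 b) ->
  exists q0 q1 q2 : R, let q x := q0 + q1 * x + q2 * x ^+ 2 in
    [/\ forall x, q x <= k x, q s = k s & q (- s) = k (- s)].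
Proof.
move=> s0 kd k1d ke k1o k2e ki; apply: (quadratic_touching s0 kd k1d).
  by rewrite k1o ke !subrr mulr0.
apply: (quasiconvex_of_mono (t := 0)) => // a b ab b0.
by rewrite -k2e -(k2e a); apply: ki; rewrite ?oppr_ge0 ?ltrN2.
Qed.

End touching.

(** * The function B and two-point laws *)

Section Bfun_theory.
Context {R : realType}.
Implicit Types (x y t d rho lam : R).

(** [d] is the positive root of [d ^+ 2 - rho * d - 2], which makes [rho ^+ 2 + 8] the square of
    [d + 2 / d] and removes the inner root. *)
Lemma Bfun_param d : 2 <= d -> Bfun (d - 2 / d) = Num.sqrt (d ^+ 2 - 4).
Proof.
move=> d2; have d0 : d != 0 by lra.
have dp : 0 <= d + 2 / d by rewrite addr_ge0 // ?divr_ge0 //; lra.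
rewrite /Bfun (_ : (d - 2 / d) ^+ 2 + 8 = (d + 2 / d) ^+ 2); last by field.
by rewrite sqrtr_sqr ger0_norm //; congr Num.sqrt; field.
Qed.

Lemma Bfun_paramP rho : 1 <= rho ->
  exists d, [/\ 2 <= d, rho = d - 2 / d &
    forall rho', rho <= rho' -> exists d', d <= d' /\ rho' = d' - 2 / d'].
Proof.
move=> rho1; pose r x : R := Num.sqrt (x ^+ 2 + 8); pose D x : R := (x + r x) / 2.
have r2 x : r x ^+ 2 = x ^+ 2 + 8 by rewrite sqr_sqrtr // addr_ge0 ?sqr_ge0.
have r3 x : 1 <= x -> 3 <= r x.
  move=> x1; rewrite -(@ler_pXn2r _ 2) ?nnegrE ?sqrtr_ge0 // r2.
  by nra.
have DE x : 1 <= x -> x = D x - 2 / D x.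
  move=> x1; have D0 : D x != 0 by have := r3 x x1; rewrite /D; lra.
  apply: (mulIf D0); rewrite mulrBl divfK // /D; have := r2 x; lra.
exists (D rho); split; [by have := r3 _ rho1; rewrite /D; lra|exact: DE|].
move=> x rx; exists (D x); split; last by apply: DE; exact: le_trans rx.
rewrite /D ler_pM2r ?invr_gt0 // lerD // /r ler_wsqrtr // lerD2r.
by rewrite ler_pXn2r // nnegrE; lra.
Qed.

(* Parametrized by [rho = d - 2 / d], where [B = sqrt (d ^ 2 - 4) <= rho]. *)
Lemma Bfun_expansive rho rho' : 1 <= rho -> rho <= rho' ->
  Bfun rho + (rho' - rho) <= Bfun rho'.
Proof.
move=> rho1 rr; have [d [d2 E H]] := Bfun_paramP rho1.
have [d' [dd' E']] := H _ rr; rewrite E E' {rho rho' E E' rho1 rr H}.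
have d'2 : 2 <= d' by exact: le_trans dd'.
rewrite !Bfun_param //; set b := Num.sqrt (d ^+ 2 - 4).
set b' := Num.sqrt (d' ^+ 2 - 4).
have b0 : 0 <= b by exact: sqrtr_ge0.
have b'0 : 0 <= b' by exact: sqrtr_ge0.
have bE : b ^+ 2 = d ^+ 2 - 4 by rewrite sqr_sqrtr //; nra.
have b'E : b' ^+ 2 = d' ^+ 2 - 4 by rewrite sqr_sqrtr //; nra.
have le2 z y : 2 <= z -> 0 <= y -> y ^+ 2 = z ^+ 2 - 4 -> y <= z - 2 / z.
  move=> z2 y0 yE; have z0 : 0 < z by lra.
  have zz : 0 <= z - 2 / z by rewrite subr_ge0 ler_pdivrMr //; nra.
  rewrite -(@ler_pXn2r _ 2) ?nnegrE // yE.
  rewrite (_ : (z - 2 / z) ^+ 2 = z ^+ 2 - 4 + (2 / z) ^+ 2); last first.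
    by field; rewrite gt_eqF.
  by rewrite lerDl sqr_ge0.
have h := le2 _ _ d2 b0 bE; have h' := le2 _ _ d'2 b'0 b'E.
have d0 : 0 < d by lra.
have d'0 : 0 < d' by lra.
have p0 : 0 < d * d' by rewrite mulr_gt0.
have -> : d' - 2 / d' - (d - 2 / d) = (d' - d) * (1 + 2 / (d * d')).
  by field; rewrite !gt_eqF.
have [dE|dlt] := eqVneq d d'.
  by rewrite /b /b' dE subrr mul0r addr0.
have {}dlt : d < d' by rewrite lt_neqAle dlt.
have bb : 0 < b + b'.
  rewrite ltr_wpDl // lt_neqAle b'0 andbT; apply/eqP => b'z.
  by move: b'E; rewrite -b'z expr0n /=; nra.
(* Multiplication by [b + b'] turns the difference of roots into [d' ^+ 2 - d ^+ 2]. With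
   [u = 2 / (d * d')] the claim becomes [(1 + u) * (b + b') <= d + d'], and the bounds [h], [h'] add
   up to [b + b' <= (d + d') * (1 - u)]. *)
rewrite addrC -lerBrDr -(ler_pM2r bb).
have -> : (b' - b) * (b + b') = (d' - d) * (d' + d).
  by rewrite -(subr0 (d' ^+ 2)) in b'E *; nra.
rewrite -mulrA ler_pM2l ?subr_gt0 //.
have hs : b + b' <= (d + d') * (1 - 2 / (d * d')).
  apply: le_trans (lerD h h') _; rewrite le_eqVlt; apply/orP; left; apply/eqP.
  by field; rewrite !gt_eqF.
have u0 : 0 < 1 + 2 / (d * d') by rewrite addr_gt0 // divr_gt0.
apply: le_trans (ler_wpM2l (ltW u0) hs) _.
have -> : (1 + 2 / (d * d')) * ((d + d') * (1 - 2 / (d * d'))) =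
  (d + d') - (d + d') * (2 / (d * d')) ^+ 2 by field; rewrite !gt_eqF.
rewrite (addrC d') lerBlDr lerDl mulr_ge0 ?sqr_ge0 //; lra.
Qed.

(** The standardized law on [x] and [- x^-1] gives mass [1 / (1 + x ^+ 2)] to [x]. The argument of
    [Bfun] is its absolute third moment, and [x - x^-1] is its third moment. *)
Lemma Bfun_reciprocal x : 0 < x ->
  Bfun ((x ^+ 2 + x ^- 2) / (x + x^-1)) = `|x - x^-1|.
Proof.
move=> x0; have xN0 : x != 0 by rewrite gt_eqF.
have dE : x + x^-1 = (x ^+ 2 + 1) / x by field.
have x2 : x ^+ 2 + 1 != 0 by rewrite gt_eqF // ltr_wpDl ?sqr_ge0.
rewrite (_ : _ / _ = (x + x^-1) - 2 / (x + x^-1)); last first.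
  by field; rewrite xN0 -expr2 x2.
rewrite Bfun_param; last first.
  by rewrite dE ler_pdivlMr //; have := sqr_ge0 (x - 1); lra.
rewrite -sqrtr_sqr; congr Num.sqrt; field => //.
Qed.

(** For [Y] distributed on [x] and [- x^-1] as in [Bfun_reciprocal], this is
    [E |Y - t|^3 <= 1 + 3 t^2 + |E Y^3|], rewritten by means of [|z|^3 = 2 max(0, z)^3 - z^3]; the
    negative atom does not contribute to the positive part. *)
Lemma two_point_base x t : 0 < x -> 0 <= t <= 1 ->
  x^-1 - x + 2 * Num.max 0 (x - t) ^+ 3 / (x ^+ 2 + 1) <=
  (1 - t) ^+ 3 + `|x - x^-1|.
Proof.
move=> x0 /andP[t0 t1].
have x2 : 0 < x ^+ 2 + 1 by rewrite ltr_wpDl ?sqr_ge0.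
set p := Num.max 0 (x - t).
have p0 : 0 <= p by rewrite /p le_max lexx.
have w0 : 0 <= 1 - t by lra.
have [x1|x1] := leP x 1.
  have xV : 1 <= x^-1 by rewrite invf_ge1.
  rewrite ler0_norm; last by lra.
  have pw : p <= x * (1 - t) by rewrite /p ge_max mulr_ge0 ?(ltW x0) //=; nra.
  have p3 : p ^+ 3 <= x ^+ 3 * (1 - t) ^+ 3.
    by rewrite -exprMn ler_pXn2r ?nnegrE ?mulr_ge0 // ltW.
  suff : 2 * p ^+ 3 / (x ^+ 2 + 1) <= (1 - t) ^+ 3 by lra.
  rewrite ler_pdivrMr //.
  have w3 : 0 <= (1 - t) ^+ 3 by rewrite exprn_ge0.
  have xx : 2 * x ^+ 3 <= x ^+ 2 + 1.
    have : x ^+ 3 <= x ^+ 2 by rewrite exprSr ler_piMr ?sqr_ge0.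
    have : x ^+ 2 <= 1 by rewrite expr_le1 // ltW.
    by lra.
  have := ler_wpM2l w3 xx; lra.
have xV : x^-1 <= 1 by rewrite invf_le1 // ltW.
rewrite ger0_norm; last by lra.
have pE : p = x - t by rewrite /p; apply/max_idPr; lra.
rewrite pE; pose u := x - 1; pose w := 1 - t.
have u0 : 0 <= u by rewrite /u; lra.
have w1 : w <= 1 by rewrite /w; lra.
have -> : x - t = u + w by rewrite /u /w; ring.
suff : 2 * (u + w) ^+ 3 / (x ^+ 2 + 1) <= w ^+ 3 + 2 * (x - x^-1).
  by rewrite -/w; lra.
rewrite ler_pdivrMr //.
have E : (x - x^-1) * (x ^+ 2 + 1) = x ^+ 3 - x^-1 by field; rewrite gt_eqF.
rewrite [X in _ <= X]mulrDl -[2 * _ * _]mulrA E.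
have xE : x ^+ 3 = 1 + 3 * u + 3 * u ^+ 2 + u ^+ 3 by rewrite /u; ring.
have w3 : 0 <= w ^+ 3 by rewrite exprn_ge0.
have x21 : 2 <= x ^+ 2 + 1 by nra.
have h1 : w ^+ 3 * 2 <= w ^+ 3 * (x ^+ 2 + 1) by rewrite ler_wpM2l.
have h2 : u ^+ 2 * w <= u ^+ 2 by rewrite ler_piMr // sqr_ge0.
have h3 : u * w ^+ 2 <= u by rewrite ler_piMr // expr_le1 // /w.
have -> : (u + w) ^+ 3 = u ^+ 3 + 3 * (u ^+ 2 * w) + 3 * (u * w ^+ 2) + w ^+ 3.
  by ring.
by rewrite xE; lra.
Qed.

(* Reduction to [x * y = 1] by scaling: [u |-> (x - u)_+ ^ 3] is convex. *)
Lemma two_point_moment_le x y t rho : 0 < x -> 0 < y -> 1 <= x * y ->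
  0 <= t <= 1 -> (x ^+ 2 + y ^+ 2) / (x + y) <= rho ->
  rho + 2 * ((Num.max 0 (x - t) ^+ 3 - x ^+ 3) / (x * (x + y))) <=
  (1 - t) ^+ 3 + Bfun rho.
Proof.
move=> x0 y0 xy1 t01 rhoge; have /andP[t0 t1] := t01.
(* With [x = lam * x'] and [y = lam / x'], the atoms [x] and [- y] are [lam] times those of the
   standardized law on [x'] and [- x'^-1]. *)
pose lam := Num.sqrt (x * y).
have lam1 : 1 <= lam by rewrite -sqrtr1 ler_wsqrtr.
have lam0 : 0 < lam by lra.
have lam2 : lam ^+ 2 = x * y by rewrite sqr_sqrtr // mulr_ge0 ?ltW.
pose x' := x / lam.
have x'0 : 0 < x' by rewrite divr_gt0.
have xE : x = lam * x' by rewrite /x' mulrC divfK // gt_eqF.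
have yE : y = lam / x'.
  by rewrite /x' invf_div mulrA -expr2 lam2 mulrAC divff ?mul1r // gt_eqF.
have x2 : 0 < x' ^+ 2 + 1 by rewrite ltr_wpDl ?sqr_ge0.
have x'N : x' != 0 by rewrite gt_eqF.
have lamN : lam != 0 by rewrite gt_eqF.
have x2N : x' ^+ 2 + 1 != 0 by rewrite gt_eqF.
pose r := (x' ^+ 2 + x' ^- 2) / (x' + x'^-1).
have rE : r = (x' ^+ 4 + 1) / (x' * (x' ^+ 2 + 1)).
  by rewrite /r; field; rewrite ?x'N -?expr2 ?x2N.
have r1 : 1 <= r.
  rewrite rE ler_pdivlMr; last by rewrite mulr_gt0.
  rewrite mul1r; have := sqr_ge0 (x' - 1); have := sqr_ge0 (x' ^+ 2 - 1); nra.
have rl : (x ^+ 2 + y ^+ 2) / (x + y) = lam * r.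
  rewrite xE yE /r; field.
  rewrite x'N -expr2 x2N -mulrA -expr2 -{2}[lam]mulr1 -mulrDr.
  by rewrite mulf_neq0.
have rrho : r <= rho.
  by apply: le_trans rhoge; rewrite rl ler_peMl //; lra.
(* The excess of [rho] over [r] is absorbed by the growth of [Bfun], so that only [two_point_base]
   at [x'] remains to be used. *)
have B := Bfun_expansive r1 rrho; rewrite Bfun_reciprocal // in B.
have base := two_point_base x'0 t01.
set p := Num.max 0 (x - t); set p' := Num.max 0 (x' - t) in base *.
have p0 : 0 <= p by rewrite /p le_max lexx.
have p'0 : 0 <= p' by rewrite /p' le_max lexx.
have p'ge : x' - t <= p' by rewrite /p' le_max lexx orbT.
have ple : p <= p' + (lam - 1) * x'.
  rewrite /p ge_max addr_ge0 //=; last first.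
    by rewrite mulr_ge0 ?(ltW x'0) // subr_ge0.
  by rewrite mulrBl mul1r -xE; lra.
(* Jensen's inequality for the cube, with weights [1 / lam] on [p'] and [1 - 1 / lam] on [x']. *)
have p3 : p ^+ 3 <= lam ^+ 2 * (p' ^+ 3 + (lam - 1) * x' ^+ 3).
  apply: (@le_trans _ _ ((p' + (lam - 1) * x') ^+ 3)).
    rewrite ler_pXn2r // nnegrE // addr_ge0 // mulr_ge0 ?(ltW x'0) //; lra.
  rewrite -subr_ge0.
  have -> : lam ^+ 2 * (p' ^+ 3 + (lam - 1) * x' ^+ 3) -
      (p' + (lam - 1) * x') ^+ 3 =
      (lam - 1) * (p' - x') ^+ 2 * ((lam + 1) * p' + (2 * lam - 1) * x').
    by ring.
  have l1 : 0 <= lam - 1 by lra.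
  have l2 : 0 <= 2 * lam - 1 by lra.
  have l3 : 0 <= lam + 1 by lra.
  apply: mulr_ge0; first by apply: mulr_ge0 => //; exact: sqr_ge0.
  by apply: addr_ge0; apply: mulr_ge0 => //; exact: ltW.
have le1 : (p ^+ 3 - x ^+ 3) / (x * (x + y)) <= (p' ^+ 3 - x' ^+ 3) / (x' ^+ 2 + 1).
  have -> : x * (x + y) = lam ^+ 2 * (x' ^+ 2 + 1) by rewrite yE xE; field.
  rewrite invfM mulrA ler_wpM2r ?invr_ge0 ?(ltW x2) //.
  rewrite ler_pdivrMr ?exprn_gt0 // xE; lra.
have -> : (1 - t) ^+ 3 + Bfun rho = (1 - t) ^+ 3 + `|x' - x'^-1| + (Bfun rho -  `|x' - x'^-1|) by ring.
have E2 : r - 2 * x' ^+ 3 / (x' ^+ 2 + 1) = x'^-1 - x'.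
  by rewrite rE; field; rewrite ?x'N -?expr2 ?x2N.
have E3 : 2 * ((p' ^+ 3 - x' ^+ 3) / (x' ^+ 2 + 1)) =
   2 * p' ^+ 3 / (x' ^+ 2 + 1) - 2 * x' ^+ 3 / (x' ^+ 2 + 1) by field.
lra.
Qed.

End Bfun_theory.

(** * Real-valued expectations and abstract expectation functionals *)

Section expectation.
Context {R : realType}.
Implicit Types (P : law R) (f g : R -> R).

Definition integ P f : Prop := P.-integrable [set: _] (EFin \o f).

Definition expect P f : R := Rintegral P [set: _] f.

Lemma expectE P f : integ P f ->
  (\int[P]_x (f x)%:E = (expect P f)%:E)%E.
Proof.
by move=> fi; rewrite /expect /Rintegral fineK //; exact: integrable_fin_num.
Qed.

Lemma integD P f g : integ P f -> integ P g -> integ P (fun x => f x + g x).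
Proof. by move=> fi gi; exact: (integrableD measurableT fi gi). Qed.

Lemma integZ P a f : integ P f -> integ P (fun x => a * f x).
Proof. by move=> fi; exact: (integrableZl measurableT a fi). Qed.

Lemma integN P f : integ P f -> integ P (fun x => - f x).
Proof. by move=> fi; exact: (integrableN fi). Qed.

Lemma integB P f g : integ P f -> integ P g -> integ P (fun x => f x - g x).
Proof. by move=> fi gi; apply: integD => //; exact: integN. Qed.

Lemma integ_cst P a : integ P (fun _ => a).
Proof. exact: finite_measure_integrable_cst. Qed.

Lemma integ_measurable P f : integ P f -> measurable_fun [set: R] f.
Proof. by move=> /integrableP[/measurable_EFinP]. Qed.

Lemma integ_le P f g : measurable_fun [set: R] f -> integ P g ->
  (forall x, `|f x| <= g x) -> integ P f.
Proof.
move=> mf gi fg; apply: (le_integrable measurableT _ _ gi).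
  exact/measurable_EFinP.
by move=> x _ /=; rewrite lee_fin (le_trans (fg x)) // ler_norm.
Qed.

Lemma integ_bounded P (M : R) f : measurable_fun [set: R] f ->
  (forall x, `|f x| <= M) -> integ P f.
Proof. by move=> mf; apply: integ_le => //; exact: integ_cst. Qed.

Lemma expectD P f g : integ P f -> integ P g ->
  expect P (fun x => f x + g x) = expect P f + expect P g.
Proof. by move=> fi gi; exact: RintegralD. Qed.

Lemma expectZ P a f : integ P f -> expect P (fun x => a * f x) = a * expect P f.
Proof. by move=> fi; exact: RintegralZl. Qed.

Lemma expectB P f g : integ P f -> integ P g ->
  expect P (fun x => f x - g x) = expect P f - expect P g.
Proof. by move=> fi gi; exact: RintegralB. Qed.

Lemma expectN P f : integ P f -> expect P (fun x => - f x) = - expect P f.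
Proof.
move=> fi; under eq_fun do rewrite -mulN1r.
by rewrite expectZ // mulN1r.
Qed.

Lemma expect_cst P a : expect P (fun _ => a) = a.
Proof.
rewrite /expect Rintegral_cst // -[RHS]mulr1; congr (_ * _).
rewrite -[RHS]/(fine 1%:E); congr fine; exact: probability_setT.
Qed.

Lemma expect_le P f g : integ P f -> integ P g -> (forall x, f x <= g x) ->
  expect P f <= expect P g.
Proof. by move=> fi gi fg; exact: le_Rintegral. Qed.

Lemma expect_norm_le P (M : R) f : integ P f -> (forall x, `|f x| <= M) ->
  `|expect P f| <= M.
Proof.
move=> fi fM; rewrite ler_norml -{1}(expect_cst P (- M)).
rewrite -{2}(expect_cst P M) !expect_le //; try exact: integ_cst.
  by move=> x; have := fM x; rewrite ler_norml => /andP[].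
by move=> x; have := fM x; rewrite ler_norml => /andP[].
Qed.

(** A class of functions integrable under every law with finite third absolute moment. It does not
    mention the law and is stable under affine substitutions, so it can be the domain of
    [expectation_functional]. *)
Definition cubic_growth f : Prop := measurable_fun [set: R] f /\
  exists C : R, forall x, `|f x| <= C * (1 + `|x| ^+ 3).

Lemma cubic_growthD f g : cubic_growth f -> cubic_growth g ->
  cubic_growth (fun x => f x + g x).
Proof.
move=> [mf [C fC]] [mg [D gD]]; split; first exact: measurable_funD.
exists (C + D) => x; rewrite mulrDl (le_trans (ler_normD _ _)) // lerD //.
Qed.

Lemma cubic_growthZ a f : cubic_growth f -> cubic_growth (fun x => a * f x).
Proof.
move=> [mf [C fC]]; split; first exact: measurable_funM.
by exists (`|a| * C) => x; rewrite normrM -mulrA ler_wpM2l.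
Qed.

Lemma cubic_growth_cst a : cubic_growth (fun _ => a).
Proof.
split=> //; exists `|a| => x; rewrite ler_peMr // lerDl.
by rewrite exprn_ge0.
Qed.

Lemma norm_cube_add_le (x y : R) : `|x + y| ^+ 3 <= 4 * (`|x| ^+ 3 + `|y| ^+ 3).
Proof.
apply: (@le_trans _ _ ((`|x| + `|y|) ^+ 3)).
  by rewrite ler_pXn2r ?nnegrE ?addr_ge0 // ler_normD.
rewrite -subr_ge0; set a := `|x|; set b := `|y|.
have -> : 4 * (a ^+ 3 + b ^+ 3) - (a + b) ^+ 3 = 3 * ((a - b) ^+ 2 * (a + b)).
  by ring.
apply: mulr_ge0 => //; apply: mulr_ge0; first exact: sqr_ge0.
exact: addr_ge0 (normr_ge0 _) (normr_ge0 _).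
Qed.

Lemma cubic_growth_affine a b f : cubic_growth f ->
  cubic_growth (fun x => f (a * x + b)).
Proof.
move=> [mf [C fC]]; split.
  apply: (measurableT_comp mf).
  by apply: measurable_funD => //; exact: measurable_funM.
have C0 : 0 <= C.
  by have := le_trans (normr_ge0 _) (fC 0); rewrite normr0 expr0n addr0 mulr1.
exists (C * (1 + 4 * (`|a| ^+ 3 + `|b| ^+ 3))) => x.
rewrite (le_trans (fC _)) // -mulrA ler_wpM2l //.
have := norm_cube_add_le (a * x) b; rewrite normrM exprMn.
have a3 : 0 <= `|a| ^+ 3 by rewrite exprn_ge0.
have b3 : 0 <= `|b| ^+ 3 by rewrite exprn_ge0.
have x3 : 0 <= `|x| ^+ 3 by rewrite exprn_ge0.
have := mulr_ge0 b3 x3; nra.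
Qed.

(* What the moment inequality uses of an expectation; changing variables by an
   affine map is then a mere substitution, with no image law. *)
Record expectation_functional (E : (R -> R) -> R) : Prop := {
  efD : forall f g, cubic_growth f -> cubic_growth g ->
    E (fun x => f x + g x) = E f + E g;
  efZ : forall a f, cubic_growth f -> E (fun x => a * f x) = a * E f;
  ef_le : forall f g, cubic_growth f -> cubic_growth g ->
    (forall x, f x <= g x) -> E f <= E g;
  ef_cst : forall a, E (fun _ => a) = a }.

Lemma integ_cubic P f : integ P (fun x => `|x| ^+ 3) -> cubic_growth f ->
  integ P f.
Proof.
move=> P3 [mf [C fC]]; apply: (integ_le mf _ fC).
by apply: integZ; apply: integD => //; exact: integ_cst.
Qed.

Lemma expect_functional P : integ P (fun x => `|x| ^+ 3) ->
  expectation_functional (expect P).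
Proof.
move=> P3; split.
- by move=> f g fc gc; rewrite expectD //; exact: integ_cubic.
- by move=> a f fc; rewrite expectZ //; exact: integ_cubic.
- by move=> f g fc gc; apply: expect_le; exact: integ_cubic.
- exact: expect_cst.
Qed.

Lemma expectation_functional_affine E a b : expectation_functional E ->
  expectation_functional (fun f => E (fun x => f (a * x + b))).
Proof.
move=> [ED EZ Ele Ec]; split.
- by move=> f g fc gc; rewrite ED //; exact: cubic_growth_affine.
- by move=> c f fc; rewrite EZ //; exact: cubic_growth_affine.
- move=> f g fc gc fg; apply: Ele => [||x];
    [exact: cubic_growth_affine..|exact: fg].
- by move=> c; rewrite Ec.
Qed.

End expectation.

(** * The third absolute moment about t of a standardized law *)

Section core_moment.
Context {R : realType} (E : (R -> R) -> R).
Hypothesis EF : expectation_functional E.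
Let p (x : R) : R := Num.max 0 x.
Let n (x : R) : R := Num.max 0 (- x).

Let measurable_p : measurable_fun [set: R] p.
Proof. exact: measurable_maxr. Qed.

Let measurable_n : measurable_fun [set: R] n.
Proof. by apply: measurable_maxr => //; exact: measurable_funN. Qed.

Let p_le x : 0 <= p x <= `|x|.
Proof. by rewrite /p le_max lexx ge_max normr_ge0 ler_norm. Qed.

Let n_le x : 0 <= n x <= `|x|.
Proof. by rewrite /n le_max lexx ge_max normr_ge0 /= -normrN ler_norm. Qed.

Let cubic_pow (g : R -> R) (k : nat) : (k <= 3)%N -> measurable_fun [set: R] g ->
  (forall x, 0 <= g x <= `|x|) -> cubic_growth (fun x => g x ^+ k).
Proof.
move=> k3 mg gx; split; first exact: measurable_funX.
exists 1 => x; rewrite mul1r; have /andP[g0 gle] := gx x.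
rewrite ger0_norm ?exprn_ge0 //.
apply: (@le_trans _ _ (`|x| ^+ k)); first by rewrite lerXn2r ?nnegrE.
have [x1|/ltW x1] := leP `|x| 1.
  by rewrite (@le_trans _ _ 1) ?exprn_ile1 // lerDl exprn_ge0.
by rewrite (@le_trans _ _ (`|x| ^+ 3)) ?lerDr // ler_weXn2l.
Qed.

Variable t : R.

Let cubic_w : cubic_growth (fun x => p (x - t) ^+ 3).
Proof.
have /(cubic_growth_affine 1 (- t)) := cubic_pow (leqnn 3) measurable_p p_le.
by under eq_fun do rewrite mul1r.
Qed.

Let cubic_a : cubic_growth (fun x => `|x - t| ^+ 3).
Proof.
have : cubic_growth (fun x : R => `|x| ^+ 3).
  apply: (cubic_pow (leqnn 3)) => [|x]; first exact: normr_measurable.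
  by rewrite lexx normr_ge0.
move=> /(cubic_growth_affine 1 (- t)).
by under eq_fun do rewrite mul1r.
Qed.

(** Every moment relation used below is a pointwise inequality, linear in nine basic functions,
    integrated by this one statement; afterwards the nine expectations are mere numbers. *)
Let master (c0 c1 c2 c3 c4 c5 c6 c7 c8 : R) :
  (forall x, 0 <= c0 + c1 * p x + c2 * n x + c3 * p x ^+ 2 + c4 * n x ^+ 2 +
    c5 * p x ^+ 3 + c6 * n x ^+ 3 + c7 * p (x - t) ^+ 3 +
    c8 * `|x - t| ^+ 3) ->
  0 <= c0 + c1 * E p + c2 * E n + c3 * E (fun x => p x ^+ 2) +
    c4 * E (fun x => n x ^+ 2) + c5 * E (fun x => p x ^+ 3) +
    c6 * E (fun x => n x ^+ 3) + c7 * E (fun x => p (x - t) ^+ 3) +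
    c8 * E (fun x => `|x - t| ^+ 3).
Proof.
move=> ge0; case: EF => ED EZ Ele Ec.
have cp := cubic_pow (isT : (1 <= 3)%N) measurable_p p_le.
have cn := cubic_pow (isT : (1 <= 3)%N) measurable_n n_le.
have cp2 := cubic_pow (isT : (2 <= 3)%N) measurable_p p_le.
have cn2 := cubic_pow (isT : (2 <= 3)%N) measurable_n n_le.
have cp3 := cubic_pow (isT : (3 <= 3)%N) measurable_p p_le.
have cn3 := cubic_pow (isT : (3 <= 3)%N) measurable_n n_le.
have cc a := @cubic_growth_cst R a.
have := Ele (fun=> 0) (fun x => c0 + c1 * p x + c2 * n x + c3 * p x ^+ 2 +
  c4 * n x ^+ 2 + c5 * p x ^+ 3 + c6 * n x ^+ 3 + c7 * p (x - t) ^+ 3 +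
  c8 * `|x - t| ^+ 3) (cc 0).
rewrite Ec.
have D f g a : cubic_growth f -> cubic_growth g ->
    cubic_growth (fun x => f x + a * g x) /\
     E (fun x => f x + a * g x) = E f + a * E g.
  move=> fc gc; split; first by apply: cubic_growthD => //; exact: cubic_growthZ.
  by rewrite ED ?EZ //; exact: cubic_growthZ.
have [d1 e1] := D _ _ c1 (cc c0) cp.
have [d2 e2] := D _ _ c2 d1 cn.
have [d3 e3] := D _ _ c3 d2 cp2.
have [d4 e4] := D _ _ c4 d3 cn2.
have [d5 e5] := D _ _ c5 d4 cp3.
have [d6 e6] := D _ _ c6 d5 cn3.
have [d7 e7] := D _ _ c7 d6 cubic_w.
have [d8 e8] := D _ _ c8 d7 cubic_a.
move=> /(_ d8 ge0); rewrite e8 e7 e6 e5 e4 e3 e2 e1 Ec.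
by [].
Qed.

Hypothesis mean0 : E id = 0.
Hypothesis var1 : E (fun x => x ^+ 2) = 1.

Let pnP x : (p x = x /\ n x = 0 /\ 0 <= x) \/ (p x = 0 /\ n x = - x /\ x <= 0).
Proof.
rewrite /p /n; have [x0|/ltW x0] := leP 0 x; [left|right]; split=> //.
- by split=> //; apply/max_idPl; rewrite oppr_le0.
- by split=> //; apply/max_idPr; rewrite oppr_ge0.
Qed.

Hypothesis t01 : 0 <= t <= 1.

(** The majorant has no constant term, since [E p] and [E p^2] are tracked but not the mass of the
    half line; it is exact at 0 and tangent at [x]. On the branch containing [x] the gap is
    [z * (z - x) ^+ 2] for [x <= t] and [t ^+ 3 * ((z - x) / x) ^+ 2] otherwise. *)
Let tangent_coef (x : R) : 0 < x -> exists a b : R,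
  a * x + b * x ^+ 2 = p (x - t) ^+ 3 - x ^+ 3 /\
  forall z, 0 <= z -> p (z - t) ^+ 3 - z ^+ 3 <= a * z + b * z ^+ 2.
Proof.
move=> x0; have /andP[t0 t1] := t01; have [xt|tx] := leP x t.
  exists (x ^+ 2), (- 2 * x); split.
    by rewrite /p; have /max_idPl -> : x - t <= 0 by [lra|]; ring.
  move=> z z0; rewrite /p; have [zt|zt] := leP 0 (z - t).
    rewrite -subr_ge0.
    have -> : x ^+ 2 * z + - 2 * x * z ^+ 2 - ((z - t) ^+ 3 - z ^+ 3) =
      z * (z - x) ^+ 2 - (z - t) ^+ 3 by ring.
    rewrite subr_ge0 exprS; apply: ler_pM; rewrite ?sqr_ge0 //; first by lra.
    by rewrite ler_pXn2r ?nnegrE //; lra.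
  rewrite -subr_ge0.
  have -> : x ^+ 2 * z + - 2 * x * z ^+ 2 - (0 ^+ 3 - z ^+ 3) =
      z * (z - x) ^+ 2 by rewrite expr0n /=; ring.
  by rewrite mulr_ge0 ?sqr_ge0.
have xN : x != 0 by rewrite gt_eqF.
exists (3 * t ^+ 2 - 2 * t ^+ 3 / x), (- 3 * t + t ^+ 3 / x ^+ 2); split.
  rewrite /p; have /max_idPr -> : 0 <= x - t by lra.
  by field.
move=> z z0; rewrite /p; have [zt|zt] := leP 0 (z - t).
  rewrite -subr_ge0.
  have -> : (3 * t ^+ 2 - 2 * t ^+ 3 / x) * z +
      (- 3 * t + t ^+ 3 / x ^+ 2) * z ^+ 2 - ((z - t) ^+ 3 - z ^+ 3) =
      t ^+ 3 * ((z - x) / x) ^+ 2 by field.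
  by rewrite mulr_ge0 ?sqr_ge0 // exprn_ge0.
rewrite -subr_ge0.
have -> : (3 * t ^+ 2 - 2 * t ^+ 3 / x) * z +
    (- 3 * t + t ^+ 3 / x ^+ 2) * z ^+ 2 - (0 ^+ 3 - z ^+ 3) =
    z * ((t - z) ^+ 2 + (t - z) * t * (1 - t / x) +
         (1 - t / x) * t ^+ 2 * (1 - z / x)) by rewrite expr0n /=; field.
have tx1 : t / x <= 1 by rewrite ler_pdivrMr // mul1r ltW.
have zx1 : z / x <= 1 by rewrite ler_pdivrMr // mul1r; lra.
have tz : 0 <= t - z by lra.
have r0 : 0 <= 1 - t / x by lra.
have q0 : 0 <= 1 - z / x by lra.
apply: mulr_ge0 => //; apply: addr_ge0; last first.
  by apply: mulr_ge0 => //; apply: mulr_ge0 => //; exact: sqr_ge0.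
apply: addr_ge0; first exact: sqr_ge0.
by apply: mulr_ge0 => //; exact: mulr_ge0.
Qed.

(** Both parts of [Y] have the same mean [m]. Let [x] and [y] be the ratios of their second moments
    to [m]. The comparison law has masses [m / x] at [x], [m / y] at [- y] and the rest at 0: it
    keeps the first two moments of each part, and its absolute third moment is at most that of [Y].
    This leads to [two_point_moment_le]. *)
Lemma standard_moment_le_nonneg :
  E (fun x => `|x - t| ^+ 3) <=
  1 + 3 * t ^+ 2 + Bfun (E (fun x => `|x| ^+ 3)).
Proof.
have /andP[t0 t1] := t01; case: (EF) => ED EZ Ele Ec.
have cp := cubic_pow (isT : (1 <= 3)%N) measurable_p p_le.
have cn := cubic_pow (isT : (1 <= 3)%N) measurable_n n_le.
have cp2 := cubic_pow (isT : (2 <= 3)%N) measurable_p p_le.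
have cn2 := cubic_pow (isT : (2 <= 3)%N) measurable_n n_le.
have cp3 := cubic_pow (isT : (3 <= 3)%N) measurable_p p_le.
have cn3 := cubic_pow (isT : (3 <= 3)%N) measurable_n n_le.
have mean : E p - E n = 0.
  rewrite -mean0 -mulN1r -(EZ _ _ cn) -ED //; last exact: cubic_growthZ.
  congr E; apply/funext => x; rewrite mulN1r.
  by case: (pnP x) => [[-> [-> _]]|[-> [-> _]]]; rewrite ?subr0 // sub0r opprK.
have var : E (fun x => p x ^+ 2) + E (fun x => n x ^+ 2) = 1.
  rewrite -ED // -var1; congr E; apply/funext => x.
  by case: (pnP x) => [[-> [-> _]]|[-> [-> _]]]; rewrite expr0n /= ?sqrrN; ring.
have rhoE : E (fun x => `|x| ^+ 3) =
    E (fun x => p x ^+ 3) + E (fun x => n x ^+ 3).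
  rewrite -ED //; congr E; apply/funext => x.
  case: (pnP x) => [[-> [-> x0]]|[-> [-> x0]]].
    by rewrite ger0_norm // expr0n addr0.
  by rewrite ler0_norm // expr0n add0r.
rewrite rhoE.
(* Integrates [p * (p - c) ^+ 2 >= 0]; at the ratio of second to first moment this is the
   Cauchy-Schwarz lower bound for the third moment of the part. *)
have pA c : 0 <= c ^+ 2 * E p - 2 * c * E (fun x => p x ^+ 2) +
    E (fun x => p x ^+ 3).
  apply: (le_trans (@master 0 (c ^+ 2) 0 (- (2 * c)) 0 1 0 0 0 _)); last by lra.
  move=> x.
  have /andP[p0 _] := p_le x; have := mulr_ge0 p0 (sqr_ge0 (p x - c)); lra.
have nA c : 0 <= c ^+ 2 * E n - 2 * c * E (fun x => n x ^+ 2) +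
    E (fun x => n x ^+ 3).
  apply: (le_trans (@master 0 0 (c ^+ 2) 0 (- (2 * c)) 0 1 0 0 _)); last by lra.
  move=> x.
  have /andP[n0 _] := n_le x; have := mulr_ge0 n0 (sqr_ge0 (n x - c)); lra.
have pS c : 0 <= 1 - 2 * c * E p + c ^+ 2 * E (fun x => p x ^+ 2).
  apply: (le_trans (@master 1 (- (2 * c)) 0 (c ^+ 2) 0 0 0 0 0 _)); last by lra.
  by move=> x; have := sqr_ge0 (c * p x - 1); lra.
have nS c : 0 <= 1 - 2 * c * E n + c ^+ 2 * E (fun x => n x ^+ 2).
  apply: (le_trans (@master 1 0 (- (2 * c)) 0 (c ^+ 2) 0 0 0 0 _)); last by lra.
  by move=> x; have := sqr_ge0 (c * n x - 1); lra.
(* The square of [1 - c * p - d * n] has no cross term, the two parts having disjoint supports. At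
   [c = x^-1], [d = y^-1] it yields [1 <= x * y]: the masses at [x] and [- y] do not exceed 1
   together. *)
have pnS c d : 0 <= 1 - 2 * c * E p + c ^+ 2 * E (fun x => p x ^+ 2)
                - 2 * d * E n + d ^+ 2 * E (fun x => n x ^+ 2).
  apply: (le_trans (@master 1 (- (2 * c)) (- (2 * d)) (c ^+ 2) (d ^+ 2) 0 0 0 0 _)); last by lra.
  move=> x.
  have := sqr_ge0 (c * p x - 1); have := sqr_ge0 (d * n x - 1).
  by case: (pnP x) => [[-> [-> _]]|[-> [-> _]]]; lra.
have W a b : (forall z, 0 <= z -> p (z - t) ^+ 3 - z ^+ 3 <= a * z + b * z ^+ 2) ->
    0 <= a * E p + b * E (fun x => p x ^+ 2) + E (fun x => p x ^+ 3) -
      E (fun x => p (x - t) ^+ 3).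
  move=> ab; apply: (le_trans (@master 0 a 0 b 0 1 0 (- 1) 0 _)); last by lra.
  move=> x; have /andP[p0 _] := p_le x.
  have := ab _ p0; suff -> : p (p x - t) = p (x - t) by lra.
  case: (pnP x) => [[-> _]|[-> [_ x0]]] //; rewrite /p sub0r.
  have /max_idPl -> : - t <= 0 by lra.
  by have /max_idPl -> : x - t <= 0 by lra.
(* Integrates [|z|^3 = 2 max(0, z)^3 - z^3] at [z = x - t], with [x ^+ 3] split into the cubes of
   the two parts; one direction of this equality suffices. *)
have V : 0 <= t ^+ 3 + 3 * t * (E (fun x => p x ^+ 2) + E (fun x => n x ^+ 2)) -
    3 * t ^+ 2 * (E p - E n) - E (fun x => p x ^+ 3) + E (fun x => n x ^+ 3) +
    2 * E (fun x => p (x - t) ^+ 3) - E (fun x => `|x - t| ^+ 3).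
  apply: (le_trans (@master (t ^+ 3) (- (3 * t ^+ 2)) (3 * t ^+ 2) (3 * t) (3 * t) (- 1) 1 2 (- 1) _)); last by lra.
  move=> x; rewrite le_eqVlt; apply/orP; left.
  apply/eqP; rewrite [in p (x - t)]/p.
  have [xt|xt] := leP 0 (x - t).
    rewrite ger0_norm //.
    by case: (pnP x) => [[-> [-> _]]|[-> [-> _]]]; ring.
  rewrite ltr0_norm //.
  by case: (pnP x) => [[-> [-> _]]|[-> [-> _]]]; ring.
move: mean var pA nA pS nS pnS W V; rewrite {rhoE}.
(* From here on the expectations are arbitrary reals bound by the relations collected above. *)
move: (E p) (E n) (E (fun x => p x ^+ 2)) (E (fun x => n x ^+ 2))
  (E (fun x => p x ^+ 3)) (E (fun x => n x ^+ 3)) (E (fun x => p (x - t) ^+ 3))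
  (E (fun x => `|x - t| ^+ 3)) => m m' S S' A B w v.
move=> /eqP; rewrite subr_eq0 => /eqP <- {m'} var pA nA pS nS pnS W V.
have A0 : 0 <= A by have := pA 0; lra.
have B0 : 0 <= B by have := nA 0; lra.
have m0 : 0 < m.
  (* Adding [pA c] and [nA c] gives [0 <= 2 * c ^+ 2 * m - 2 * c + A + B], which this [c] makes
     impossible for [m <= 0]. *)
  rewrite ltNge; apply/negP => m0; pose c := A + B + 1.
  have := pA c; have := nA c.
  have c0 : 0 <= c ^+ 2 by exact: sqr_ge0.
  by have := mulr_ge0_le0 c0 m0; rewrite /c; nra.
have S0 : 0 < S.
  rewrite ltNge; apply/negP => S0; have := pS (m^-1).
  have : m^-1 ^+ 2 * S <= 0 by rewrite mulr_ge0_le0 // sqr_ge0.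
  by rewrite -mulrA mulVf ?gt_eqF //; lra.
have S'0 : 0 < S'.
  rewrite ltNge; apply/negP => S0'; have := nS (m^-1).
  have : m^-1 ^+ 2 * S' <= 0 by rewrite mulr_ge0_le0 // sqr_ge0.
  by rewrite -mulrA mulVf ?gt_eqF //; lra.
pose x := S / m; pose y := S' / m.
have x0 : 0 < x by rewrite divr_gt0.
have y0 : 0 < y by rewrite divr_gt0.
have mN : m != 0 by rewrite gt_eqF.
have SN : S != 0 by rewrite gt_eqF.
have S'N : S' != 0 by rewrite gt_eqF.
have xy : m * (x + y) = 1 by rewrite /x /y -mulrDl var mul1r divff.
have SE : S = x * m by rewrite /x divfK.
have S'E : S' = y * m by rewrite /y divfK.
have xy0 : 0 < x + y by rewrite addr_gt0.
have mE : m = (x + y)^-1 by apply: (mulIf (lt0r_neq0 xy0)); rewrite xy mulVf ?gt_eqF.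
have xy1 : 1 <= x * y.
  have := pnS x^-1 y^-1; rewrite SE S'E.
  have -> : 1 - 2 * x^-1 * m + x^-1 ^+ 2 * (x * m) - 2 * y^-1 * m +
      y^-1 ^+ 2 * (y * m) = 1 - m * (x + y) / (x * y).
    by field; rewrite !gt_eqF.
  by rewrite xy div1r subr_ge0 invf_le1 // mulr_gt0.
have rho : (x ^+ 2 + y ^+ 2) / (x + y) <= A + B.
  have := pA x; have := nA y; rewrite SE S'E -mE; nra.
have := two_point_moment_le x0 y0 xy1 t01 rho; rewrite -/(p (x - t)).
have [a [b [abx ab]]] := tangent_coef x0.
have := W _ _ ab; rewrite SE.
have -> : a * m + b * (x * m) = (a * x + b * x ^+ 2) / (x * (x + y)).
  by rewrite invfM -mE; field; rewrite gt_eqF.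
by rewrite abx; move: V; rewrite var subrr; lra.
Qed.

End core_moment.

(** * Replacing one law by a two-point law *)

Section one_step.
Context {R : realType}.
Implicit Types (E : (R -> R) -> R) (f k : R -> R).

Lemma cubic_growth_id : cubic_growth (id : R -> R).
Proof.
split; first exact: measurable_id.
exists 1 => x; rewrite mul1r; have := normr_ge0 x => x0.
have [x1|/ltW x1] := leP `|x| 1; first by rewrite ler_wpDr // exprn_ge0.
by rewrite ler_wpDl // -[X in X <= _]expr1 ler_weXn2l.
Qed.

Lemma standard_moment_le E t : expectation_functional E ->
  E id = 0 -> E (fun x => x ^+ 2) = 1 -> -1 <= t <= 1 ->
  E (fun x => `|x - t| ^+ 3) <=
  1 + 3 * t ^+ 2 + Bfun (E (fun x => `|x| ^+ 3)).
Proof.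
move=> EF mean0 var1 /andP[t1 t2]; have [t0|t0] := leP 0 t.
  by apply: standard_moment_le_nonneg => //; rewrite t0.
have EF' := expectation_functional_affine (- 1) 0 EF.
have := @standard_moment_le_nonneg _ _ EF' (- t) _ _ _.
have E3 : (fun x : R => `|-1 * x + 0 - - t| ^+ 3) = (fun x => `|x - t| ^+ 3).
  by apply/funext => x; rewrite -normrN; congr (`|_| ^+ 3); ring.
have E4 : (fun x : R => `|-1 * x + 0| ^+ 3) = (fun x => `|x| ^+ 3).
  by apply/funext => x; rewrite -normrN; congr (`|_| ^+ 3); ring.
rewrite E3 E4 sqrrN; apply.
- have -> : (fun x : R => id (- 1 * x + 0)) = (fun x => -1 * id x).
    by apply/funext => x; rewrite addr0.
  rewrite (efZ EF) ?mean0 ?mulr0 //; exact: cubic_growth_id.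
- by rewrite -[RHS]var1; congr E; apply/funext => x /=; rewrite addr0 mulN1r sqrrN.
- by apply/andP; split; lra.
Qed.

Lemma cubic_growth_sqr : cubic_growth (fun x : R => x ^+ 2).
Proof.
split; first exact: measurable_funX.
exists 1 => x; rewrite mul1r normrX; have := normr_ge0 x => x0.
have [x1|/ltW x1] := leP `|x| 1.
  by rewrite ler_wpDr ?exprn_ge0 // exprn_ile1.
by rewrite ler_wpDl // ler_weXn2l.
Qed.

Lemma cubic_growth_norm3 t : cubic_growth (fun x : R => `|x - t| ^+ 3).
Proof.
have : cubic_growth (fun x : R => `|x| ^+ 3).
  split; first by apply: measurable_funX; exact: normr_measurable.
  by exists 1 => x; rewrite mul1r ger0_norm ?exprn_ge0 // lerDr.
move=> /(cubic_growth_affine 1 (- t)).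
by under eq_fun do rewrite mul1r.
Qed.

Lemma C2lip_measurable (L : R) (f f1 f2 : R -> R) : C2lip L f f1 f2 ->
  measurable_fun [set: R] f.
Proof. by case=> _ fd _ _; exact: continuous_measurable_fun (is_derive_cvg fd). Qed.

Lemma C2lip_cubic_growth (L : R) (f f1 f2 : R -> R) : C2lip L f f1 f2 ->
  cubic_growth f.
Proof.
move=> fL; split; first exact: C2lip_measurable fL.
case: fL => -[M fM] _ _ _; exists M => x; rewrite (le_trans (fM x)) //.
by rewrite ler_peMr ?lerDl ?exprn_ge0 // (le_trans _ (fM 0)).
Qed.

(** A quadratic polynomial has the same expectation under [E] as under the symmetric law on [- s]
    and [s], because the first two moments agree. *)
Lemma functional_touching E k (s q0 q1 q2 : R) : expectation_functional E ->
  cubic_growth k -> E id = 0 -> E (fun x => x ^+ 2) = s ^+ 2 ->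
  let q x := q0 + q1 * x + q2 * x ^+ 2 in
  (forall x, q x <= k x) -> q s = k s -> q (- s) = k (- s) ->
  (k s + k (- s)) / 2 <= E k.
Proof.
move=> [ED EZ Ele Ec] ck mean0 var q qk <- <-.
have ci := cubic_growth_id; have c2 := cubic_growth_sqr.
have cc := @cubic_growth_cst R q0.
have Z1 := cubic_growthZ q1 ci; have Z2 := cubic_growthZ q2 c2.
have D1 := cubic_growthD cc Z1; have D2 := cubic_growthD D1 Z2.
have := Ele _ _ D2 ck qk; rewrite !(ED, EZ) // Ec.
rewrite mean0 var /q; apply: le_trans; rewrite le_eqVlt; apply/orP; left.
by apply/eqP; field.
Qed.

(** Removes the strict inequality [L < M] on which the touching arguments depend. *)
Lemma le_mul_limit (X L K : R) : 0 <= K -> (forall M, L < M -> X <= M * K) ->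
  X <= L * K.
Proof.
move=> K0 H; apply/ler_addgt0Pr => e e0.
have K1 : 0 < K + 1 by rewrite ltr_wpDl.
have := H (L + e / (K + 1)); rewrite ltrDl divr_gt0 // => /(_ isT).
move=> /le_trans; apply; rewrite mulrDl lerD2l mulrAC ler_pdivrMr //.
by rewrite ler_pM2l // lerDl.
Qed.

Lemma functional_one_step E (L s : R) (f f1 f2 : R -> R) :
  expectation_functional E -> C2lip L f f1 f2 -> 0 < s ->
  E id = 0 -> E (fun x => x ^+ 2) = s ^+ 2 ->
  `|E f - (f s + f (- s)) / 2| <=
  L * (s ^+ 3 * Bfun (E (fun x => `|x / s| ^+ 3)) / 6).
Proof.
move=> EF fL s0 mean0 var; have sN : s != 0 by rewrite gt_eqF.
case: (EF) => ED EZ Ele Ec.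
set K := s ^+ 3 * _ / 6.
have K0 : 0 <= K by rewrite /K divr_ge0 // mulr_ge0 ?sqrtr_ge0 // exprn_ge0 // ltW.
suff up g g1 g2 : C2lip L g g1 g2 -> E g - (g s + g (- s)) / 2 <= L * K.
  rewrite ler_norml (up _ _ _ fL) andbT.
  have := up _ _ _ (C2lip_opp fL).
  have -> : (fun x => - f x) = (fun x => -1 * f x).
    by apply/funext => x; rewrite mulN1r.
  by rewrite EZ; [lra | exact: C2lip_cubic_growth fL].
move=> gL; apply: le_mul_limit => // M LM.
have [t /andP[ts1 ts2] [q0 [q1 [q2 [qk qs qNs]]]]] := cubic_touching gL LM s0.
have cg := C2lip_cubic_growth gL; have cn := cubic_growth_norm3 t.
have cM := cubic_growthZ (M / 6) cn.
have cN := cubic_growthZ (- 1) cg.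
have E1 : (fun x => M / 6 * `|x - t| ^+ 3 - g x) =
    (fun x => M / 6 * `|x - t| ^+ 3 + -1 * g x).
  by apply/funext => x; rewrite mulN1r.
have ck : cubic_growth (fun x => M / 6 * `|x - t| ^+ 3 - g x).
  by rewrite E1; exact: cubic_growthD.
have := functional_touching EF ck mean0 var qk qs qNs.
rewrite E1 ED // !EZ //.
have EF' := expectation_functional_affine s^-1 0 EF.
have := @standard_moment_le _ (t / s) EF' _ _ _.
have -> : (fun x : R => id (s^-1 * x + 0)) = (fun x => s^-1 * id x).
  by apply/funext => x; rewrite addr0.
have -> : (fun x : R => (s^-1 * x + 0) ^+ 2) = (fun x => s^-1 ^+ 2 * x ^+ 2).
  by apply/funext => x; rewrite addr0 exprMn.
have -> : (fun x : R => `|s^-1 * x + 0| ^+ 3) = (fun x => `|x / s| ^+ 3).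
  by apply/funext => x; rewrite addr0 mulrC.
have -> : (fun x : R => `|s^-1 * x + 0 - t / s| ^+ 3) =
    (fun x => s^-1 ^+ 3 * `|x - t| ^+ 3).
  apply/funext => x; rewrite addr0 mulrC -mulrBl normrM exprMn mulrC.
  by rewrite (@ger0_norm _ s^-1) // invr_ge0 ltW.
rewrite !EZ //; [|exact: cubic_growth_sqr|exact: cubic_growth_id].
rewrite mean0 var mulr0 -exprMn mulVf // expr1n => /(_ erefl erefl).
have t1 : -1 <= t / s <= 1.
  by rewrite ler_pdivlMr // ler_pdivrMr // mulN1r mul1r ts1.
move=> /(_ t1) mom; have := ler_wpM2l (exprn_ge0 3 (ltW s0)) mom.
rewrite mulrA -exprMn divff // expr1n mul1r.
have M0 : 0 < M by apply: le_lt_trans LM; exact: C2lip_ge0 gL.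
rewrite /K ger0_norm ?subr_ge0 // ler0_norm; last by lra.
set B := Bfun _; set V := E _; set G := E g => mom'.
move=> h1; have := ler_wpM2l (ltW M0) mom'.
have -> : s ^+ 3 * (1 + 3 * (t / s) ^+ 2 + B) =
    s ^+ 3 + 3 * s * t ^+ 2 + s ^+ 3 * B by field.
move: h1.
(* The nodes contribute [(s - t)^3 + (s + t)^3 = 2 s^3 + 6 s t^2], which cancels the term
   [1 + 3 (t / s)^2] of the moment inequality and leaves [Bfun] alone. *)
have -> : M / 6 * (s - t) ^+ 3 - g s + (M / 6 * (- (- s - t)) ^+ 3 - g (- s)) =
    M / 6 * (2 * s ^+ 3 + 6 * s * t ^+ 2) - (g s + g (- s)) by field.
by lra.
Qed.

End one_step.

(** * Expectations under convolutions *)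

Section laws.
Context {R : realType}.
Implicit Types (P Q : law R) (f : R -> R).

Lemma integ_expect_of P f (r : R) : measurable_fun [set: R] f ->
  (forall x, 0 <= f x) -> (\int[P]_x (f x)%:E = r%:E)%E ->
  integ P f /\ expect P f = r.
Proof.
move=> mf f0 E; split; last by rewrite /expect /Rintegral E.
apply/integrableP; split; first exact/measurable_EFinP.
have -> : (\int[P]_x `|(EFin \o f) x| = r%:E)%E.
  by rewrite -E; apply: eq_integral => x _ /=; rewrite ger0_norm.
exact: ltry.
Qed.

Lemma measurable_shift f (a : R) : measurable_fun [set: R] f ->
  measurable_fun [set: R] (fun x => f (x + a)).
Proof.
by move=> mf; apply: (measurableT_comp mf); exact: measurable_funD.
Qed.

Lemma measurable_shiftl f (a : R) : measurable_fun [set: R] f ->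
  measurable_fun [set: R] (fun x => f (a + x)).
Proof.
by move=> mf; apply: (measurableT_comp mf); exact: measurable_funD.
Qed.

Lemma measurable_add_comp f : measurable_fun [set: R] f ->
  measurable_fun [set: (measurableTypeR R * measurableTypeR R)%type]
    (fun z => (f (z.1 + z.2))%:E).
Proof.
move=> mf; apply/measurable_EFinP; apply: (measurableT_comp mf).
exact: measurable_add_pair.
Qed.

Lemma ge0_integral_convolution P Q f : measurable_fun [set: R] f ->
  (forall x, 0 <= f x) ->
  (\int[convolution P Q]_z (f z)%:E =
   \int[P]_x \int[Q]_y (f (x + y))%:E)%E.
Proof.
move=> mf f0; rewrite /convolution ge0_integral_distribution; last 2 first.
- exact/measurable_EFinP.
- by move=> y; rewrite lee_fin.
rewrite (@fubini_tonelli1 _ _ _ _ _ P Q (fun z => (f (z.1 + z.2))%:E)) //.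
- exact: measurable_add_comp.
- by move=> z; rewrite lee_fin.
Qed.

Lemma ge0_expect_convolution P Q f : measurable_fun [set: R] f ->
  (forall x, 0 <= f x) -> (forall x, integ Q (fun y => f (x + y))) ->
  integ P (fun x => expect Q (fun y => f (x + y))) ->
  integ (convolution P Q) f /\
  expect (convolution P Q) f = expect P (fun x => expect Q (fun y => f (x + y))).
Proof.
move=> mf f0 iQ iP; apply: integ_expect_of => //.
rewrite ge0_integral_convolution // -(expectE iP).
by apply: eq_integral => x _; rewrite (expectE (iQ x)).
Qed.

Lemma integ_inner_bounded P Q f (M : R) : measurable_fun [set: R] f ->
  (forall x, 0 <= f x <= M) -> integ P (fun x => expect Q (fun y => f (x + y))).
Proof.
move=> mf fM; have f0 x : 0 <= f x by have /andP[] := fM x.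
have iQ x : integ Q (fun y => f (x + y)).
  apply: (@integ_bounded _ _ M); first exact: measurable_shiftl.
  by move=> y; rewrite ger0_norm //; have /andP[] := fM (x + y).
apply: (@integ_bounded _ _ M); last first.
  move=> x; apply: expect_norm_le => // y.
  by rewrite ger0_norm //; have /andP[] := fM (x + y).
apply/measurable_EFinP.
have g0 (z : measurableTypeR R * measurableTypeR R) :
    (0 <= (f (z.1 + z.2))%:E)%E by rewrite lee_fin.
have H := measurable_fun_fubini_tonelli_F (m2 := Q)
  (fun z : measurableTypeR R * measurableTypeR R => (f (z.1 + z.2))%:E)
  (measurable_add_comp mf) g0.
rewrite (_ : _ \o _ = fubini_F Q (fun z : measurableTypeR R * measurableTypeR R => (f (z.1 + z.2))%:E)) //.
by apply/funext => x; rewrite /fubini_F /= (expectE (iQ x)).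
Qed.

(** Adding the bound [M] makes the function nonnegative, so Tonelli's theorem is enough; the
    constant cancels at the end. The device recurs for commutativity and for normal laws. *)
Lemma expect_convolution P Q f (M : R) : measurable_fun [set: R] f ->
  (forall x, `|f x| <= M) ->
  expect (convolution P Q) f = expect P (fun x => expect Q (fun y => f (x + y)))
  /\ integ P (fun x => expect Q (fun y => f (x + y))).
Proof.
move=> mf fM; pose g x := f x + M.
have mg : measurable_fun [set: R] g by exact: measurable_funD.
have gM x : 0 <= g x <= M + M.
  have := fM x; rewrite ler_norml /g => /andP[? ?]; apply/andP; split; lra.
have g0 x : 0 <= g x by have /andP[] := gM x.
have bi P' (h : R -> R) : measurable_fun [set: R] h ->
    (forall x, `|h x| <= M) -> integ P' h by exact: integ_bounded.
have iQ x : integ Q (fun y => g (x + y)).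
  apply: (@integ_bounded _ _ (M + M)); first exact: measurable_shiftl.
  by move=> y; rewrite ger0_norm //; have /andP[] := gM (x + y).
have iPg := integ_inner_bounded P Q mg gM.
have [ig Eg] := ge0_expect_convolution mg g0 iQ iPg.
have iQf x : integ Q (fun y => f (x + y)).
  by apply: bi => //; exact: measurable_shiftl.
have innerE x : expect Q (fun y => g (x + y)) = expect Q (fun y => f (x + y)) + M.
  by rewrite /g expectD ?expect_cst //; exact: integ_cst.
have iPf : integ P (fun x => expect Q (fun y => f (x + y))).
  rewrite (_ : (fun x => _) = (fun x => expect Q (fun y => g (x + y)) - M)).
    by apply: integB => //; exact: integ_cst.
  by apply/funext => x; rewrite innerE addrK.
split; last exact: iPf.
apply: (addIr M).
have -> : expect (convolution P Q) f + M = expect (convolution P Q) g.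
  by rewrite /g expectD ?expect_cst //; [exact: bi|exact: integ_cst].
rewrite Eg; under eq_fun do rewrite innerE.
by rewrite expectD ?expect_cst //; exact: integ_cst.
Qed.

Lemma expect_convolutionC P Q f (M : R) : measurable_fun [set: R] f ->
  (forall x, `|f x| <= M) ->
  expect (convolution P Q) f = expect (convolution Q P) f.
Proof.
move=> mf fM; pose h x := f x + M.
have mh : measurable_fun [set: R] h by exact: measurable_funD.
have h0 x : 0 <= h x by have := fM x; rewrite ler_norml /h => /andP[? _]; lra.
have i (V : law R) : integ V f := integ_bounded V mf fM.
apply: (addIr M).
have A (V : law R) : expect V f + M = expect V h.
  by rewrite /h (expectD (i V) (integ_cst V M)) expect_cst.
rewrite !A /expect /Rintegral !ge0_integral_convolution //; congr fine.
rewrite (@fubini_tonelli _ _ _ _ _ P Q (fun z => (h (z.1 + z.2))%:E)) /=.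
- by apply: eq_integral => y _; apply: eq_integral => x _; rewrite addrC.
- exact: measurable_add_comp.
- by move=> z; rewrite lee_fin.
Qed.

(* Only bounded test functions are compared; [a] and [b] are the centerings. *)
Lemma convolution_close P P' Q Q' f (M a b c d : R) :
  measurable_fun [set: R] f -> (forall x, `|f x| <= M) ->
  (forall y, `|expect P (fun x => f (x + y)) -
               expect P' (fun x => f (x + a + y))| <= c) ->
  (forall x, `|expect Q (fun y => f (x + y)) -
               expect Q' (fun y => f (x + (y + b)))| <= d) ->
  `|expect (convolution P Q) f -
    expect (convolution P' Q') (fun x => f (x + (a + b)))| <= c + d.
Proof.
move=> mf fM close1 close2.
have mfs z : measurable_fun [set: R] (fun x => f (x + z)) by exact: measurable_shift.
have [E1 i1] := expect_convolution P Q mf fM.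
have [E2 i2] := expect_convolution P Q' (mfs b) (fun x => fM (x + b)).
have [E3 i3] := expect_convolution Q' P (mfs b) (fun x => fM (x + b)).
have [E4 i4] := expect_convolution Q' P' (mfs (a + b)) (fun x => fM (x + (a + b))).
have [E5 i5] := expect_convolution P' Q' (mfs (a + b)) (fun x => fM (x + (a + b))).
(* The intermediate law is [P * Q']. Commuting its factors puts the law to be replaced inside the
   outer integral in both halves. *)
have ->: expect (convolution P Q) f -
    expect (convolution P' Q') (fun x => f (x + (a + b))) =
    (expect (convolution P Q) f - expect (convolution P Q') (fun x => f (x + b))) +
    (expect (convolution Q' P) (fun x => f (x + b)) -
     expect (convolution Q' P') (fun x => f (x + (a + b)))).
  rewrite (expect_convolutionC Q' P (mfs b) (fun x => fM _)).
  by rewrite (expect_convolutionC Q' P' (mfs _) (fun x => fM _)) addrA subrK.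
rewrite addrC (le_trans (ler_normD _ _)) // addrC addrC lerD //.
  rewrite E3 E4 -expectB //; apply: expect_norm_le; first exact: integB.
  move=> y; apply: le_trans (close1 (y + b)); rewrite le_eqVlt; apply/orP; left.
  apply/eqP; congr (`|expect _ _ - expect _ _|); apply/funext => x; congr f; ring.
rewrite E1 E2 -expectB //; apply: expect_norm_le; first exact: integB.
move=> x; apply: le_trans (close2 x); rewrite le_eqVlt; apply/orP; left.
by apply/eqP; congr (`|expect _ _ - expect _ _|); apply/funext => y; congr f; ring.
Qed.

End laws.

(** * Means and variances of convolutions *)

Section moments_of_laws.
Context {R : realType}.
Implicit Types (P Q : law R) (f : R -> R).

Definition has_moments P (m v : R) : Prop :=
  [/\ integ P (fun x => x ^+ 2), expect P id = m &
      expect P (fun x => x ^+ 2) = v + m ^+ 2].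

Lemma integ_id P : integ P (fun x => x ^+ 2) -> integ P id.
Proof.
move=> i2; have i3 : integ P (fun x => 1 + x ^+ 2).
  by apply: integD => //; exact: integ_cst.
apply: (integ_le (@measurable_id _ _ _) i3) => x /=.
by rewrite -[x ^+ 2]real_normK ?num_real //; have := sqr_ge0 (`|x| - 1); nra.
Qed.

Lemma expect_sqr_shift P m v (c : R) : has_moments P m v ->
  integ P (fun x => (x + c) ^+ 2) /\
  expect P (fun x => (x + c) ^+ 2) = v + (m + c) ^+ 2.
Proof.
move=> [i2 E1 E2]; have i1 := integ_id i2.
have -> : (fun x : R => (x + c) ^+ 2) =
    (fun x => x ^+ 2 + 2 * c * id x + c ^+ 2).
  by apply/funext => x /=; ring.
have iZ := integZ (2 * c) i1; have ic := @integ_cst _ P (c ^+ 2).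
split; first by apply: integD => //; exact: integD.
rewrite (expectD (integD i2 iZ) ic) (expectD i2 iZ) expectZ // expect_cst E1 E2.
by ring.
Qed.

(** [ge0_expect_convolution] handles nonnegative functions, so only squares [(x + c) ^+ 2] are
    integrated; the mean is read off from the difference between [c = 1] and [c = 0]. *)
Lemma convolution_moments P Q m v m' v' : has_moments P m v ->
  has_moments Q m' v' -> has_moments (convolution P Q) (m + m') (v + v').
Proof.
move=> hP hQ.
have K c : integ (convolution P Q) (fun x => (x + c) ^+ 2) /\
    expect (convolution P Q) (fun x => (x + c) ^+ 2) =
    v + v' + (m + m' + c) ^+ 2.
  have inner x : integ Q (fun y => (x + y + c) ^+ 2) /\
      expect Q (fun y => (x + y + c) ^+ 2) = v' + (x + (m' + c)) ^+ 2.
    have [] := expect_sqr_shift (x + c) hQ.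
    rewrite (_ : (fun y => (y + (x + c)) ^+ 2) = (fun y => (x + y + c) ^+ 2)).
      by move=> i ->; split=> //; congr (_ + _ ^+ 2); ring.
    by apply/funext => y; congr (_ ^+ 2); ring.
  have [iP EP] := expect_sqr_shift (m' + c) hP.
  have E : (fun x => expect Q (fun y => (x + y + c) ^+ 2)) =
      (fun x => v' + (x + (m' + c)) ^+ 2).
    by apply/funext => x; have [] := inner x.
  have ic := @integ_cst _ P v'.
  have [] := @ge0_expect_convolution R P Q (fun x => (x + c) ^+ 2).
  - by apply: measurable_funX; exact: measurable_funD.
  - by move=> x; exact: sqr_ge0.
  - by move=> x; have [] := inner x.
  - by rewrite E; exact: integD.
  by move=> i ->; split=> //; rewrite E expectD // expect_cst EP; ring.
have [i0 E0] := K 0; have [i1 E1] := K 1.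
have sq0 : (fun x : R => (x + 0) ^+ 2) = (fun x => x ^+ 2).
  by apply/funext => x; rewrite addr0.
rewrite sq0 addr0 in i0 E0; split=> //.
have ii := integ_id i0.
have sq1 : (fun x : R => (x + 1) ^+ 2) = (fun x => x ^+ 2 + 2 * id x + 1).
  by apply/funext => x /=; ring.
move: E1; rewrite sq1 !expectD ?expectZ ?expect_cst ?E0 //.
- by lra.
- exact: integZ.
- by apply: integD => //; exact: integZ.
- exact: integ_cst.
Qed.

Lemma has_moments_mean P m v : has_moments P m v -> law_mean P = m.
Proof.
move=> [i2 <- _]; rewrite /law_mean unlock /=.
by rewrite (expectE (integ_id i2)).
Qed.

Lemma has_moments_variance P m v : has_moments P m v ->
  law_variance P = v%:E.
Proof.
move=> h; have [i E] := expect_sqr_shift (- m) h.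
rewrite /law_variance /variance covariance.unlock -/(law_mean P) (has_moments_mean h).
rewrite expectation.unlock.
have -> : v = expect P (fun x => (x - m) ^+ 2) by rewrite E subrr expr0n addr0.
by rewrite -expectE.
Qed.

Lemma has_moments_sd P m v : has_moments P m v -> law_sd P = Num.sqrt v.
Proof. by move=> h; rewrite /law_sd (has_moments_variance h). Qed.

Lemma P3_moments P : in_P3 P -> [/\ integ P (fun x => `|x| ^+ 3),
  0 < law_sd P & has_moments P (law_mean P) (law_sd P ^+ 2)].
Proof.
move=> [m3 v0].
have i3 : integ P (fun x => `|x| ^+ 3).
  apply/integrableP; split.
    by apply/measurable_EFinP/measurable_funX; exact: normr_measurable.
  apply: le_lt_trans m3; rewrite le_eqVlt; apply/orP; left; apply/eqP.
  by apply: eq_integral => x _ /=; rewrite ger0_norm // exprn_ge0.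
have i2 : integ P (fun x => x ^+ 2) by exact: integ_cubic (cubic_growth_sqr).
have h : has_moments P (expect P id) (expect P (fun x => x ^+ 2) - expect P id ^+ 2).
  by split=> //; rewrite subrK.
have v0' : 0 < expect P (fun x => x ^+ 2) - expect P id ^+ 2.
  by move: v0; rewrite (has_moments_variance h) lte_fin.
rewrite (has_moments_mean h) (has_moments_sd h) sqr_sqrtr ?(ltW v0') //.
by rewrite sqrtr_gt0.
Qed.

Lemma law_rhoE P : law_rho P =
  expect P (fun x => `|(x - law_mean P) / law_sd P| ^+ 3).
Proof. by []. Qed.

Lemma P3_one_step P (L : R) (f f1 f2 : R -> R) : in_P3 P -> C2lip L f f1 f2 ->
  `|expect P f -
    (f (law_sd P + law_mean P) + f (- law_sd P + law_mean P)) / 2| <=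
  L * (law_sd P ^+ 3 * Bfun (law_rho P) / 6).
Proof.
move=> P3 fL; have [i3 s0 h] := P3_moments P3.
set s := law_sd P in s0 h *; set m := law_mean P in h *.
have EF : expectation_functional (fun g => expect P (fun x => g (x - m))).
  have := expectation_functional_affine 1 (- m) (expect_functional i3).
  congr expectation_functional; apply/funext => g; congr expect.
  by apply/funext => x; rewrite mul1r.
have gL := C2lip_shift m fL.
have := functional_one_step EF gL s0; rewrite /=.
have [i1 E1] : integ P id /\ expect P id = m by case: h => /integ_id.
have -> : expect P (fun x => x - m) = 0.
  by rewrite (expectB i1 (integ_cst P m)) expect_cst E1 subrr.
have [_ ->] := expect_sqr_shift (- m) h.
rewrite subrr expr0n addr0 => /(_ erefl erefl).
rewrite (_ : (fun x : R => f (x - m + m)) = f); last first.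
  by apply/funext => x; rewrite subrK.
by rewrite law_rhoE.
Qed.

End moments_of_laws.

(** * Two-point laws, the unit law and the replacement induction *)

Section lindeberg.
Context {R : realType}.
Implicit Types (P Q : law R) (f : R -> R).

Lemma ge0_integral_two_point (s : R) f : measurable_fun [set: R] f ->
  (forall x, 0 <= f x) ->
  (\int[two_point s]_x (f x)%:E = ((f s + f (- s)) / 2)%:E)%E.
Proof.
move=> mf f0; have mf' : measurable_fun [set: R] (EFin \o f) by exact/measurable_EFinP.
have f0' x : [set: R]%classic x -> (0 <= (EFin \o f) x)%E by rewrite lee_fin.
have E1 (k : {nonneg R}) := @ge0_integral_mscale _ _ R (measure_add \d_(- s : measurableTypeR R)
  \d_(s : measurableTypeR R)) _ measurableT k _ mf' f0'.
apply: (etrans (E1 _)).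
have E2 := @ge0_integral_measure_add _ _ R \d_(- s : measurableTypeR R)
  \d_(s : measurableTypeR R) _ measurableT _ f0' mf'.
apply: (etrans (congr1 (fun z => (_ * z)%E) E2)).
rewrite !integral_dirac // !diracT !mul1e /= -EFinD -EFinM.
by congr EFin; rewrite mulrC addrC.
Qed.

Lemma expect_two_point (s : R) f : measurable_fun [set: R] f ->
  integ (two_point s) f /\ expect (two_point s) f = (f s + f (- s)) / 2.
Proof.
move=> mf; pose fp x := Num.max 0 (f x); pose fn x := Num.max 0 (- f x).
have mfp : measurable_fun [set: R] fp by exact: measurable_maxr.
have mfn : measurable_fun [set: R] fn.
  by apply: measurable_maxr => //; exact: measurable_funN.
have fp0 x : 0 <= fp x by rewrite /fp le_max lexx.
have fn0 x : 0 <= fn x by rewrite /fn le_max lexx.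
have [i1 e1] := integ_expect_of mfp fp0 (ge0_integral_two_point s mfp fp0).
have [i2 e2] := integ_expect_of mfn fn0 (ge0_integral_two_point s mfn fn0).
have fE x : f x = fp x - fn x.
  rewrite /fp /fn; case: (leP 0 (f x)) => fx.
    have /max_idPl -> : - f x <= 0 by rewrite oppr_le0.
    by rewrite subr0.
  have /max_idPr -> : 0 <= - f x by rewrite oppr_ge0 ltW.
  by rewrite sub0r opprK.
have -> : f = (fun x => fp x - fn x) by exact/funext.
split; first exact: integB.
by rewrite expectB // e1 e2; field.
Qed.

Lemma two_point_moments (s : R) : has_moments (two_point s) 0 (s ^+ 2).
Proof.
have [i2 e2] := expect_two_point s (measurable_funX 2 (@measurable_id _ R setT)).
have [i1 e1] := expect_two_point s (@measurable_id _ R setT).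
by split=> //; [rewrite e1 subrr mul0r | rewrite e2; field].
Qed.

Definition dirac0 : law R := \d_(0 : measurableTypeR R).

Lemma integral_dirac0 (g : R -> \bar R) : measurable_fun [set: R] g ->
  (\int[dirac0]_x g x)%E = g 0.
Proof.
move=> mg.
have := @integral_dirac _ _ (0 : measurableTypeR R) R _ measurableT _ mg.
by rewrite diracT mul1e => E; exact: E.
Qed.

Lemma expect_dirac0 f : measurable_fun [set: R] f -> expect dirac0 f = f 0.
Proof.
move=> mf; rewrite /expect /Rintegral integral_dirac0 //.
exact/measurable_EFinP.
Qed.

Lemma dirac0_moments : has_moments dirac0 0 0.
Proof.
have [] := @integ_expect_of R dirac0 (fun x => x ^+ 2) 0.
- exact: measurable_funX.
- by move=> x; exact: sqr_ge0.
- rewrite integral_dirac0 ?expr0n //.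
  by apply/measurable_EFinP; exact: measurable_funX.
move=> i e; split=> //; first by rewrite expect_dirac0 //; exact: measurable_id.
by rewrite e expr0n addr0.
Qed.

Lemma convolution_law_recl n (P : 'I_n.+1 -> law R) :
  convolution_law P =
  convolution (P ord0) (convolution_law (fun i => P (lift ord0 i))).
Proof. by rewrite /convolution_law big_ord_recl. Qed.

Lemma convolution_law0 (P : 'I_0 -> law R) : convolution_law P = dirac0.
Proof. by rewrite /convolution_law big_ord0. Qed.

Lemma convolution_law_moments n (P : 'I_n -> law R) (m v : 'I_n -> R) :
  (forall i, has_moments (P i) (m i) (v i)) ->
  has_moments (convolution_law P) (\sum_i m i) (\sum_i v i).
Proof.
elim: n P m v => [|n IH] P m v h.
  by rewrite convolution_law0 !big_ord0; exact: dirac0_moments.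
rewrite convolution_law_recl !big_ord_recl.
by apply: convolution_moments => //; exact: IH.
Qed.

(** Freezing the other summands shifts [f], and [C2lip L] is stable under shifts, so the hypothesis
    on a single factor applies. The shifts [m i] allow [P i] to be uncentered while [Q i] is
    centered. *)
Lemma convolution_law_close n (P Q : 'I_n -> law R) (m c : 'I_n -> R) (L : R) :
  (forall i f f1 f2, C2lip L f f1 f2 ->
    `|expect (P i) f - expect (Q i) (fun x => f (x + m i))| <= c i) ->
  forall f f1 f2, C2lip L f f1 f2 ->
  `|expect (convolution_law P) f -
    expect (convolution_law Q) (fun x => f (x + \sum_i m i))| <= \sum_i c i.
Proof.
elim: n P Q m c => [|n IH] P Q m c close f f1 f2 fL.
  have mf := C2lip_measurable fL.
  rewrite !convolution_law0 !big_ord0 !expect_dirac0 //; last exact: measurable_shift.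
  by rewrite addr0 subrr normr0.
rewrite !convolution_law_recl !big_ord_recl.
have [M fM] : exists M : R, forall x, `|f x| <= M by case: fL.
apply: (convolution_close (C2lip_measurable fL) fM).
  move=> y; have := close ord0 _ _ _ (C2lip_shift y fL).
  by congr (`|_ - expect _ _| <= _); apply/funext => x; rewrite addrAC.
move=> x; have E (z : R) : x + z = z + x by rewrite addrC.
under [X in expect _ X]eq_fun do rewrite E.
under [X in _ - expect _ X]eq_fun do rewrite E.
have := IH _ _ _ _ (fun i => close (lift ord0 i)) _ _ _ (C2lip_shift x fL).
by [].
Qed.

End lindeberg.

(** * The first inequality: reduction to two-point laws *)

Section two_point_reduction.
Context {R : realType}.

Lemma sumr_sqr_gt0 (I : finType) (p : pred I) (s : I -> R) (i : I) : p i ->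
  0 < s i -> 0 < \sum_(j | p j) s j ^+ 2.
Proof.
move=> pi si; rewrite (bigD1 i pi); apply: ltr_pwDl; first exact: exprn_gt0.
by apply: sumr_ge0 => j _; exact: sqr_ge0.
Qed.

Lemma F3oo_C2lip (f : R -> R) : F3oo f -> C2lip 1 f f^`()%classic f^`(2)%classic.
Proof.
move=> [bf df ddf _ lf]; split.
- have [M [_ MP]] := bf; exists (M + 1) => x.
  by apply: MP => //; rewrite ltrDl.
- by move=> x; rewrite derive1E; exact: derivableP.
- by move=> x; have /derivableP := ddf x; rewrite -derive1E.
- by move=> x y; rewrite mul1r.
Qed.

Lemma zeta3_le (P Q : law R) (c : R) :
  (forall f f1 f2, C2lip 1 f f1 f2 -> `|expect P f - expect Q f| <= c) ->
  (zeta3 P Q <= c%:E)%E.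
Proof.
move=> H; apply: ge_ereal_sup => _ [f /F3oo_C2lip fL <-].
have fc := C2lip_measurable fL; have [M fM] : exists M : R, forall x, `|f x| <= M.
  by case: fL.
rewrite !expectE; [|exact: integ_bounded fM..].
by rewrite -EFinB abse_EFin lee_fin; exact: H fL.
Qed.

Lemma expect_standardized (P : law R) (f f1 f2 : R -> R) (L : R) :
  C2lip L f f1 f2 ->
  expect (standardized_law P) f =
  expect P (fun x => f ((x - law_mean P) / law_sd P)).
Proof.
move=> fL; have mf := C2lip_measurable fL; have [M fM] : exists M : R, forall x, `|f x| <= M.
  by case: fL.
rewrite /expect /Rintegral /standardized_law integral_distribution //.
  exact/measurable_EFinP.
apply: (@integ_bounded R P M (f \o standardize P)) => [|x]; last exact: fM.
by apply: measurableT_comp => //; exact: measurable_standardize.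
Qed.

Lemma zeta3_triangle (P P' Q : law R) (c : R) :
  (forall f f1 f2, C2lip 1 f f1 f2 -> `|expect P f - expect P' f| <= c) ->
  (zeta3 P Q <= c%:E + zeta3 P' Q)%E.
Proof.
move=> H; apply: ge_ereal_sup => _ [f F3f <-]; have fL := F3oo_C2lip F3f.
have mf := C2lip_measurable fL; have [M fM] : exists M : R, forall x, `|f x| <= M.
  by case: fL.
have i (V : law R) : integ V f by exact: integ_bounded fM.
apply: (@le_trans _ _ (c%:E + `|\int[P']_x (f x)%:E - \int[Q]_x (f x)%:E|)%E).
  rewrite !expectE // -!EFinB !abse_EFin -EFinD lee_fin.
  have := H _ _ _ fL; have := ler_distD (expect P' f) (expect P f) (expect Q f).
  by lra.
by rewrite leeD2l //; apply: ereal_sup_ubound; exists f.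
Qed.

Lemma zeta3_two_point_reduction n (n_gt0 : (0 < n)%N)
    (P : 'I_n -> law R) (P3 : forall i, in_P3 (P i))
    (s := fun i => law_sd (P i)) (Q := fun i => two_point (s i) : law R)
    (sigma := Num.sqrt (\sum_(i < n) s i ^+ 2))
    (rho := fun i => law_rho (P i)) :
  (zeta3 (standardized_law (convolution_law P)) std_normal <=
     (1 / (6 * sigma ^+ 3) * \sum_(i < n) s i ^+ 3 * Bfun (rho i))%:E +
     zeta3 (standardized_law (convolution_law Q)) std_normal)%E.
Proof.
have hP i : has_moments (P i) (law_mean (P i)) (s i ^+ 2).
  by have [] := P3_moments (P3 i).
have s0 i : 0 < s i by have [] := P3_moments (P3 i).
have hQ i : has_moments (Q i) 0 (s i ^+ 2) by exact: two_point_moments.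
have HP := convolution_law_moments hP; have HQ := convolution_law_moments hQ; rewrite big1_eq in HQ.
have sig0 : 0 < sigma.
  by rewrite sqrtr_gt0; exact: (sumr_sqr_gt0 _ (s0 (Ordinal n_gt0))).
apply: zeta3_triangle => f f1 f2 fL.
rewrite (expect_standardized _ fL) (expect_standardized _ fL).
rewrite (has_moments_mean HP) (has_moments_sd HP) (has_moments_mean HQ).
rewrite (has_moments_sd HQ) -/sigma.
set m := \sum_i _.
(* Standardization is moved into the test function; the factor [sigma ^- 3] of the bound is its new
   Lipschitz constant. *)
have gL := C2lip_affine sigma^-1 (- m / sigma) fL.
pose L := 1 * `|sigma^-1| ^+ 3.
have := @convolution_law_close R n P Q (fun i => law_mean (P i))
  (fun i => L * (s i ^+ 3 * Bfun (rho i) / 6)) L _ _ _ _ gL.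
rewrite -/m.
have -> : (fun x => f (sigma^-1 * x + - m / sigma)) = (fun x => f ((x - m) / sigma)).
  by apply/funext => x; congr f; field; rewrite gt_eqF.
have -> : (fun x => f (sigma^-1 * (x + m) + - m / sigma)) = (fun x => f ((x - 0) / sigma)).
  by apply/funext => x; congr f; field; rewrite gt_eqF.
move=> H; apply: le_trans (H _) _.
  move=> i g g1 g2 gL'; have := P3_one_step (P3 i) gL'.
  have [_ ->] := expect_two_point (s i) (measurable_shift (law_mean (P i)) (C2lip_measurable gL')).
  by [].
rewrite le_eqVlt; apply/orP; left; apply/eqP.
rewrite mulr_sumr; apply: eq_bigr => i _.
rewrite /L ger0_norm ?invr_ge0 ?ltW //; field.
by rewrite gt_eqF.
Qed.

End two_point_reduction.

(** * A lower bound for pi and the numerical constants *)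

Section pi_bound.
Context {R : realType}.
Implicit Types x : R.

Let dsin x : is_derive x (1 : R) sin (cos x).
Proof. exact: is_derive_sin. Qed.

Let dcos x : is_derive x (1 : R) cos (- sin x).
Proof. exact: is_derive_cos. Qed.

(** Used as a ladder: starting from [cos <= 1], each Taylor bound for [sin] or [cos] says that the
    derivative for the next one is nonnegative. *)
Let mono (g dg : R -> R) : (forall x : R, is_derive x (1 : R) g (dg x)) ->
  g 0 = 0 -> (forall x, 0 <= x -> 0 <= dg x) -> forall x, 0 <= x -> 0 <= g x.
Proof.
move=> gd g0 dg0 x x0; rewrite -g0.
by apply: (is_derive_mono x0 gd) => y /andP[y0 _]; exact/dg0/ltW.
Qed.

Lemma sin_le_id x : 0 <= x -> sin x <= x.
Proof.
have ds := dsin; move=> x0; rewrite -subr_ge0; move: x x0.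
apply: (@mono (fun x => x - sin x) (fun x => 1 - cos x)).
- by rewrite sin0 subrr.
- by move=> x _; rewrite subr_ge0 cos_le1.
Qed.

Lemma cos_ge2 x : 0 <= x -> 1 - x ^+ 2 / 2 <= cos x.
Proof.
have dc := dcos; move=> x0; rewrite -subr_ge0; move: x x0.
apply: (@mono (fun x => cos x - (1 - x ^+ 2 / 2)) (fun x => x - sin x)).
- by move=> x; derive_tac; field.
- by rewrite cos0 expr0n /=; ring.
- by move=> x x0; rewrite subr_ge0 sin_le_id.
Qed.

Lemma sin_ge3 x : 0 <= x -> x - x ^+ 3 / 6 <= sin x.
Proof.
have ds := dsin; move=> x0; rewrite -subr_ge0; move: x x0.
apply: (@mono (fun x => sin x - (x - x ^+ 3 / 6))
  (fun x => cos x - (1 - x ^+ 2 / 2))).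
- by move=> x; derive_tac; field.
- by rewrite sin0 expr0n /=; ring.
- by move=> x x0; rewrite subr_ge0 cos_ge2.
Qed.

Lemma cos_le4 x : 0 <= x -> cos x <= 1 - x ^+ 2 / 2 + x ^+ 4 / 24.
Proof.
have dc := dcos; move=> x0; rewrite -subr_ge0; move: x x0.
apply: (@mono (fun x => 1 - x ^+ 2 / 2 + x ^+ 4 / 24 - cos x)
  (fun x => sin x - (x - x ^+ 3 / 6))).
- by move=> x; derive_tac; field.
- by rewrite cos0 !expr0n /=; ring.
- by move=> x x0; rewrite subr_ge0 sin_ge3.
Qed.

Lemma sin_le5 x : 0 <= x -> sin x <= x - x ^+ 3 / 6 + x ^+ 5 / 120.
Proof.
have ds := dsin; move=> x0; rewrite -subr_ge0; move: x x0.
apply: (@mono (fun x => x - x ^+ 3 / 6 + x ^+ 5 / 120 - sin x)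
  (fun x => 1 - x ^+ 2 / 2 + x ^+ 4 / 24 - cos x)).
- by move=> x; derive_tac; field.
- by rewrite sin0 !expr0n /=; ring.
- by move=> x x0; rewrite subr_ge0 cos_le4.
Qed.

Lemma cos_ge6 x : 0 <= x ->
  1 - x ^+ 2 / 2 + x ^+ 4 / 24 - x ^+ 6 / 720 <= cos x.
Proof.
have dc := dcos; move=> x0; rewrite -subr_ge0; move: x x0.
apply: (@mono (fun x => cos x - (1 - x ^+ 2 / 2 + x ^+ 4 / 24 - x ^+ 6 / 720))
  (fun x => x - x ^+ 3 / 6 + x ^+ 5 / 120 - sin x)).
- by move=> x; derive_tac; field.
- by rewrite cos0 !expr0n /=; ring.
- by move=> x x0; rewrite subr_ge0 sin_le5.
Qed.

(* [cos] is negative just above [pi / 2], but its Taylor polynomial at half of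
   that point forces it to be positive. *)
Lemma pi_ge : 333 / 106 <= pi :> R.
Proof.
rewrite leNgt; apply/negP => pilt; pose y : R := 333 / 424.
have y0 : 0 <= y by rewrite /y; lra.
have pi2 := @pi_ge2 R.
have yE : y *+ 2 = 333 / 212 by rewrite -mulr_natl /y; field.
have in1 : y *+ 2 \in `[0, pi].
  by rewrite yE in_itv /=; apply/andP; split; lra.
have in2 : (pi / 2 : R) \in `[0, pi].
  by rewrite in_itv /=; apply/andP; split; lra.
have c2 : cos (y *+ 2) < cos (pi / 2).
  by rewrite (ltr_cos in2 in1) yE; lra.
move: c2; rewrite cos_pihalf cos_mulr2n.
(* [169 / 239] is slightly above [1 / sqrt 2]. *)
have c : 169 / 239 <= cos y.
  by apply: le_trans (cos_ge6 y0); rewrite /y; lra.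
have : (169 / 239) ^+ 2 <= cos y ^+ 2.
  by apply: lerXn2r => //; rewrite nnegrE; lra.
by rewrite -mulr_natl; lra.
Qed.

Lemma normal_constant_le :
  1 / 6 * (2 * Num.sqrt (2 / pi) - 1) <= 993 / 10000 :> R.
Proof.
have p := pi_ge; have p0 := @pi_gt0 R.
(* [0.0993 = (2 * 0.7979 - 1) / 6] exactly. The bound by 0.7979 asks for [pi] above about 3.14147,
   which [333 / 106 = 3.14150...] barely provides. *)
suff : Num.sqrt (2 / pi) <= 7979 / 10000 :> R by lra.
rewrite -[leRHS]ger0_norm; last by lra.
rewrite -sqrtr_sqr ler_sqrt; last by exact: sqr_ge0.
by rewrite ler_pdivrMr //; lra.
Qed.

Lemma smoothing_constant_le : 1 / (6 * Num.sqrt (2 * pi)) <= 665 / 10000 :> R.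
Proof.
have p := pi_ge; have p0 := @pi_gt0 R.
(* 2.50627 is just above [1 / (6 * 0.0665) = 2.506265...]. *)
have s : 2506 / 1000 + 27 / 100 / 1000 <= Num.sqrt (2 * pi) :> R.
  rewrite -[leLHS]ger0_norm; last by lra.
  rewrite -sqrtr_sqr ler_sqrt; last by lra.
  by lra.
rewrite ler_pdivrMr; last by lra.
by lra.
Qed.

End pi_bound.

(** * Integration against a normal law through its density *)

Section density.
Context {R : realType} (m s : R).
Local Notation mu := (@lebesgue_measure R).
Local Notation G := (normal_prob m s : law R).
Local Open Scope ereal_scope.
Import HBNNSimple.

Let pdf x : \bar R := (normal_pdf m s x)%:E.

Let mpdf : measurable_fun [set: R] pdf.
Proof. by apply/measurable_EFinP; exact: measurable_normal_pdf. Qed.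

Let pdf0 x : 0 <= pdf x.
Proof. by rewrite lee_fin normal_pdf_ge0. Qed.

Let integral_indic_normal (E : set R) : measurable E ->
  \int[G]_x (\1_E x)%:E = \int[mu]_x ((\1_E x)%:E * pdf x).
Proof.
move=> mE; rewrite integral_indic // setIT /= /normal_prob.
rewrite integral_mkcond; apply: eq_integral => x _.
rewrite patchE indicE; case: ifPn => xE; first by rewrite mul1e.
by rewrite mul0e.
Qed.

Let integral_nnsfun_normal (h : {nnsfun R >-> R}) :
  \int[G]_x (h x)%:E = \int[mu]_x ((h x)%:E * pdf x).
Proof.
have mh r : measurable_fun [set: R] (fun x : R => (r * \1_(h @^-1` [set r]) x)%:E).
  by apply/measurable_EFinP/measurable_funM => //; exact: measurable_indic.
under [LHS]eq_integral do rewrite fimfunE -fsumEFin//.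
rewrite [LHS]ge0_integral_fsum//; last first.
    by move=> n x _; rewrite EFinM nnfun_muleindic_ge0.
under [RHS]eq_integral.
  move=> x xD; rewrite fimfunE -fsumEFin// ge0_mule_fsuml; last first.
    by move=> r; rewrite EFinM nnfun_muleindic_ge0.
  over.
rewrite [RHS]ge0_integral_fsum//; last 2 first.
  - by move=> r; apply: emeasurable_funM => //; exact: mh.
  - by move=> n x _; rewrite EFinM mule_ge0// nnfun_muleindic_ge0.
apply: eq_fsbigr => r /[!inE] -[y _ yr].
have r0 : (0 <= r)%R by rewrite -yr.
have mi : measurable_fun [set: R] (fun x : R => (\1_(h @^-1` [set r]) x : R)%:E).
  by apply/measurable_EFinP; exact: measurable_indic.
have i0 (x : R) : 0 <= (\1_(h @^-1` [set r]) x : R)%:E.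
  by rewrite lee_fin.
under eq_integral do rewrite EFinM.
under [RHS]eq_integral do rewrite EFinM -muleA.
transitivity (r%:E * \int[G]_x (\1_(h @^-1` [set r]) x)%:E).
  by apply: ge0_integralZl => //; rewrite lee_fin.
rewrite integral_indic_normal //; apply/esym/ge0_integralZl => //.
- exact: emeasurable_funM.
- by move=> x _; rewrite mule_ge0.
Qed.

(** The usual extension: indicators, where it is the definition of the law, then simple functions by
    linearity, then monotone limits. *)
Lemma ge0_integral_normal_prob (f : R -> \bar R) : measurable_fun [set: R] f ->
  (forall x, 0 <= f x) -> \int[G]_x f x = \int[mu]_x (f x * pdf x).
Proof.
move=> mf f0; pose f_ := nnsfun_approx measurableT mf.
have mfn n : measurable_fun [set: R] (fun x : R => (f_ n x)%:E).
  exact/measurable_EFinP/measurable_funP.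
have nd a b (x : R) : (a <= b)%N -> (f_ a x <= f_ b x)%R.
  by move=> ab; have /lefP := nd_nnsfun_approx measurableT mf ab; exact.
transitivity (limn (fun n => \int[G]_x (f_ n x)%:E)).
  rewrite -monotone_convergence//=.
  - apply: eq_integral => x /[!inE] xD; apply/esym/cvg_lim => //=.
    by apply: cvg_nnsfun_approx => // y _; exact: f0.
  - by move=> n x _; rewrite lee_fin.
  - by move=> x _ a b ab; rewrite lee_fin; exact: nd.
transitivity (limn (fun n => \int[mu]_x ((f_ n x)%:E * pdf x))).
  by congr (limn _); apply/funext => n /=; rewrite integral_nnsfun_normal.
rewrite -monotone_convergence//=.
- apply: eq_integral => x /[!inE] xD; apply/cvg_lim => //=.
  apply: cvgeZr => //; apply: cvg_nnsfun_approx => // y _; exact: f0.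
- by move=> n; apply: emeasurable_funM => //; exact: mfn.
- by move=> n x _; rewrite mule_ge0 // lee_fin.
- move=> x _ a b ab; rewrite lee_wpmul2r // lee_fin.
  exact: nd.
Qed.

End density.

(** * Affine images and integrability for normal laws *)

Section gaussian.
Context {R : realType}.
Local Notation mu := (@lebesgue_measure R).
Implicit Types (f g : R -> R) (x s m : R).

(** The second parameter is the standard deviation, not the variance. *)
Definition gaussian m s : law R := normal_prob m s.

Lemma sqrt_2pi_gt0 : 0 < Num.sqrt (2 * pi) :> R.
Proof. by rewrite sqrtr_gt0 mulr_gt0 // pi_gt0. Qed.

Lemma gaussian_pdfE m s x : 0 < s -> normal_pdf m s x =
  (Num.sqrt (2 * pi) * s)^-1 * expR (- ((x - m) / s) ^+ 2 / 2).
Proof.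
move=> s0; rewrite normal_pdfE ?gt_eqF // /normal_peak /normal_fun.
congr (_^-1 * expR _).
  have -> : s ^+ 2 * pi *+ 2 = (2 * pi) * s ^+ 2 by rewrite -mulr_natl; ring.
  by rewrite sqrtrM ?sqrtr_sqr ?(gtr0_norm s0) // mulr_ge0 // pi_ge0.
by rewrite -mulr_natl; field; rewrite gt_eqF.
Qed.

Lemma ge0_integral_gaussian_affine m s f : 0 < s -> continuous f ->
  (forall x, 0 <= f x) ->
  (\int[gaussian m s]_x (f x)%:E = \int[gaussian 0 1]_x (f (s * x + m))%:E)%E.
Proof.
move=> s0 cf f0; have sN : s != 0 by rewrite gt_eqF.
(* The map [s * x + m] is written as a multiple of a translation, the form from which its limits at
   infinity are read off. *)
pose F (x : R) : R := (x + m / s) * s.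
have FE x : F x = s * x + m by rewrite /F; field.
have Fd x : is_derive x (1 : R) F s by rewrite /F; derive_tac; ring.
have F'E : F^`()%classic = cst s.
  by apply/funext => x; rewrite derive1E; exact: derive_val.
have cF : continuous F by exact: is_derive_cvg Fd.
have cG : continuous (fun x => f x * normal_pdf m s x).
  move=> x; apply: cvgM; first exact: cf.
  by apply: continuous_normal_pdf; rewrite gt_eqF.
have mf : measurable_fun [set: R] (fun x => (f x)%:E).
  by apply/measurable_EFinP; exact: continuous_measurable_fun.
have cfF : continuous (fun x => f (s * x + m)).
  under eq_fun do rewrite -FE.
  by move=> x; apply: continuous_comp; [exact: cF | exact: cf].
have mfF : measurable_fun [set: R] (fun x => (f (s * x + m))%:E).
  by apply/measurable_EFinP; exact: continuous_measurable_fun.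
have f0' x : (0 <= (f x)%:E)%E by rewrite lee_fin.
have fF0' x : (0 <= (f (s * x + m))%:E)%E by rewrite lee_fin.
rewrite [LHS](ge0_integral_normal_prob m s mf f0').
rewrite [RHS](ge0_integral_normal_prob 0 1 mfF fF0').
under eq_integral do rewrite -EFinM.
rewrite (@increasing_ge0_integration_by_substitutionT _ F
  (fun x => f x * normal_pdf m s x)) //; first last.
- by move=> x; rewrite mulr_ge0 // normal_pdf_ge0.
- by apply: gt0_cvgMly => //; exact: cvg_addrr.
- by apply: gt0_cvgMlNy => //; exact: cvg_addrr_Ny.
- by rewrite F'E; exact: is_cvg_cst.
- by rewrite F'E; exact: is_cvg_cst.
- by rewrite F'E => x; exact: cvg_cst.
- by move=> x y xy; rewrite /F ltr_pM2r // ltrD2r.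
apply: eq_integral => x _; rewrite F'E !fctE /= FE -EFinM; congr EFin.
rewrite -mulrA; congr (_ * _); rewrite !gaussian_pdfE //.
rewrite mulrAC; congr (_ * expR _); last by field.
by field; rewrite sN gt_eqF // sqrt_2pi_gt0.
Qed.

Lemma ge0_expect_gaussian m s f : 0 < s -> continuous f ->
  (forall x, 0 <= f x) -> integ (gaussian 0 1) (fun x => f (s * x + m)) ->
  integ (gaussian m s) f /\
  expect (gaussian m s) f = expect (gaussian 0 1) (fun x => f (s * x + m)).
Proof.
move=> s0 cf f0 i; apply: integ_expect_of => //.
  exact: continuous_measurable_fun.
by rewrite ge0_integral_gaussian_affine // expectE.
Qed.

Lemma expect_gaussian m s f (M : R) : 0 < s -> continuous f ->
  (forall x, `|f x| <= M) ->
  expect (gaussian m s) f = expect (gaussian 0 1) (fun x => f (s * x + m)).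
Proof.
move=> s0 cf fM; pose g x := f x + M.
have cg : continuous g by move=> x; apply: cvgD; [exact: cf | exact: cvg_cst].
have g0 x : 0 <= g x by have := fM x; rewrite ler_norml /g => /andP[? _]; lra.
have caff : continuous (fun x => f (s * x + m)).
  move=> x; apply: (@continuous_comp _ _ _ (fun x => s * x + m) f); last exact: cf.
  apply: cvgD; last exact: cvg_cst.
  by apply: cvgM; [exact: cvg_cst | exact: cvg_id].
have i1 : integ (gaussian 0 1) (fun x => f (s * x + m)).
  by apply: (@integ_bounded _ _ M) => //; exact: continuous_measurable_fun.
have i2 : integ (gaussian m s) f.
  by apply: (@integ_bounded _ _ M) => //; exact: continuous_measurable_fun.
have ic (P : law R) := @integ_cst R P M.
have [_] := @ge0_expect_gaussian m s g s0 cg g0 (integD i1 (ic _)).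
rewrite (expectD i2 (ic _)) (expectD i1 (ic _)) !expect_cst.
exact: addIr.
Qed.

Lemma expR_ge_sqr (y : R) : 0 <= y -> y ^+ 2 / 2 <= expR y.
Proof.
move=> y0; apply: le_trans (expR_ge1Dxn 1 y0).
by rewrite lerDr.
Qed.

Lemma expR_gauss_le x : x ^+ 4 * expR (- x ^+ 2 / 2) <= 8.
Proof.
have y0 : 0 <= x ^+ 2 / 2 by rewrite divr_ge0 // sqr_ge0.
have h := expR_ge_sqr y0.
have {}h : x ^+ 4 <= 8 * expR (x ^+ 2 / 2).
  by have -> : x ^+ 4 = 4 * (x ^+ 2 / 2) ^+ 2; [field | lra].
by rewrite mulNr expRN ler_pdivrMr ?expR_gt0.
Qed.

Lemma integ_gaussian_pow4 : integ (gaussian 0 1) (fun x => x ^+ 4).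
Proof.
have mf : measurable_fun [set: R] (fun x : R => (x ^+ 4)%:E).
  by apply/measurable_EFinP; exact: measurable_funX.
have f0 (x : R) : (0 <= (x ^+ 4)%:E)%E by rewrite lee_fin exprn_even_ge0.
apply/integrableP; split=> //.
under eq_integral do rewrite /= ger0_norm ?exprn_even_ge0 //.
rewrite ge0_integral_normal_prob //.
(* Domination by a normal density of standard deviation 2. With [e = expR (- (x / 2) ^+ 2 / 2)] the
   exponential in the standard density is [e ^+ 4], and [expR_gauss_le] at [x / 2] gives
   [x ^+ 4 * e <= 128]; the factor 2 compensates the normalization. *)
pose C : R := 128 * 2.
apply: (@le_lt_trans _ _ (\int[mu]_x (C%:E * (normal_pdf 0 2 x)%:E))%E).
  apply: ge0_le_integral => //.
  - by move=> x _; rewrite mule_ge0 // lee_fin normal_pdf_ge0.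
  - by apply: emeasurable_funM => //; apply/measurable_EFinP; exact: measurable_normal_pdf.
  - by apply: emeasurable_funM => //; apply/measurable_EFinP; exact: measurable_normal_pdf.
  move=> x _; rewrite -!EFinM lee_fin !gaussian_pdfE // !subr0 !invr1 !mulr1.
  have p0 := sqrt_2pi_gt0; rewrite invfM /C.
  have -> : 128 * 2 * ((Num.sqrt (2 * pi))^-1 * 2^-1 * expR (- (x / 2) ^+ 2 / 2)) =
    (Num.sqrt (2 * pi))^-1 * (128 * expR (- (x / 2) ^+ 2 / 2)) by field; rewrite gt_eqF.
  rewrite mulrCA ler_pM2l ?invr_gt0 //.
  have -> : - x ^+ 2 / 2 = - (x / 2) ^+ 2 / 2 + - (x / 2) ^+ 2 / 2 +
      - (x / 2) ^+ 2 / 2 + - (x / 2) ^+ 2 / 2 by field.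
  rewrite !expRD; have e0 := expR_gt0 (- (x / 2) ^+ 2 / 2).
  have e1 : expR (- (x / 2) ^+ 2 / 2) <= 1.
    by rewrite -expR0 ler_expR mulNr oppr_le0 divr_ge0 // sqr_ge0.
  have h1 := expR_gauss_le (x / 2).
  move: (expR _) e0 e1 h1 => e e0 e1 h1.
  have h2 : x ^+ 4 * e <= 128.
    have x4 : (x / 2) ^+ 4 = x ^+ 4 / 16 by field.
    by rewrite x4 in h1; lra.
  have e3 : 0 <= e * e * e by rewrite !mulr_ge0 // ltW.
  have := ler_wpM2r e3 h2.
  have e2 : e * e <= 1 by rewrite mulr_ile1 // ltW.
  have := ler_wpM2r (ltW e0) e2.
  by lra.
rewrite ge0_integralZl //.
- by rewrite integral_normal_pdf mule1 ltry.
- by apply/measurable_EFinP; exact: measurable_normal_pdf.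
- by move=> x _; rewrite lee_fin normal_pdf_ge0.
- by rewrite lee_fin /C; lra.
Qed.

Lemma integ_gaussian_growth f : measurable_fun [set: R] f ->
  (exists C : R, forall x, `|f x| <= C * (1 + x ^+ 4)) ->
  integ (gaussian 0 1) f.
Proof.
move=> mf [C fC]; apply: (integ_le mf _ fC); apply: integZ.
by apply: integD; [exact: integ_cst | exact: integ_gaussian_pow4].
Qed.

Lemma pow_le_1D4 k x : (k <= 4)%N -> `|x| ^+ k <= 1 + x ^+ 4.
Proof.
move=> k4; have -> : x ^+ 4 = `|x| ^+ 4.
  by rewrite -normrX ger0_norm // exprn_even_ge0.
have [x1|/ltW x1] := leP `|x| 1.
  by rewrite (@le_trans _ _ 1) ?exprn_ile1 // lerDl exprn_ge0.
by rewrite (@le_trans _ _ (`|x| ^+ 4)) ?lerDr // ler_weXn2l.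
Qed.

Lemma integ_gaussian_norm k : (k <= 4)%N ->
  integ (gaussian 0 1) (fun x => `|x| ^+ k).
Proof.
move=> k4; apply: integ_gaussian_growth.
  by apply: measurable_funX; exact: normr_measurable.
exists 1 => x; rewrite mul1r ger0_norm ?exprn_ge0 //.
exact: pow_le_1D4.
Qed.

Lemma integ_gaussian_pow k : (k <= 4)%N -> integ (gaussian 0 1) (fun x => x ^+ k).
Proof.
move=> k4; apply: integ_gaussian_growth; first exact: measurable_funX.
by exists 1 => x; rewrite mul1r normrX; exact: pow_le_1D4.
Qed.

Local Notation p := (normal_pdf 0 1 : R -> R).

Lemma expect_gaussian_density g : integ (gaussian 0 1) g ->
  mu.-integrable [set: R] (fun x => (g x * p x)%:E) /\
  (\int[mu]_x (g x * p x)%:E = (expect (gaussian 0 1) g)%:E)%E.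
Proof.
move=> ig; have mg := integ_measurable ig.
have pos h : (forall x, 0 <= h x) -> integ (gaussian 0 1) h ->
    mu.-integrable [set: R] (fun x => (h x * p x)%:E) /\
    (\int[mu]_x (h x * p x)%:E = (expect (gaussian 0 1) h)%:E)%E.
  move=> h0 ih; have mh := integ_measurable ih.
  have E : (\int[mu]_x (h x * p x)%:E = (expect (gaussian 0 1) h)%:E)%E.
    have mh' : measurable_fun [set: R] (fun x => (h x)%:E) by exact/measurable_EFinP.
    have h0' x : (0 <= (h x)%:E)%E by rewrite lee_fin.
    rewrite -expectE // [RHS](ge0_integral_normal_prob 0 1 mh' h0').
    by apply: eq_integral => x _; rewrite EFinM.
  split=> //; apply/integrableP; split.
    apply/measurable_EFinP; apply: measurable_funM => //.
    exact: measurable_normal_pdf.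
  under eq_integral do rewrite /= ger0_norm ?mulr_ge0 ?normal_pdf_ge0 //.
  by rewrite E ltry.
pose gp x := Num.max 0 (g x); pose gn x := Num.max 0 (- g x).
have gp0 x : 0 <= gp x by rewrite /gp le_max lexx.
have gn0 x : 0 <= gn x by rewrite /gn le_max lexx.
have mgp : measurable_fun [set: R] gp by exact: measurable_maxr.
have mgn : measurable_fun [set: R] gn.
  by apply: measurable_maxr => //; exact: measurable_funN.
have iabs : integ (gaussian 0 1) (fun x => `|g x|).
  exact: (integrable_norm ig).
have igp : integ (gaussian 0 1) gp.
  apply: (integ_le mgp iabs) => x; rewrite ger0_norm // /gp.
  by rewrite ge_max normr_ge0 ler_norm.
have ign : integ (gaussian 0 1) gn.
  apply: (integ_le mgn iabs) => x; rewrite ger0_norm // /gn.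
  by rewrite ge_max normr_ge0 -normrN ler_norm.
have gE x : g x = gp x - gn x.
  rewrite /gp /gn; have [g0|/ltW g0] := leP 0 (g x).
    have /max_idPl -> : - g x <= 0 by rewrite oppr_le0.
    by rewrite subr0.
  have /max_idPr -> : 0 <= - g x by rewrite oppr_ge0.
  by rewrite sub0r opprK.
have [i1 e1] := pos _ gp0 igp; have [i2 e2] := pos _ gn0 ign.
have E (x : R) : (g x * p x)%:E = ((gp x * p x)%:E - (gn x * p x)%:E)%E.
  by rewrite -EFinB -mulrBl -gE.
have EE : (fun x : R => (g x * p x)%:E) =
    (fun x => ((gp x * p x)%:E - (gn x * p x)%:E)%E) by exact/funext.
rewrite EE.
split; first exact: integrableB.
rewrite integralB // e1 e2 -EFinB -expectB //.
by congr (expect _ _)%:E; apply/funext => x; rewrite gE.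
Qed.

Lemma is_derive_gaussian_pdf x : is_derive x (1 : R) p (- x * p x).
Proof.
pose c : R := (Num.sqrt (2 * pi) * 1)^-1.
have pE y : p y = c * expR (- y ^+ 2 / 2).
  by rewrite gaussian_pdfE // subr0 divr1.
have de (y : R) : is_derive y (1 : R) expR (expR y) by exact: is_derive_expR.
rewrite (_ : p = fun y => c * expR (- y ^+ 2 / 2)); last exact/funext.
by derive_tac; field.
Qed.

Lemma gaussian_pdf_decay x : x ^+ 4 * p x <= 8 / Num.sqrt (2 * pi).
Proof.
have q0 := sqrt_2pi_gt0; rewrite gaussian_pdfE // subr0 divr1 mulr1 mulrCA.
by rewrite mulrC ler_wpM2r ?invr_ge0 ?(ltW q0) // expR_gauss_le.
Qed.

End gaussian.

(** * Stein's identity and the moments of the standard normal law *)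

Section stein.
Context {R : realType}.
Local Notation mu := (@lebesgue_measure R).
Local Notation p := (normal_pdf 0 1 : R -> R).
Local Notation N01 := (@gaussian R 0 1).

(** The density decays at least like [x ^- 4], which beats cubic growth by one power; this kills the
    boundary terms in Stein's identity. *)
Lemma gaussian_pdf_boundary (G : R -> R) : 
  (exists C : R, forall x, `|G x| <= C * (1 + `|x| ^+ 3)) ->
  exists2 K : R, 0 <= K & forall x, 1 <= `|x| -> `|G x * p x| <= K / `|x|.
Proof.
move=> [C GC]; have q0 := @sqrt_2pi_gt0 R.
have C0 : 0 <= C.
  by have := le_trans (normr_ge0 _) (GC 0); rewrite normr0 expr0n addr0 mulr1.
have K0 : 0 <= 2 * C * (8 / Num.sqrt (2 * pi)).
  by rewrite !mulr_ge0 // invr_ge0 ltW.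
exists (2 * C * (8 / Num.sqrt (2 * pi))) => // x x1.
have x0 : 0 < `|x| by exact: lt_le_trans x1.
have p0 := @normal_pdf_ge0 R 0 1 x.
rewrite ler_pdivlMr // normrM (ger0_norm p0).
have dec := gaussian_pdf_decay x.
have x4 : x ^+ 4 = `|x| ^+ 4 by rewrite -normrX ger0_norm // exprn_even_ge0.
rewrite x4 in dec.
have h : `|G x| * p x * `|x| <= C * (1 + `|x| ^+ 3) * p x * `|x|.
  by rewrite ler_wpM2r // ler_wpM2r.
apply: le_trans h _.
have g : (1 + `|x| ^+ 3) * `|x| <= 2 * `|x| ^+ 4.
  have a3 : 1 <= `|x| ^+ 3 by rewrite exprn_ege1.
  have := ler_wpM2r (ltW x0) a3; have -> : `|x| ^+ 4 = `|x| ^+ 3 * `|x| by rewrite exprSr.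
  lra.
have := ler_wpM2l (mulr_ge0 C0 p0) g.
have := ler_wpM2l C0 dec.
lra.
Qed.

(** With [p] the density, [(G' x - x * G x) * p x] is the derivative of [G x * p x]. Its integral
    over a growing interval is a boundary term tending to 0, and also tends to the expectation by
    dominated convergence. *)
Lemma gaussian_stein (G G' : R -> R) :
  (forall x : R, is_derive x (1 : R) G (G' x)) -> continuous G' ->
  (exists C : R, forall x, `|G x| <= C * (1 + `|x| ^+ 3)) ->
  integ N01 (fun x => G' x - x * G x) ->
  expect N01 (fun x => G' x - x * G x) = 0.
Proof.
move=> Gd cG' GC ih; have [ihp Ehp] := expect_gaussian_density ih.
have [K K0 FK] := gaussian_pdf_boundary GC.
pose hp (x : R) := (G' x - x * G x) * p x; pose F (x : R) := G x * p x.
have pd := @is_derive_gaussian_pdf R.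
have Fd (x : R) : is_derive x (1 : R) F (hp x).
  by rewrite /F /hp; derive_tac; ring.
have cp : continuous p by apply: continuous_normal_pdf; exact: oner_neq0.
have cF := is_derive_cvg Fd.
have chp : continuous hp.
  move=> x; apply: cvgM; last exact: cp.
  apply: cvgB; first exact: cG'.
  by apply: cvgM; [exact: cvg_id | exact: (is_derive_cvg Gd)].
(* The successor keeps the interval nondegenerate and its endpoints in the range [1 <= |x|] of the
   boundary estimate. *)
pose u (n : nat) : R := n.+1%:R.
have u1 n : 1 <= u n by rewrite /u ler1n.
have ftc n : (\int[mu]_(x in `[(- u n)%R, u n]%classic) (hp x)%:E =
    (F (u n) - F (- u n))%R%:E)%E.
  rewrite (@continuous_FTC2 _ hp F) //.
  - by rewrite (lt_trans (y := 0)) ?oppr_lt0 // (lt_le_trans ltr01).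
  - exact: continuous_subspaceT.
  - split.
    + by move=> x _; exact: ex_derive.
    + by apply: cvg_at_right_filter; exact: cF.
    + by apply: cvg_at_left_filter; exact: cF.
  - by move=> x _; rewrite derive1E; exact: derive_val.
pose f_ (n : nat) : R -> \bar R := (EFin \o hp) \_ `[- u n, u n]%classic.
have mhp : measurable_fun [set: R] (EFin \o hp).
  by apply/measurable_EFinP; exact: continuous_measurable_fun.
have mf_ n : measurable_fun [set: R] (f_ n).
  by apply/(measurable_restrictT _ _).1 => //; exact: measurable_funTS.
have df_ : {ae mu, forall x n, [set: R]%classic x ->
    (`|f_ n x| <= (abse \o (EFin \o hp)) x)%E}.
  apply: aeW => x n _; rewrite /f_ patchE; case: ifPn => // _.
  by rewrite -[point]/(0%E : \bar R) abse0 abse_ge0.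
have ia : mu.-integrable [set: R] (abse \o (EFin \o hp)).
  exact: integrable_abse.
have [|_ _ dc] := @dominated_convergence _ _ _ mu _ measurableT f_
  (EFin \o hp) (abse \o (EFin \o hp)) mf_ mhp _ ia df_.
  apply: aeW => x _; apply: cvg_near_cst.
  have := nbhs_infty_ger `|x|; apply: filterS => n xn.
  rewrite /f_ patchE mem_set //= in_itv /=.
  by rewrite -ler_norml (le_trans xn) // /u ler_nat.
have {}dc : ((fun n => (F (u n) - F (- u n))%:E) @ \oo -->
    ((expect N01 (fun x => G' x - x * G x))%:E : \bar R))%classic.
  rewrite -Ehp; apply: cvg_trans dc; apply: near_eq_cvg; apply: nearW => n /=.
  by rewrite -ftc [RHS]integral_mkcond.
have lim1 : ((fun n => F (u n) - F (- u n)) @ \oo -->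
    expect N01 (fun x => G' x - x * G x))%classic by exact: (fine_cvg dc).
have lim0 : ((fun n => F (u n) - F (- u n)) @ \oo --> (0 : R))%classic.
  apply/cvgrPdist_le => e e0; have := nbhs_infty_ger (2 * K / e).
  apply: filterS => n ne; rewrite sub0r normrN.
  have un0 : 0 < u n by exact: lt_le_trans (u1 n).
  have b1 : `|F (u n)| <= K / u n.
    by have := FK (u n); rewrite (gtr0_norm un0); apply.
  have b2 : `|F (- u n)| <= K / u n.
    by have := FK (- u n); rewrite normrN (gtr0_norm un0); apply.
  apply: (le_trans (ler_normB _ _)); apply: (le_trans (lerD b1 b2)).
  rewrite -mulrDl ler_pdivrMr //.
  have : 2 * K / e <= u n by rewrite (le_trans ne) // /u ler_nat.
  rewrite ler_pdivrMr //; lra.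
exact: (cvg_unique (@norm_hausdorff _ R) lim1 lim0).
Qed.

(** Stein's identity for [G = 1]; the choices [x], [x ^+ 3] and [x * |x|] give the second, fourth
    and third absolute moments. *)
Lemma expect_gaussian_id : expect N01 id = 0.
Proof.
have d (x : R) : is_derive x (1 : R) (fun _ : R => 1 : R) 0 by exact: is_derive_cst.
have i1 := @integ_gaussian_pow R _ (isT : (1 <= 4)%N).
have := @gaussian_stein (fun=> 1) (fun=> 0) d _ _ _.
have -> : (fun x : R => 0 - x * 1) = (fun x => - id x).
  by apply/funext => x; rewrite sub0r mulr1.
rewrite expectN //; move=> H; apply/eqP; rewrite -oppr_eq0; apply/eqP; apply: H.
- by move=> x; exact: cvg_cst.
- by exists 1 => x; rewrite normr1 mul1r lerDl exprn_ge0.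
- exact: integN.
Qed.

Lemma expect_gaussian_sqr : expect N01 (fun x => x ^+ 2) = 1.
Proof.
have d (x : R) : is_derive x (1 : R) (fun x : R => x) 1 by exact: is_derive_id.
have i2 := @integ_gaussian_pow R _ (isT : (2 <= 4)%N).
have := @gaussian_stein id (fun=> 1) d _ _ _.
have -> : (fun x : R => 1 - x * id x) = (fun x => 1 - x ^+ 2) by [].
rewrite (expectB (integ_cst _ 1) i2) expect_cst => H.
apply/eqP; rewrite eq_sym -subr_eq0; apply/eqP; apply: H.
- by move=> x; exact: cvg_cst.
- by have [_] := @cubic_growth_id R.
- by apply: integB => //; exact: integ_cst.
Qed.

Lemma expect_gaussian_pow4 : expect N01 (fun x => x ^+ 4) = 3.
Proof.
have d (x : R) : is_derive x (1 : R) (fun x : R => x ^+ 3) (3 * x ^+ 2).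
  by derive_tac; ring.
have i2 := @integ_gaussian_pow R _ (isT : (2 <= 4)%N).
have i4 := @integ_gaussian_pow R _ (isT : (4 <= 4)%N).
have := @gaussian_stein (fun x => x ^+ 3) (fun x => 3 * x ^+ 2) d _ _ _.
have -> : (fun x : R => 3 * x ^+ 2 - x * x ^+ 3) = (fun x => 3 * x ^+ 2 - x ^+ 4).
  by apply/funext => x; rewrite [x ^+ 4]exprS.
rewrite (expectB (integZ 3 i2) i4) expectZ // expect_gaussian_sqr mulr1 => H.
apply/eqP; rewrite eq_sym -subr_eq0; apply/eqP; apply: H.
- by move=> x; apply: cvgM; [exact: cvg_cst | exact: exprn_continuous].
- by exists 1 => x; rewrite mul1r normrX lerDr.
- by apply: integB => //; exact: integZ.
Qed.

(** Here Stein's identity would require [G] to be the sign function, which is not differentiable.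
    Instead, by symmetry, the integral is doubled from the half line, where [x * p x] is the
    derivative of [- p x]. *)
Lemma expect_gaussian_norm : expect N01 (fun x => `|x|) = 2 / Num.sqrt (2 * pi).
Proof.
have i1 := @integ_gaussian_norm R _ (isT : (1 <= 4)%N).
have [_] := expect_gaussian_density i1.
have cp : continuous p by apply: continuous_normal_pdf; exact: oner_neq0.
rewrite ge0_symfun_integralT; first last.
- move=> x /=; rewrite normrN; congr (_ * _).
  by rewrite !gaussian_pdfE // !subr0 !divr1 sqrrN.
- by move=> x; apply: cvgM; [apply: (norm_continuous (V := R)) | exact: cp].
- by move=> x; rewrite mulr_ge0 // normal_pdf_ge0.
have pd := @is_derive_gaussian_pdf R.
have Fd (x : R) : is_derive x (1 : R) (fun y => - p y) (x * p x).
  by derive_tac; ring.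
rewrite -set_itvcy (@ge0_continuous_FTC2y _ (fun x => `|x| ^+ 1 * p x) (fun y => - p y) 0 0).
- have -> : p 0 = (Num.sqrt (2 * pi))^-1.
    by rewrite gaussian_pdfE // subr0 mul0r expr0n /= oppr0 mul0r expR0 !mulr1.
  by rewrite -EFinB sub0r opprK -EFinM => -[E]; exact: esym E.
- by move=> x _; rewrite mulr_ge0 // normal_pdf_ge0.
- apply: continuous_subspaceT => x; apply: cvgM; last exact: cp.
  exact: (norm_continuous (V := R)).
- have [K K0 FK] : exists2 K : R, 0 <= K & forall x, 1 <= `|x| -> `|1 * p x| <= K / `|x|.
    apply: (@gaussian_pdf_boundary (fun=> 1)); exists 1 => x.
    by rewrite normr1 mul1r lerDl exprn_ge0.
  apply/cvgrPdist_le => e e0.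
  have := @nbhs_pinfty_ge R (Num.max 1 (K / e)) (num_real _).
  apply: filterS => x; rewrite ge_max => /andP[x1 xe].
  have x0 : 0 < x by exact: lt_le_trans x1.
  rewrite sub0r opprK; have := FK x; rewrite mul1r (gtr0_norm x0) => /(_ x1).
  move=> /le_trans; apply; rewrite ler_pdivrMr //; move: xe.
  by rewrite ler_pdivrMr // mulrC.
- by move=> x _; exact: ex_derive.
- by apply: cvg_at_right_filter; exact: (is_derive_cvg Fd).
- move=> x; rewrite in_itv /= andbT => x0.
  by rewrite derive1E derive_val expr1 gtr0_norm.
Qed.

Lemma expect_gaussian_norm3 :
  expect N01 (fun x => `|x| ^+ 3) = 4 / Num.sqrt (2 * pi).
Proof.
have d := @is_derive_id_norm R.
have i1 := @integ_gaussian_norm R _ (isT : (1 <= 4)%N).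
have i3 := @integ_gaussian_norm R _ (isT : (3 <= 4)%N).
have := @gaussian_stein (fun x => x * `|x|) (fun x => 2 * `|x|) d _ _ _.
have -> : (fun x : R => 2 * `|x| - x * (x * `|x|)) = (fun x => 2 * `|x| - `|x| ^+ 3).
  by apply/funext => x; rewrite mulrA -expr2 -real_normK ?num_real // -exprSr.
rewrite (expectB (integZ 2 i1) i3) expectZ // expect_gaussian_norm => H.
apply/eqP; rewrite eq_sym -subr_eq0; apply/eqP; rewrite -[RHS]H.
- by congr (_ - _); field; rewrite gt_eqF // sqrt_2pi_gt0.
- move=> x; apply: cvgM; first exact: cvg_cst.
  exact: (norm_continuous (V := R)).
- exists 1 => x; rewrite mul1r normrM normr_id.
  have [x1|/ltW x1] := leP `|x| 1.
    by rewrite ler_wpDr ?exprn_ge0 // mulr_ile1.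
  by rewrite -expr2 ler_wpDl // ler_weXn2l.
- by apply: integB => //; exact: integZ.
Qed.

End stein.

(** * Convolution and symmetry of normal laws *)

Section gaussian_convolution.
Context {R : realType}.
Local Notation mu := (@lebesgue_measure R).
Implicit Types (f : R -> R) (x y s t : R).

Lemma normal_pdf_shift x t y : 0 < t -> normal_pdf x t y = normal_pdf 0 t (y - x).
Proof. by move=> t0; rewrite !gaussian_pdfE // subr0. Qed.

(* Completing the square: the joint density of [x ~ N(0, s^2)] and of
   [y ~ N(x, t^2)], factored the other way round. *)
Lemma normal_pdf_bayes s t x y : 0 < s -> 0 < t ->
  let r := Num.sqrt (s ^+ 2 + t ^+ 2) in
  normal_pdf x t y * normal_pdf 0 s x =
  normal_pdf 0 r y * normal_pdf (y * s ^+ 2 / r ^+ 2) (s * t / r) x.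
Proof.
move=> s0 t0 r; have r20 : 0 < s ^+ 2 + t ^+ 2 by rewrite addr_gt0 ?exprn_gt0.
have r0 : 0 < r by rewrite sqrtr_gt0.
have r2 : r ^+ 2 = s ^+ 2 + t ^+ 2 by rewrite sqr_sqrtr // ltW.
have st0 : 0 < s * t / r by rewrite divr_gt0 // mulr_gt0.
rewrite !gaussian_pdfE // !subr0 mulrACA [RHS]mulrACA -!expRD.
have q0 := @sqrt_2pi_gt0 R.
have [sN tN rN qN] : [/\ s != 0, t != 0, r != 0 & Num.sqrt (2 * pi) != 0 :> R].
  by rewrite !gt_eqF.
congr (_ * expR _); first by field; rewrite sN tN rN qN.
have e1 : - (x - y * s ^+ 2 / r ^+ 2) ^+ 2 * r ^+ 2 =
    - x ^+ 2 * r ^+ 2 + 2 * x * y * s ^+ 2 - y ^+ 2 * s ^+ 4 / r ^+ 2 by field.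
have -> : - ((x - y * s ^+ 2 / r ^+ 2) / (s * t / r)) ^+ 2 / 2 =
    (- (x - y * s ^+ 2 / r ^+ 2) ^+ 2 * r ^+ 2) / (2 * s ^+ 2 * t ^+ 2).
  by field; rewrite sN tN rN.
rewrite e1; have -> : - (y / r) ^+ 2 / 2 = - y ^+ 2 / (2 * r ^+ 2) by field.
have e2 : y ^+ 2 / r ^+ 2 * (t ^+ 2 + s ^+ 2) = y ^+ 2.
  by rewrite addrC -r2; field.
have e3 : - y ^+ 2 / (2 * r ^+ 2) +
    (- x ^+ 2 * r ^+ 2 + 2 * x * y * s ^+ 2 - y ^+ 2 * s ^+ 4 / r ^+ 2) /
    (2 * s ^+ 2 * t ^+ 2) =
    - (y ^+ 2 / r ^+ 2 * (t ^+ 2 + s ^+ 2)) / (2 * t ^+ 2) +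
    (- x ^+ 2 * r ^+ 2 + 2 * x * y * s ^+ 2) / (2 * s ^+ 2 * t ^+ 2).
  by field; rewrite sN tN rN.
by rewrite e3 e2 r2; field; rewrite sN tN.
Qed.

(** After the exchange of integrals, [normal_pdf_bayes] reduces the inner one to the total mass of a
    normal density. *)
Lemma ge0_integral_gaussian_mix s t f : 0 < s -> 0 < t -> continuous f ->
  (forall x, 0 <= f x) ->
  (\int[gaussian 0 s]_x \int[gaussian x t]_y (f y)%:E =
   \int[gaussian 0 (Num.sqrt (s ^+ 2 + t ^+ 2))]_y (f y)%:E)%E.
Proof.
move=> s0 t0 cf f0; set r := Num.sqrt _.
have mf : measurable_fun [set: R] (fun y => (f y)%:E).
  by apply/measurable_EFinP; exact: continuous_measurable_fun.
have f0' y : (0 <= (f y)%:E)%E by rewrite lee_fin.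
have mp m v : measurable_fun [set: R] (fun y => (normal_pdf m v y : R)%:E).
  by apply/measurable_EFinP; exact: measurable_normal_pdf.
have p0 (m v y : R) : (0 <= (normal_pdf m v y)%:E)%E.
  by rewrite lee_fin normal_pdf_ge0.
pose g (z : measurableTypeR R * measurableTypeR R) : \bar R :=
  ((f z.2)%:E * (normal_pdf z.1 t z.2)%:E)%E.
have mg : measurable_fun [set: (measurableTypeR R * measurableTypeR R)%type] g.
  apply: emeasurable_funM; first exact: measurableT_comp mf measurable_snd.
  apply/measurable_EFinP.
  rewrite (_ : (fun z => _) = (fun z : measurableTypeR R * measurableTypeR R =>
    normal_pdf 0 t (z.2 - z.1))); last first.
    by apply/funext => z; exact: normal_pdf_shift.
  apply: (measurableT_comp (measurable_normal_pdf 0 t)).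
  by apply: measurable_funB; [exact: measurable_snd | exact: measurable_fst].
have g0 z : (0 <= g z)%E by rewrite mule_ge0.
have inner x : (\int[gaussian x t]_y (f y)%:E = \int[mu]_y g (x, y))%E.
  exact: ge0_integral_normal_prob.
under eq_integral do rewrite inner.
have mF := measurable_fun_fubini_tonelli_F (m2 := mu) g mg g0.
have F0 x : (0 <= \int[mu]_y g (x, y))%E by apply: integral_ge0.
rewrite [LHS](ge0_integral_normal_prob 0 s mF F0).
rewrite [RHS](ge0_integral_normal_prob 0 r mf f0').
pose h (z : measurableTypeR R * measurableTypeR R) : \bar R :=
  (g z * (normal_pdf 0 s z.1)%:E)%E.
have mh : measurable_fun [set: (measurableTypeR R * measurableTypeR R)%type] h.
  apply: emeasurable_funM => //.
  exact: measurableT_comp (mp 0 s) measurable_fst.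
have h0 z : (0 <= h z)%E by rewrite mule_ge0.
transitivity (\int[mu]_x \int[mu]_y h (x, y))%E.
  apply: eq_integral => x _; rewrite /fubini_F /h /= ge0_integralZr //.
  exact: measurableT_comp mg (pair1_measurable x).
rewrite (fubini_tonelli h mh h0).
apply: eq_integral => y _.
transitivity (\int[mu]_x (((f y)%:E * (normal_pdf 0 r y)%:E) *
   (normal_pdf (y * s ^+ 2 / r ^+ 2) (s * t / r) x)%:E))%E.
  apply: eq_integral => x _; rewrite /h /g /= -!EFinM; congr EFin.
  by rewrite -mulrA normal_pdf_bayes // mulrA.
have c0 : (0 <= (f y)%:E * (normal_pdf 0 r y)%:E)%E by rewrite mule_ge0.
transitivity (((f y)%:E * (normal_pdf 0 r y)%:E) *
   \int[mu]_x (normal_pdf (y * s ^+ 2 / r ^+ 2) (s * t / r) x)%:E)%E.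
  by apply: ge0_integralZl => //; exact: mp.
by rewrite integral_normal_pdf mule1.
Qed.

Lemma expect_gaussian_convolution s t f (M : R) : 0 < s -> 0 < t ->
  continuous f -> (forall x, `|f x| <= M) ->
  expect (convolution (gaussian 0 s) (gaussian 0 t)) f =
  expect (gaussian 0 (Num.sqrt (s ^+ 2 + t ^+ 2))) f.
Proof.
move=> s0 t0 cf fM; pose g x := f x + M.
have cg : continuous g by move=> x; apply: cvgD; [exact: cf | exact: cvg_cst].
have g0 x : 0 <= g x by have := fM x; rewrite ler_norml /g => /andP[? _]; lra.
have mg : measurable_fun [set: R] g by exact: continuous_measurable_fun.
have ifP (P : law R) : integ P f.
  by apply: (@integ_bounded _ _ M) => //; exact: continuous_measurable_fun.
apply: (addIr M).
have A (P : law R) : expect P f + M = expect P g.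
  by rewrite /g (expectD (ifP P) (integ_cst P M)) expect_cst.
rewrite (A (convolution _ _)) (A (gaussian _ _)) /expect /Rintegral; congr fine.
rewrite (ge0_integral_convolution _ _ mg g0).
rewrite -(ge0_integral_gaussian_mix s0 t0 cg g0); apply: eq_integral => x _.
have cgs : continuous (fun y => g (x + y)).
  move=> y; apply: (@continuous_comp _ _ _ (fun y => x + y) g); last exact: cg.
  by apply: cvgD; [exact: cvg_cst | exact: cvg_id].
have E1 := ge0_integral_gaussian_affine 0 t0 cgs (fun y => g0 (x + y)).
have E2 := ge0_integral_gaussian_affine x t0 cg g0.
apply: (etrans E1); apply: (etrans _ (esym E2)).
by apply: eq_integral => y _; rewrite addr0 addrC.
Qed.

Lemma ge0_integral_oppr (k : R -> \bar R) : measurable_fun [set: R] k ->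
  (forall x, 0 <= k x)%E -> (\int[mu]_x k (- x)%R = \int[mu]_x k x)%E.
Proof.
move=> mk k0.
pose phi : measurableTypeR R -> measurableTypeR R := -%R.
have mphi : measurable_fun [set: measurableTypeR R] phi by exact: oppr_measurable.
have k0' : {in [set: measurableTypeR R]%classic, forall y, (0 <= k y)%E}.
  by move=> x _; exact: k0.
have E := @ge0_integral_pushforward _ _ (measurableTypeR R) (measurableTypeR R) R
  phi mphi mu setT k measurableT mk k0'.
rewrite preimage_setT in E; rewrite -[LHS]E.
by apply: eq_measure_integral => //= A mA _; exact: lebesgue_measureN.
Qed.

Lemma gaussian_symmetric f (M : R) : continuous f -> (forall x, `|f x| <= M) ->
  expect (gaussian 0 1) (fun x => f (- x)) = expect (gaussian 0 1) f.
Proof.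
move=> cf fM; pose g x := f x + M.
have cg : continuous g by move=> x; apply: cvgD; [exact: cf | exact: cvg_cst].
have cN : continuous (fun x : R => - x) by move=> x; apply: cvgN; exact: cvg_id.
have cgN : continuous (fun x => g (- x)).
  by move=> x; apply: (@continuous_comp _ _ _ (fun y => - y) g); [exact: cN | exact: cg].
have cfN : continuous (fun x => f (- x)).
  by move=> x; apply: (@continuous_comp _ _ _ (fun y => - y) f); [exact: cN | exact: cf].
have g0 x : 0 <= g x by have := fM x; rewrite ler_norml /g => /andP[? _]; lra.
have i1 : integ (gaussian 0 1) f.
  by apply: (@integ_bounded _ _ M) => //; exact: continuous_measurable_fun.
have i2 : integ (gaussian 0 1) (fun x => f (- x)).
  by apply: (@integ_bounded _ _ M) => //; exact: continuous_measurable_fun.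
apply: (addIr M).
have -> : expect (gaussian 0 1) f + M = expect (gaussian 0 1) g.
  by rewrite /g (expectD i1 (integ_cst _ M)) expect_cst.
have -> : expect (gaussian 0 1) (fun x => f (- x)) + M =
    expect (gaussian 0 1) (fun x => g (- x)).
  by rewrite /g (expectD i2 (integ_cst _ M)) expect_cst.
have mg : measurable_fun [set: R] (fun x => (g x)%:E).
  by apply/measurable_EFinP; exact: continuous_measurable_fun.
have mgN : measurable_fun [set: R] (fun x => (g (- x))%:E).
  by apply/measurable_EFinP; exact: continuous_measurable_fun.
have g0' x : (0 <= (g x)%:E)%E by rewrite lee_fin.
have gN0' x : (0 <= (g (- x))%:E)%E by rewrite lee_fin.
rewrite /expect /Rintegral; congr fine.
rewrite [LHS](ge0_integral_normal_prob 0 1 mgN gN0').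
rewrite [RHS](ge0_integral_normal_prob 0 1 mg g0').
pose k (x : R) : \bar R := ((g x)%:E * (normal_pdf 0 1 x)%:E)%E.
have mk : measurable_fun [set: R] k.
  apply: emeasurable_funM => //; apply/measurable_EFinP.
  exact: measurable_normal_pdf.
have k0 x : (0 <= k x)%E by rewrite mule_ge0 // lee_fin normal_pdf_ge0.
transitivity (\int[mu]_x k (- x)%R)%E.
  apply: eq_integral => x _; rewrite /k /=; congr (_ * _%:E)%E.
  by rewrite !gaussian_pdfE // !subr0 !divr1 sqrrN.
exact: ge0_integral_oppr.
Qed.

End gaussian_convolution.

(** * Replacing a two-point law by a normal law *)

Section smoothing.
Context {R : realType}.
Local Notation N01 := (@gaussian R 0 1).
Implicit Types (f g w : R -> R) (x s t : R).

Lemma continuous_affine_comp f (a b : R) : continuous f ->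
  continuous (fun x => f (a * x + b)).
Proof.
move=> cf x; apply: (@continuous_comp _ _ _ (fun x => a * x + b) f); last exact: cf.
apply: cvgD; last exact: cvg_cst.
by apply: cvgM; [exact: cvg_cst | exact: cvg_id].
Qed.

Lemma integ_weighted (P : law R) g w (M a b : R) : continuous g ->
  (forall x, `|g x| <= M) -> integ P w ->
  integ P (fun z => g (a * z + b) * w z).
Proof.
move=> cg gM iw; have mw := integ_measurable iw.
have iabs : integ P (fun z => `|w z|) by exact: (integrable_norm iw).
apply: (integ_le _ (integZ M iabs)).
  apply: measurable_funM => //.
  exact: continuous_measurable_fun (continuous_affine_comp cg).
by move=> z; rewrite normrM ler_wpM2r.
Qed.

(** The Lipschitz bound on [g1] makes the Taylor remainder of [g] quadratic in the step, uniformly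
    in [z]; integrated against [|w|], it fits [is_derive_sqr_remainder] without any exchange of
    limits. The weight [w] is 1 or the factor [z] produced by Stein's identity. *)
Lemma is_derive_expect (P : law R) (g g1 w : R -> R) (K M t : R) :
  (forall x : R, is_derive x (1 : R) g (g1 x)) -> continuous g1 ->
  (forall x y, `|g1 x - g1 y| <= K * `|x - y|) ->
  (forall x, `|g x| <= M) -> (forall x, `|g1 x| <= M) -> integ P w ->
  forall x : R, is_derive x (1 : R)
    (fun x => expect P (fun z => g (t * z + x) * w z))
    (expect P (fun z => g1 (t * z + x) * w z)).
Proof.
move=> gd cg1 lip gM g1M iw x.
have cg := is_derive_cvg gd.
have ig y := @integ_weighted P g w M t y cg gM iw.
have ig1 y := @integ_weighted P g1 w M t y cg1 g1M iw.
have iabs : integ P (fun z => `|w z|) by exact: (integrable_norm iw).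
apply: (@is_derive_sqr_remainder _ _ _ (K / 2 * expect P (fun z => `|w z|))) => h.
have taylor y : `|g (y + h) - g y - h * g1 y| <= K * `|h| ^+ 2 / 2.
  have D (k : R) : is_derive k (1 : R) (fun k => g (y + k) - g y - k * g1 y)
      (g1 (y + k) - g1 y).
    by derive_tac; ring.
  apply: (is_derive_pow_bound D); first by rewrite addr0 subrr mul0r subrr.
  by move=> k; rewrite expr1 (le_trans (lip _ _)) // addrAC subrr add0r.
have E : expect P (fun z => g (t * z + (x + h)) * w z) -
    expect P (fun z => g (t * z + x) * w z) -
    h * expect P (fun z => g1 (t * z + x) * w z) =
    expect P (fun z => g (t * z + (x + h)) * w z - g (t * z + x) * w z -
      h * (g1 (t * z + x) * w z)).
  by rewrite -expectZ // -expectB // -expectB //; [exact: integB | exact: integZ].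
have iI : integ P (fun z => g (t * z + (x + h)) * w z - g (t * z + x) * w z -
      h * (g1 (t * z + x) * w z)).
  by apply: integB; [exact: integB | exact: integZ].
have bnd z : `|g (t * z + (x + h)) * w z - g (t * z + x) * w z -
      h * (g1 (t * z + x) * w z)| <= (K * `|h| ^+ 2 / 2) * `|w z|.
  have -> : g (t * z + (x + h)) * w z - g (t * z + x) * w z -
      h * (g1 (t * z + x) * w z) =
    (g (t * z + x + h) - g (t * z + x) - h * g1 (t * z + x)) * w z.
    by rewrite addrA; ring.
  by rewrite normrM ler_wpM2r.
rewrite E; have -> : K / 2 * expect P (fun z => `|w z|) * h ^+ 2 =
    expect P (fun z => K * `|h| ^+ 2 / 2 * `|w z|).
  by rewrite expectZ // real_normK ?num_real //; field.
have iB := integZ (K * `|h| ^+ 2 / 2) iabs.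
rewrite ler_norml lerNl -expectN //; apply/andP; split; apply: expect_le => //.
- exact: integN.
- by move=> z; rewrite (le_trans _ (bnd z)) // -normrN ler_norm.
- by move=> z; rewrite (le_trans _ (bnd z)) // ler_norm.
Qed.

Lemma is_derive_smoothed (P : law R) (L t : R) (f f1 f2 : R -> R) :
  C2lip L f f1 f2 -> forall x : R,
  is_derive x (1 : R) (fun x => expect P (fun z => f (t * z + x)))
    (expect P (fun z => f1 (t * z + x))).
Proof.
move=> fL x; have [B [fB f1B f2B]] := C2lip_bounded fL.
case: fL => _ fd f1d _; have cf1 := is_derive_cvg f1d.
have f1lip a b : `|f1 a - f1 b| <= B * `|a - b|.
  have D (h : R) : is_derive h (1 : R) (fun h => f1 (b + h) - f1 b) (f2 (b + h)).
    by derive_tac; ring.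
  have := is_derive_pow_bound (c := B) (n := 0) D _ _ (a - b).
  rewrite expr1 divr1 [b + (a - b)]addrC subrK; apply; first by rewrite addr0 subrr.
  by move=> h; rewrite expr0 mulr1.
have one (h : R -> R) : (fun x => expect P (fun z => h (t * z + x) * 1)) =
    (fun x => expect P (fun z => h (t * z + x))).
  by apply/funext => y; congr expect; apply/funext => z; rewrite mulr1.
have := is_derive_expect t fd cf1 f1lip fB f1B (integ_cst P 1) x.
by rewrite one (congr1 (@^~ x) (one f1)).
Qed.

(** Counterpart of [functional_touching] that also admits the quartic [k] of the smoothing step,
    which is outside [cubic_growth]. *)
Lemma gaussian_touching (k : R -> R) (s q0 q1 q2 : R) :
  integ N01 (fun z => k (s * z)) ->
  let q x := q0 + q1 * x + q2 * x ^+ 2 in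
  (forall x, q x <= k x) -> q s = k s -> q (- s) = k (- s) ->
  (k s + k (- s)) / 2 <= expect N01 (fun z => k (s * z)).
Proof.
move=> ik q qk <- <-.
have i1 := @integ_gaussian_pow R _ (isT : (1 <= 4)%N).
have i2 := @integ_gaussian_pow R _ (isT : (2 <= 4)%N).
have Z1 := integZ (q1 * s) i1; have Z2 := integZ (q2 * s ^+ 2) i2.
have ic := integ_cst N01 q0.
have D1 := integD ic Z1; have D2 := integD D1 Z2.
have := expect_le D2 ik _.
rewrite (expectD D1 Z2) (expectD ic Z1) !expectZ // expect_cst.
rewrite (expect_gaussian_sqr : expect N01 (fun x => x ^+ 2) = 1).
rewrite (expect_gaussian_id : expect N01 (fun x => x ^+ 1) = 0).
move=> H; apply: le_trans (H _).
  by rewrite /q le_eqVlt; apply/orP; left; apply/eqP; field.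
by move=> z; apply: le_trans (qk _); rewrite /q exprMn expr1 le_eqVlt;
  apply/orP; left; apply/eqP; ring.
Qed.

(** Symmetrizing [f] changes neither its normal expectation nor its average over [- s] and [s], so
    [even_touching] applies in both Gaussian steps. *)
Lemma even_part_gaussian f (M s : R) : continuous f -> (forall x, `|f x| <= M) ->
  integ N01 (fun z => (f (s * z) + f (- (s * z))) / 2) /\
  expect N01 (fun z => (f (s * z) + f (- (s * z))) / 2) =
  expect N01 (fun z => f (s * z)).
Proof.
move=> cf fM.
have c1 : continuous (fun z => f (s * z)).
  by have := continuous_affine_comp (a := s) (b := 0) cf; under eq_fun do rewrite addr0.
have c2 : continuous (fun z => f (- (s * z))).
  have := continuous_affine_comp (a := - s) (b := 0) cf.
  by under eq_fun do rewrite addr0 mulNr.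
have i1 : integ N01 (fun z => f (s * z)).
  by apply: (@integ_bounded _ _ M) => //; exact: continuous_measurable_fun.
have i2 : integ N01 (fun z => f (- (s * z))).
  by apply: (@integ_bounded _ _ M) => //; exact: continuous_measurable_fun.
have sym := @gaussian_symmetric R (fun z => f (s * z)) M c1 (fun z => fM _).
have E : (fun z => (f (s * z) + f (- (s * z))) / 2) =
    (fun z => 2^-1 * (f (s * z) + f (- (s * z)))).
  by apply/funext => z; rewrite mulrC.
rewrite E; split; first by apply: integZ; exact: integD.
rewrite expectZ; last exact: integD.
rewrite expectD // (_ : (fun z => f (- (s * z))) = (fun z => f (s * - z))).
  by rewrite sym; field.
by apply/funext => z; rewrite mulrN.
Qed.

(** The even part of [f] is compared with [M / 6 * |x| ^+ 3], the case [t = 0] of [cubic_touching].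
    The cost is the excess of [E |Z|^3 = 4 / sqrt (2 pi)] over the value 1 of a random sign. *)
Lemma gaussian_first_step (L s : R) (f f1 f2 : R -> R) : C2lip L f f1 f2 ->
  0 < s ->
  `|(f s + f (- s)) / 2 - expect N01 (fun z => f (s * z))| <=
  L * (s ^+ 3 * (4 / Num.sqrt (2 * pi) - 1) / 6).
Proof.
move=> fL s0; set c := 4 / Num.sqrt (2 * pi).
have i3 := @integ_gaussian_norm R _ (isT : (3 <= 4)%N).
have c1 : 1 <= c.
  have i1 := @integ_gaussian_norm R _ (isT : (1 <= 4)%N).
  have i2 := @integ_gaussian_pow R _ (isT : (2 <= 4)%N).
  (* [3 x ^ 2 <= 1 + 2 |x| ^ 3] *)
  have := expect_le (integZ 3 i2) (integD (integ_cst _ 1) (integZ 2 i3)) _.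
  rewrite expectZ // (expectD (integ_cst _ 1) (integZ 2 i3)) expect_cst expectZ //.
  rewrite expect_gaussian_norm3 expect_gaussian_sqr -/c => H.
  have {}H : 3 * 1 <= 1 + 2 * c.
    apply: H => x; rewrite -real_normK ?num_real //; have := normr_ge0 x.
    set y := `|x| => y0; rewrite -subr_ge0.
    have -> : 1 + 2 * y ^+ 3 - 3 * y ^+ 2 = (1 + 2 * y) * (1 - y) ^+ 2 by ring.
    by rewrite mulr_ge0 ?sqr_ge0 //; lra.
  by lra.
have K0 : 0 <= s ^+ 3 * (c - 1) / 6.
  by rewrite divr_ge0 // mulr_ge0 ?subr_ge0 // exprn_ge0 // ltW.
suff up g g1 g2 : C2lip L g g1 g2 ->
    expect N01 (fun z => g (s * z)) - (g s + g (- s)) / 2 <=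
    L * (s ^+ 3 * (c - 1) / 6).
  have ib : integ N01 (fun z => f (s * z)).
    have cf : continuous f by case: fL => _ fd _ _; exact: is_derive_cvg fd.
    have [M fM] : exists M : R, forall x, `|f x| <= M by case: fL.
    apply: (@integ_bounded _ _ M) => //; apply: continuous_measurable_fun.
    by have := continuous_affine_comp (a := s) (b := 0) cf; under eq_fun do rewrite addr0.
  rewrite ler_norml lerNl opprB (up _ _ _ fL) /=.
  by have := up _ _ _ (C2lip_opp fL); rewrite expectN //; lra.
move=> gL; apply: le_mul_limit => // M LM.
have cg : continuous g by case: gL => _ gd _ _; exact: is_derive_cvg gd.
have [B gB] : exists B : R, forall x, `|g x| <= B by case: gL.
have [ie ee] := even_part_gaussian s cg gB.
case: gL => _ gd g1d g2L.
pose h3 (x : R) : R := `|x| ^+ 3; pose h2 (x : R) : R := x * `|x|.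
have h3d (x : R) : is_derive x (1 : R) h3 (3 * (x * `|x|)) by exact: is_derive_norm3.
have h2d (x : R) : is_derive x (1 : R) h2 (2 * `|x|) by exact: is_derive_id_norm.
pose k x : R := M / 6 * h3 x - (g x + g (- x)) / 2.
pose k1 x : R := M / 2 * h2 x - (g1 x - g1 (- x)) / 2.
pose k2 x : R := M * `|x| - (g2 x + g2 (- x)) / 2.
have kd (x : R) : is_derive x (1 : R) k (k1 x).
  by rewrite /k /k1; derive_tac; rewrite /h2; field.
have k1d (x : R) : is_derive x (1 : R) k1 (k2 x).
  by rewrite /k1 /k2; derive_tac; field.
have [] := even_touching s0 kd k1d.
- by move=> x; rewrite /k /h3 normrN opprK [g (- x) + _]addrC.
- by move=> x; rewrite /k1 /h2 normrN opprK; field.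
- by move=> x; rewrite /k2 normrN opprK [g2 (- x) + _]addrC.
- move=> a b a0 ab; rewrite /k2 (ger0_norm a0) ger0_norm; last first.
    exact: le_trans (ltW ab).
  have := g2L b a; have := g2L (- b) (- a).
  have -> : - b - - a = - (b - a) by ring.
  rewrite normrN (@ger0_norm _ (b - a)) ?subr_ge0 ?(ltW ab) //.
  rewrite !ler_norml => /andP[? ?] /andP[? ?].
  have : L * (b - a) < M * (b - a) by rewrite ltr_pM2r // subr_gt0.
  by lra.
move=> q0 [q1 [q2 [qk qs qNs]]].
have ik3 : integ N01 (fun z => M / 6 * s ^+ 3 * `|z| ^+ 3) by exact: integZ.
have kE : (fun z => k (s * z)) = (fun z => M / 6 * s ^+ 3 * `|z| ^+ 3 -
    (g (s * z) + g (- (s * z))) / 2).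
  apply/funext => z; rewrite /k /h3 normrM exprMn (gtr0_norm s0); ring.
have ik : integ N01 (fun z => k (s * z)) by rewrite kE; exact: integB.
have := gaussian_touching ik qk qs qNs.
rewrite kE (expectB ik3 ie) ee expectZ // expect_gaussian_norm3 -/c.
rewrite /k /h3 normrN (gtr0_norm s0) opprK; lra.
Qed.

(** The function [u], smoothed at scale [t], has a third derivative with Lipschitz constant [Lam],
    so a quartic can replace the cubic of the unsmoothed step. *)
Lemma gaussian_smoothing_step (L s t : R) (f f1 f2 : R -> R)
    (u := fun x => expect N01 (fun z => f (t * z + x))) :
  C2lip L f f1 f2 -> 0 < s -> 0 < t ->
  `|(u s + u (- s)) / 2 - expect N01 (fun z => u (s * z))| <=
  L * (s ^+ 4 / (6 * Num.sqrt (2 * pi) * t)).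
Proof.
move=> fL s0 t0; have q0 := @sqrt_2pi_gt0 R; set c := Num.sqrt (2 * pi) in q0 *.
have tN : t != 0 by rewrite gt_eqF.
have cN : c != 0 by rewrite gt_eqF.
suff up g g1 g2 : C2lip L g g1 g2 ->
    let u x := expect N01 (fun z => g (t * z + x)) in
    (continuous u /\ exists B : R, forall x, `|u x| <= B) /\
    expect N01 (fun z => u (s * z)) - (u s + u (- s)) / 2 <=
    L * (s ^+ 4 / (6 * c * t)).
  have [[cu [B uB]] upf] := up _ _ _ fL; rewrite -/u in cu uB upf.
  have iu : integ N01 (fun z => u (s * z)).
    have mu_ : measurable_fun [set: R]%classic (fun z => u (s * z)).
      have := continuous_affine_comp (a := s) (b := 0) cu.
      by under eq_fun do rewrite addr0; exact: continuous_measurable_fun.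
    exact: (integ_bounded _ mu_ (fun z => uB (s * z))).
  rewrite ler_norml lerNl opprB upf /=.
  have [_] := up _ _ _ (C2lip_opp fL).
  have uN x : expect N01 (fun z => - f (t * z + x)) = - u x.
    rewrite expectN //; have cf : continuous f.
      by case: fL => _ fd _ _; exact: is_derive_cvg fd.
    have [M fM] : exists M : R, forall x, `|f x| <= M by case: fL.
    apply: (@integ_bounded _ _ M) => //; apply: continuous_measurable_fun.
    exact: continuous_affine_comp.
  rewrite !uN (_ : (fun z => _) = (fun z => - u (s * z))); last exact/funext.
  by rewrite expectN //; lra.
move=> gL u'; have L0 := C2lip_ge0 gL; have [B [gB g1B g2B]] := C2lip_bounded gL.
move: @u' => {}u.
pose u1 x := expect N01 (fun z => g1 (t * z + x)).
have ud (x : R) : is_derive x (1 : R) u (u1 x).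
  exact: is_derive_smoothed gL x.
case: gL => _ gd g1d g2L; have cg := is_derive_cvg gd; have cg1 := is_derive_cvg g1d.
have cg2 : continuous g2.
  move=> x; apply/cvgrPdist_le => e e0; near=> y.
  apply: le_trans (g2L _ _) _.
  have : `|x - y| <= e / (L + 1).
    by near: y; apply: cvgr_dist_le; [exact: cvg_id|rewrite divr_gt0 // ltr_wpDl].
  rewrite ler_pdivlMr ?ltr_wpDl // => /(le_trans _); apply.
  by rewrite mulrC ler_wpM2l // lerDl.
have i0 := integ_cst N01 1; have i1 := @integ_gaussian_pow R _ (isT : (1 <= 4)%N).
have in1 := @integ_gaussian_norm R _ (isT : (1 <= 4)%N).
pose u2 x := expect N01 (fun z => g2 (t * z + x)).
pose u3 x := t^-1 * expect N01 (fun z => g2 (t * z + x) * z ^+ 1).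
have one (h : R -> R) : (fun x => expect N01 (fun z => h (t * z + x) * 1)) =
    (fun x => expect N01 (fun z => h (t * z + x))).
  by apply/funext => x; congr expect; apply/funext => z; rewrite mulr1.
have u1d (x : R) : is_derive x (1 : R) u1 (u2 x).
  have := is_derive_expect t g1d cg2 g2L g1B g2B i0 x.
  by rewrite one (congr1 (@^~ x) (one g2)).
have ig1 x : integ N01 (fun z => g1 (t * z + x) * z ^+ 1).
  exact: integ_weighted cg1 g1B i1.
have ig2 x : integ N01 (fun z => g2 (t * z + x) * z ^+ 1).
  exact: integ_weighted cg2 g2B i1.
have ib2 x : integ N01 (fun z => g2 (t * z + x)).
  apply: (@integ_bounded _ _ B) => //; apply: continuous_measurable_fun.
  exact: continuous_affine_comp.
(* Stein's identity trades a derivative of [g1] for a factor [z / t]. The new expression can be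
   differentiated once more although [g2] is merely Lipschitz. *)
have u2E x : u2 x = t^-1 * expect N01 (fun z => g1 (t * z + x) * z ^+ 1).
  have D (z : R) : is_derive z (1 : R) (fun z => g1 (t * z + x)) (t * g2 (t * z + x)).
    by derive_tac; ring.
  have := gaussian_stein D _ _ _.
  have -> : (fun z => t * g2 (t * z + x) - z * g1 (t * z + x)) =
      (fun z => t * g2 (t * z + x) - g1 (t * z + x) * z ^+ 1).
    by apply/funext => z; rewrite expr1 [z * _]mulrC.
  have iZ := integZ t (ib2 x).
  rewrite (expectB iZ (ig1 x)) expectZ // -/(u2 x) => H.
  have {}H : t * u2 x - expect N01 (fun z => g1 (t * z + x) * z ^+ 1) = 0.
    apply: H.
    - move=> z; apply: cvgM; first exact: cvg_cst.
      exact: continuous_affine_comp.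
    - by exists B => z; rewrite (le_trans (g1B _)) // ler_peMr ?lerDl ?exprn_ge0 //
        (le_trans _ (g1B 0)).
    - exact: integB.
  by move/eqP: H; rewrite subr_eq0 => /eqP <-; rewrite mulKf.
have u2d (x : R) : is_derive x (1 : R) u2 (u3 x).
  pose v x := expect N01 (fun z => g1 (t * z + x) * z ^+ 1).
  have vd (y : R) : is_derive y (1 : R) v
      (expect N01 (fun z => g2 (t * z + y) * z ^+ 1)).
    exact: is_derive_expect g1d cg2 g2L g1B g2B i1 y.
  rewrite (_ : u2 = fun x => t^-1 * v x); last exact/funext.
  by rewrite /u3; derive_tac; ring.
(* [L / t] times [E |Z| = 2 / c]. *)
pose Lam := 2 / (c * t) * L.
have u3lip x y : `|u3 x - u3 y| <= Lam * `|x - y|.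
  rewrite /u3 -mulrBr normrM gtr0_norm ?invr_gt0 // -(expectB (ig2 x) (ig2 y)).
  have iI := integB (ig2 x) (ig2 y).
  have iB := integZ (L * `|x - y|) in1.
  have bnd z : `|g2 (t * z + x) * z ^+ 1 - g2 (t * z + y) * z ^+ 1| <=
      L * `|x - y| * `|z| ^+ 1.
    rewrite -mulrBl normrM normrX ler_wpM2r ?exprn_ge0 //.
    apply: le_trans (g2L _ _) _; rewrite opprD addrACA subrr add0r //.
  have -> : Lam * `|x - y| = t^-1 * (L * `|x - y| * (2 / c)).
    by rewrite /Lam; field; rewrite tN cN.
  rewrite ler_wpM2l ?invr_ge0 ?(ltW t0) //.
  have <- : expect N01 (fun z => `|z| ^+ 1) = 2 / c by exact: expect_gaussian_norm.
  rewrite -expectZ // ler_norml lerNl -expectN //.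
  apply/andP; split; apply: expect_le => //.
  - exact: integN.
  - by move=> z; rewrite (le_trans _ (bnd z)) // -normrN ler_norm.
  - by move=> z; rewrite (le_trans _ (bnd z)) // ler_norm.
have uB x : `|u x| <= B.
  apply: expect_norm_le => //; apply: (@integ_bounded _ _ B) => //.
  apply: continuous_measurable_fun; exact: continuous_affine_comp.
have cu := is_derive_cvg ud.
split; first by split=> //; exists B.
(* [Lam / 24 * (E Z^4 - 1)] with [E Z^4 = 3] is [Lam / 12]. *)
have -> : L * (s ^+ 4 / (6 * c * t)) = Lam * (s ^+ 4 / 12).
  by rewrite /Lam; field; rewrite tN cN.
apply: le_mul_limit => [|M LM].
  by rewrite divr_ge0 // exprn_ge0 // ltW.
have [ie ee] := even_part_gaussian s cu uB.
pose k x : R := M / 24 * x ^+ 4 - (u x + u (- x)) / 2.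
pose k1 x : R := M / 6 * x ^+ 3 - (u1 x - u1 (- x)) / 2.
pose k2 x : R := M / 2 * x ^+ 2 - (u2 x + u2 (- x)) / 2.
have kd (x : R) : is_derive x (1 : R) k (k1 x).
  by rewrite /k /k1; derive_tac; field.
have k1d (x : R) : is_derive x (1 : R) k1 (k2 x).
  by rewrite /k1 /k2; derive_tac; field.
have k2d (x : R) : is_derive x (1 : R) k2 (M * x - (u3 x - u3 (- x)) / 2).
  by rewrite /k2; derive_tac; field.
have [] := even_touching s0 kd k1d.
- by move=> x; rewrite /k opprK [u (- x) + _]addrC; ring.
- by move=> x; rewrite /k1 opprK; field.
- by move=> x; rewrite /k2 opprK [u2 (- x) + _]addrC; ring.
(* The derivative of [k2] at [y > 0] is positive: the odd part of [u3] is at most [Lam * y], which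
   is less than [M * y]. *)
- move=> a b a0 ab; have [y /andP[ay yb] E] := MVT_is_derive ab k2d.
  rewrite -subr_gt0 E mulr_gt0 ?subr_gt0 //.
  have y0 : 0 < y by exact: le_lt_trans ay.
  have := u3lip y (- y); rewrite opprK -mulr2n normrMn (gtr0_norm y0) -mulr_natr.
  rewrite ler_norml => /andP[_ h].
  have : Lam * y < M * y by rewrite ltr_pM2r.
  by lra.
move=> r0 [r1 [r2 [qk qs qNs]]].
have i4 := @integ_gaussian_pow R _ (isT : (4 <= 4)%N).
have ik4 : integ N01 (fun z => M / 24 * s ^+ 4 * z ^+ 4) by exact: integZ.
have kE : (fun z => k (s * z)) = (fun z => M / 24 * s ^+ 4 * z ^+ 4 -
    (u (s * z) + u (- (s * z))) / 2).
  by apply/funext => z; rewrite /k exprMn; ring.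
have ik : integ N01 (fun z => k (s * z)) by rewrite kE; exact: integB.
have := gaussian_touching ik qk qs qNs.
rewrite kE (expectB ik4 ie) ee expectZ // expect_gaussian_pow4.
by rewrite /k opprK; lra.
Unshelve. all: by end_near. Qed.

End smoothing.

(** * Replacing all two-point laws in succession *)

Section two_point_sums.
Context {R : realType}.
Implicit Types (P Q W : law R) (f : R -> R) (s t : R).
Local Notation c := (Num.sqrt (2 * pi) : R).

Lemma expect_convolutionA P Q W f (M : R) : measurable_fun [set: R]%classic f ->
  (forall x, `|f x| <= M) ->
  expect (convolution P (convolution Q W)) f =
  expect (convolution (convolution P Q) W) f.
Proof.
move=> mf fM.
have [-> _] := expect_convolution P (convolution Q W) mf fM.
have [-> ig] := expect_convolution (convolution P Q) W mf fM.
have mg := integ_measurable ig.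
have gM x : `|expect W (fun z => f (x + z))| <= M.
  apply: expect_norm_le => //; apply: (@integ_bounded _ _ M) => //.
  exact: measurable_shiftl.
have [-> _] := expect_convolution P Q mg gM.
congr expect; apply/funext => x.
have [-> _] := expect_convolution Q W (measurable_shiftl x mf) (fun y => fM (x + y)).
by congr expect; apply/funext => y; congr expect; apply/funext => z; rewrite addrA.
Qed.

Lemma two_point_smoothing (L s t : R) (f f1 f2 : R -> R) : C2lip L f f1 f2 ->
  0 < s -> 0 < t ->
  `|expect (convolution (gaussian 0 t) (two_point s)) f -
    expect (gaussian 0 (Num.sqrt (t ^+ 2 + s ^+ 2))) f| <=
  L * (s ^+ 4 / (6 * c * t)).
Proof.
move=> fL s0 t0; have mf := C2lip_measurable fL.
have cf : continuous f by case: fL => _ fd _ _; exact: is_derive_cvg fd.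
have [M fM] : exists M : R, forall x, `|f x| <= M by case: fL.
pose u x := expect (gaussian 0 1) (fun z => f (t * z + x)).
have cs x : continuous (fun y => f (y + x)).
  by have := continuous_affine_comp (a := 1) (b := x) cf; under eq_fun do rewrite mul1r.
have uE x : expect (gaussian 0 t) (fun y => f (y + x)) = u x.
  have E := expect_gaussian 0 t0 (cs x) (fun y => fM (y + x)).
  by rewrite [LHS]E; congr expect; apply/funext => z; rewrite addr0.
have is_ x : integ (gaussian 0 t) (fun y => f (y + x)).
  exact: (integ_bounded _ (measurable_shift x mf) (fun y => fM (y + x))).
have E1 : expect (convolution (gaussian 0 t) (two_point s)) f =
    (u s + u (- s)) / 2.
  have [E _] := expect_convolution (gaussian 0 t) (two_point s) mf fM.
  rewrite [LHS]E -!uE -expectD // mulrC -expectZ; last exact: integD.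
  congr expect; apply/funext => x.
  have [_ E'] := expect_two_point s (measurable_shiftl x mf).
  by rewrite [LHS]E' mulrC.
have cu : continuous u by exact: is_derive_cvg (is_derive_smoothed _ t fL).
have uM x : `|u x| <= M by rewrite -uE; exact: expect_norm_le.
have E2 : expect (gaussian 0 (Num.sqrt (t ^+ 2 + s ^+ 2))) f =
    expect (gaussian 0 1) (fun z => u (s * z)).
  have := expect_gaussian_convolution s0 t0 cf fM; rewrite addrC => <-.
  have [E iu] := expect_convolution (gaussian 0 s) (gaussian 0 t) mf fM.
  have uE' : (fun x => expect (gaussian 0 t) (fun y => f (x + y))) = u.
    apply/funext => x; rewrite -uE; congr expect.
    by apply/funext => y; rewrite addrC.
  apply: (etrans E); apply: (etrans (congr1 (expect (gaussian 0 s)) uE')).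
  apply: (etrans (expect_gaussian 0 s0 cu uM)).
  apply: (congr1 (expect (gaussian 0 1))); apply/funext => z.
  exact: (congr1 u (addr0 _)).
by rewrite E1 E2; exact: gaussian_smoothing_step fL s0 t0.
Qed.

(** The induction varies [t]: the normal factor absorbs the next two-point law and goes on with
    standard deviation [t'], which produces the prefix sums under the root. *)
Lemma gaussian_two_points_close n (s : 'I_n -> R) (L t : R) (f f1 f2 : R -> R) :
  C2lip L f f1 f2 -> 0 < t -> (forall i, 0 < s i) ->
  `|expect (convolution (gaussian 0 t)
       (convolution_law (fun i => two_point (s i) : law R))) f -
    expect (gaussian 0 (Num.sqrt (t ^+ 2 + \sum_i s i ^+ 2))) f| <=
  \sum_i L * (s i ^+ 4 / (6 * c *
    Num.sqrt (t ^+ 2 + \sum_(j < n | (j < i)%N) s j ^+ 2))).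
Proof.
move=> fL t0 s0; have mf := C2lip_measurable fL.
have [M fM] : exists M : R, forall x, `|f x| <= M by case: fL.
elim: n s t t0 s0 => [|n IH] s t t0 s0.
  rewrite convolution_law0 !big_ord0 addr0 sqrtr_sqr (gtr0_norm t0).
  have [E _] := expect_convolution (gaussian 0 t) dirac0 mf fM.
  have E' : (fun x => expect dirac0 (fun y => f (x + y))) = f.
    by apply/funext => x; rewrite (expect_dirac0 (measurable_shiftl x mf)) addr0.
  by rewrite E E' subrr normr0.
set W := convolution_law (fun i => two_point (s (lift ord0 i)) : law R).
rewrite convolution_law_recl -/W (expect_convolutionA _ _ _ mf fM).
pose t' := Num.sqrt (t ^+ 2 + s ord0 ^+ 2).
have t2 : 0 < t ^+ 2 + s ord0 ^+ 2 by rewrite addr_gt0 // exprn_gt0.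
have t'0 : 0 < t' by rewrite sqrtr_gt0.
have t'2 : t' ^+ 2 = t ^+ 2 + s ord0 ^+ 2 by rewrite sqr_sqrtr // ltW.
have := IH (fun i => s (lift ord0 i)) t' t'0 (fun i => s0 _).
rewrite t'2 -/W => H2.
have H1 : `|expect (convolution (convolution (gaussian 0 t) (two_point (s ord0))) W) f -
    expect (convolution (gaussian 0 t') W) f| <=
    L * (s ord0 ^+ 4 / (6 * c * t)).
  have := @convolution_close R (convolution (gaussian 0 t) (two_point (s ord0)))
    (gaussian 0 t') W W f M 0 0 (L * (s ord0 ^+ 4 / (6 * c * t))) 0 mf fM.
  rewrite !addr0; under [X in _ -> _ -> `|_ - expect _ X| <= _]eq_fun do rewrite addr0.
  apply=> y; last first.
    by under [X in _ - expect _ X]eq_fun do rewrite addr0; rewrite subrr normr0.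
  under [X in _ - expect _ X]eq_fun do rewrite addr0.
  exact: (two_point_smoothing (C2lip_shift y fL)).
have -> : \sum_(i < n.+1) s i ^+ 2 =
    s ord0 ^+ 2 + \sum_(i < n) s (lift ord0 i) ^+ 2 by rewrite big_ord_recl.
rewrite addrA; apply: le_trans (ler_distD _ _ _) _.
apply: le_trans (lerD H1 H2) _; rewrite le_eqVlt; apply/orP; left; apply/eqP.
rewrite [RHS]big_ord_recl; congr (_ + _).
  by rewrite [X in t ^+ 2 + X]big_pred0 // addr0 sqrtr_sqr gtr0_norm.
apply: eq_bigr => i _; congr (L * (_ / (_ * Num.sqrt _))).
by rewrite [in RHS]big_mkcond big_ord_recl /= -big_mkcond addrA.
Qed.

(** At the first law nothing has been smoothed yet, hence the cubic cost; its normal substitute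
    starts the smoothing with [t = s ord0]. *)
Lemma two_points_close n (s : 'I_n.+1 -> R) (L : R) (f f1 f2 : R -> R) :
  C2lip L f f1 f2 -> (forall i, 0 < s i) ->
  `|expect (convolution_law (fun i => two_point (s i) : law R)) f -
    expect (gaussian 0 (Num.sqrt (\sum_i s i ^+ 2))) f| <=
  L * (s ord0 ^+ 3 * (4 / c - 1) / 6) +
  \sum_(k < n.+1 | (0 < k)%N) L * (s k ^+ 4 / (6 * c *
    Num.sqrt (\sum_(j < n.+1 | (j < k)%N) s j ^+ 2))).
Proof.
move=> fL s0; have mf := C2lip_measurable fL.
have cf : continuous f by case: fL => _ fd _ _; exact: is_derive_cvg fd.
have [M fM] : exists M : R, forall x, `|f x| <= M by case: fL.
set W := convolution_law (fun i => two_point (s (lift ord0 i)) : law R).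
rewrite convolution_law_recl -/W.
have H1 : `|expect (convolution (two_point (s ord0)) W) f -
    expect (convolution (gaussian 0 (s ord0)) W) f| <=
    L * (s ord0 ^+ 3 * (4 / c - 1) / 6).
  have := @convolution_close R (two_point (s ord0))
    (gaussian 0 (s ord0)) W W f M 0 0 (L * (s ord0 ^+ 3 * (4 / c - 1) / 6)) 0 mf fM.
  rewrite !addr0; under [X in _ -> _ -> `|_ - expect _ X| <= _]eq_fun do rewrite addr0.
  apply=> y; last first.
    by under [X in _ - expect _ X]eq_fun do rewrite addr0; rewrite subrr normr0.
  under [X in _ - expect _ X]eq_fun do rewrite addr0.
  have yL := C2lip_shift y fL; have [_ E] := expect_two_point (s ord0) (C2lip_measurable yL).
  have cy : continuous (fun x => f (x + y)).
    by have := continuous_affine_comp (a := 1) (b := y) cf; under eq_fun do rewrite mul1r.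
  have E' : expect (gaussian 0 (s ord0)) (fun x => f (x + y)) =
      expect (gaussian 0 1) (fun z => f (s ord0 * z + y)).
    apply: (etrans (expect_gaussian 0 (s0 ord0) cy (fun x => fM (x + y)))).
    by congr expect; apply/funext => z; rewrite addr0.
  by rewrite E E'; exact: (gaussian_first_step yL (s0 ord0)).
have H2 := gaussian_two_points_close fL (s0 ord0) (fun i => s0 (lift ord0 i)).
rewrite -/W in H2.
have -> : \sum_(i < n.+1) s i ^+ 2 =
    s ord0 ^+ 2 + \sum_(i < n) s (lift ord0 i) ^+ 2 by rewrite big_ord_recl.
apply: le_trans (ler_distD _ _ _) _.
apply: le_trans (lerD H1 H2) _; rewrite le_eqVlt; apply/orP; left; apply/eqP.
congr (_ + _); rewrite [RHS]big_mkcond big_ord_recl /= add0r.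
apply: eq_bigr => i _; congr (L * (_ / (_ * Num.sqrt _))).
by rewrite [in RHS]big_mkcond big_ord_recl /= -big_mkcond.
Qed.

(** The mean of the [k] leading squares is at least the next square, hence at least the mean of all
    the remaining ones, hence at least the overall mean. Indices start at 0, so exactly [k] of them
    precede [k]. *)
Lemma ler_prefix_sum_sqr n (s : 'I_n -> R) (k : 'I_n) : (forall i, 0 <= s i) ->
  (forall i j : 'I_n, (i <= j)%N -> s j <= s i) ->
  k%:R * s k ^+ 2 <= \sum_(j < n | (j < k)%N) s j ^+ 2 /\
  k%:R * \sum_(j < n) s j ^+ 2 <= n%:R * \sum_(j < n | (j < k)%N) s j ^+ 2.
Proof.
move=> s0 mono; set T := \sum_(j < n | (j < k)%N) _.
have cnt a : \sum_(j < n | (j < k)%N) a = k%:R * a :> R.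
  by rewrite (big_ord_narrow (ltnW (ltn_ord k))) sumr_const card_ord mulr_natl.
have kT : k%:R * s k ^+ 2 <= T.
  rewrite -cnt; apply: ler_sum => j jk; rewrite lerXn2r ?nnegrE //.
  by apply: mono; exact: ltnW.
split=> //.
have tail : \sum_(j < n | ~~ (j < k)%N) s j ^+ 2 <= (n%:R - k%:R) * s k ^+ 2.
  have -> : (n%:R - k%:R) * s k ^+ 2 = \sum_(j < n | ~~ (j < k)%N) s k ^+ 2.
    have : \sum_(j < n) s k ^+ 2 = n%:R * s k ^+ 2.
      by rewrite sumr_const card_ord mulr_natl.
    rewrite [X in X = _](bigID (fun j : 'I_n => (j < k)%N)) /= cnt; lra.
  apply: ler_sum => j; rewrite -leqNgt => kj.
  by rewrite lerXn2r ?nnegrE //; exact: mono.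
have nk : 0 <= n%:R - k%:R :> R by rewrite subr_ge0 ler_nat ltnW.
rewrite (bigID (fun j : 'I_n => (j < k)%N)) /= -/T.
have := ler_wpM2l nk kT; have := ler_wpM2l (ler0n R k) tail; lra.
Qed.

End two_point_sums.

(** * The second inequality: two-point laws against the normal law *)

Section two_point_normal.
Context {R : realType}.

Lemma four_div_sqrt (p : R) : 0 < p ->
  4 / Num.sqrt (2 * p) = 2 * Num.sqrt (2 / p).
Proof.
move=> p0; have q0 : 0 < Num.sqrt (2 * p) by rewrite sqrtr_gt0 mulr_gt0.
have -> : 2 / p = (2 / Num.sqrt (2 * p)) ^+ 2.
  rewrite exprMn exprVn sqr_sqrtr ?mulr_ge0 ?(ltW p0) //; field; exact: lt0r_neq0.
by rewrite sqrtr_sqr gtr0_norm ?divr_gt0 // mulrA; congr (_ / _); ring.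
Qed.

Lemma zeta3_two_points_normal n (s : 'I_n.+1 -> R) (s0 : forall i, 0 < s i)
    (sigma := Num.sqrt (\sum_(i < n.+1) s i ^+ 2)) :
  (zeta3 (standardized_law (convolution_law (fun i => two_point (s i) : law R)))
     std_normal <=
   (1 / 6 * (2 * Num.sqrt (2 / pi) - 1) * (s ord0 ^+ 3 / sigma ^+ 3) +
    1 / (6 * Num.sqrt (2 * pi)) *
      \sum_(k < n.+1 | (0 < k)%N)
        s k ^+ 4 / Num.sqrt (\sum_(j < n.+1 | (j < k)%N) s j ^+ 2) /
        sigma ^+ 3)%:E)%E.
Proof.
have HQ := convolution_law_moments (fun i => two_point_moments (s i)).
rewrite big1_eq in HQ.
have sig0 : 0 < sigma.
  by rewrite sqrtr_gt0; exact: (sumr_sqr_gt0 _ (s0 ord0)).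
have sigN : sigma != 0 by rewrite gt_eqF.
apply: zeta3_le => f f1 f2 fL.
rewrite (expect_standardized _ fL) (has_moments_mean HQ) (has_moments_sd HQ) -/sigma.
have gL := C2lip_affine sigma^-1 0 fL; set L := 1 * `|sigma^-1| ^+ 3 in gL.
have LE : L = (sigma ^+ 3)^-1.
  by rewrite /L mul1r gtr0_norm ?invr_gt0 // exprVn.
set g := (fun x => f (sigma^-1 * x + 0)) in gL.
have -> : (fun x => f ((x - 0) / sigma)) = g.
  by apply/funext => x; rewrite /g; congr f; ring.
have cg : continuous g by case: gL => _ gd _ _; exact: is_derive_cvg gd.
have [M gM] : exists M : R, forall x, `|g x| <= M by case: gL.
have NE : expect std_normal f = expect (gaussian 0 sigma) g.
  apply/esym; apply: (etrans (expect_gaussian 0 sig0 cg gM)).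
  apply: (congr1 (expect (gaussian 0 1))); apply/funext => x.
  by rewrite /g !addr0 mulKf.
rewrite NE; apply: le_trans (two_points_close gL s0) _.
rewrite le_eqVlt; apply/orP; left; apply/eqP; rewrite LE.
have q0 := @sqrt_2pi_gt0 R; have q0N : Num.sqrt (2 * pi) != 0 :> R by rewrite gt_eqF.
have cE := four_div_sqrt (@pi_gt0 R).
rewrite cE; congr (_ + _); first by field.
rewrite mulr_sumr; apply: eq_bigr => k k0.
have T0 : 0 < \sum_(j < n.+1 | (j < k)%N) s j ^+ 2.
  by exact: (sumr_sqr_gt0 _ (s0 ord0)).
have TN : Num.sqrt (\sum_(j < n.+1 | (j < k)%N) s j ^+ 2) != 0.
  by apply: lt0r_neq0; rewrite sqrtr_gt0; exact: T0.
by field; rewrite q0N sigN TN.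
Qed.

(** With [T] the prefix sum, the two arguments of the minimum correspond to the two lower bounds
    [k * s k ^+ 2] and [k * sigma ^+ 2 / n] for [T]. *)
Lemma prefix_term_le n (s : 'I_n -> R) (k : 'I_n) (s0 : forall i, 0 < s i)
    (sigma := Num.sqrt (\sum_(i < n) s i ^+ 2)) :
  (0 < k)%N -> (forall i j : 'I_n, (i <= j)%N -> s j <= s i) ->
  s k ^+ 4 / Num.sqrt (\sum_(j < n | (j < k)%N) s j ^+ 2) / sigma ^+ 3 <=
  s k ^+ 3 * Num.min 1 (Num.sqrt n%:R * s k / sigma) /
    (sigma ^+ 3 * Num.sqrt k%:R).
Proof.
move=> k0 mono.
have [] := ler_prefix_sum_sqr k (fun i => ltW (s0 i)) mono.
set T := \sum_(j < n | _) _; set S := \sum_(j < n) _ => h1 h2.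
have kR : 0 < k%:R :> R by rewrite ltr0n.
have T0 : 0 < T by apply: lt_le_trans h1; rewrite mulr_gt0 // exprn_gt0.
have S0 : 0 < S by exact: (sumr_sqr_gt0 _ (s0 k)).
have sig0 : 0 < sigma by rewrite sqrtr_gt0.
have t0 : 0 < Num.sqrt T by rewrite sqrtr_gt0.
have rk0 : 0 < Num.sqrt k%:R :> R by rewrite sqrtr_gt0.
have {}h1 : Num.sqrt k%:R * s k <= Num.sqrt T.
  by rewrite -[s k]gtr0_norm // -sqrtr_sqr -sqrtrM ?(ltW kR) // ler_wsqrtr.
have {}h2 : Num.sqrt k%:R * sigma <= Num.sqrt n%:R * Num.sqrt T.
  by rewrite -!sqrtrM ?ler0n // ler_wsqrtr.
set m := Num.min _ _.
have h : s k * Num.sqrt k%:R <= m * Num.sqrt T.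
  rewrite /m minEle; case: ifP => _; first by rewrite mul1r mulrC.
  have -> : Num.sqrt n%:R * s k / sigma * Num.sqrt T =
      s k * (Num.sqrt n%:R * Num.sqrt T) / sigma by ring.
  by rewrite ler_pdivlMr // -mulrA ler_pM2l.
have -> : s k ^+ 4 / Num.sqrt T / sigma ^+ 3 =
    s k ^+ 3 / sigma ^+ 3 * (s k / Num.sqrt T).
  by field; rewrite !gt_eqF.
have -> : s k ^+ 3 * m / (sigma ^+ 3 * Num.sqrt k%:R) =
    s k ^+ 3 / sigma ^+ 3 * (m / Num.sqrt k%:R).
  by field; rewrite !gt_eqF.
rewrite ler_wpM2l ?divr_ge0 ?exprn_ge0 ?(ltW (s0 k)) ?(ltW sig0) //.
by rewrite ler_pdivrMr // mulrAC ler_pdivlMr.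
Qed.

End two_point_normal.

(* Indices are shifted by one: the laws are P 0, ..., P (n - 1). *)
Theorem theorem1p15 (R : realType) (n : nat) (n_gt0 : (0 < n)%N)
    (P : 'I_n -> law R) (P3 : forall i, in_P3 (P i)) :
  let s i := law_sd (P i) in
  let Q i : law R := two_point (s i) in
  let sigma := Num.sqrt (\sum_(i < n) s i ^+ 2) in
  let rho i := law_rho (P i) in
  let s1 := s (Ordinal n_gt0) in
  (zeta3 (standardized_law (convolution_law P)) std_normal <=
     (1 / (6 * sigma ^+ 3) * \sum_(i < n) s i ^+ 3 * Bfun (rho i))%:E +
     zeta3 (standardized_law (convolution_law Q)) std_normal)%E
  /\
  ((forall i j : 'I_n, (i <= j)%N -> s j <= s i) ->
   let bound :=
     1 / 6 * (2 * Num.sqrt (2 / pi) - 1) * (s1 ^+ 3 / sigma ^+ 3) +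
     1 / (6 * Num.sqrt (2 * pi)) *
       \sum_(k < n | (0 < k)%N)
         s k ^+ 3 * Num.min 1 (Num.sqrt n%:R * s k / sigma) /
         (sigma ^+ 3 * Num.sqrt k%:R) in
   (zeta3 (standardized_law (convolution_law Q)) std_normal <= bound%:E)%E
   /\
   bound <= 993 / 10000 * (s1 ^+ 3 / sigma ^+ 3) +
            665 / 10000 *
              \sum_(k < n | (0 < k)%N)
                s k ^+ 3 / (sigma ^+ 3 * Num.sqrt k%:R)).
Proof.
move=> s Q sigma rho s1; split; first exact: (zeta3_two_point_reduction n_gt0 P3).
move=> mono bound.
have s0 i : 0 < s i by have [] := P3_moments (P3 i).
have sig0 : 0 < sigma.
  by rewrite sqrtr_gt0; exact: (sumr_sqr_gt0 _ (s0 (Ordinal n_gt0))).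
have q0 := @sqrt_2pi_gt0 R.
split.
  have zeta : (zeta3 (standardized_law (convolution_law Q)) std_normal <=
     (1 / 6 * (2 * Num.sqrt (2 / pi) - 1) * (s1 ^+ 3 / sigma ^+ 3) +
      1 / (6 * Num.sqrt (2 * pi)) *
        \sum_(k < n | (0 < k)%N)
          s k ^+ 4 / Num.sqrt (\sum_(j < n | (j < k)%N) s j ^+ 2) /
          sigma ^+ 3)%:E)%E.
    move: @s @Q @sigma @s1 {rho mono bound sig0} s0.
    (* Writing the number of laws as a successor makes [ord0] available; it is the index
       [Ordinal n_gt0] of the statement. *)
    case: n n_gt0 P P3 => // n n_gt0' P' _ s Q sigma s1 s0.
    by rewrite /s1 (_ : Ordinal _ = ord0); [exact: zeta3_two_points_normal|exact/val_inj].
  apply: le_trans zeta _; rewrite lee_fin lerD2l ler_wpM2l ?divr_ge0 ?mulr_ge0 ?(ltW q0) //.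
  by apply: ler_sum => k k0; exact: prefix_term_le.
apply: lerD.
  rewrite ler_wpM2r ?normal_constant_le //.
  by apply: divr_ge0; apply: exprn_ge0; apply: ltW => //; exact: s0.
apply: ler_pM; first by rewrite divr_ge0 ?mulr_ge0 ?(ltW q0).
- apply: sumr_ge0 => k _; rewrite divr_ge0 ?mulr_ge0 ?exprn_ge0 ?(ltW sig0) ?(ltW (s0 k)) //.
  by rewrite le_min ler01 divr_ge0 ?mulr_ge0 ?(ltW sig0) ?(ltW (s0 k)).
- exact: smoothing_constant_le.
apply: ler_sum => k _; rewrite ler_wpM2r ?invr_ge0 ?mulr_ge0 ?exprn_ge0 ?(ltW sig0) //.
by rewrite ler_piMr ?exprn_ge0 ?(ltW (s0 k)) // ge_min lexx.
Qed.
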